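(* Let $G$ be a countable discrete group which is non-elementary and hyperbolic relative to some collection of proper subgroups (an NPRH group). Then the following are equivalent: (i) the reduced $C^*$-algebra $C^*_r(G)$ of $G$ is simple; (ii) the reduced $C^*$-algebra $C^*_r(G)$ of $G$ has a unique normalized trace; (iii) $G$ has infinite conjugacy classes; (iv) $G$ does not have non-trivial finite normal subgroups.
   Context: Reduced $C^*$-algebra: for a countable discrete group $G$, $\ell^2(G)$ is the Hilbert space of square-summable complex-valued functions on $G$, and $\lambda(g)f(h)=f(g^{-1}h)$ for $g,h\in G$, $f\in\ell^2(G)$, is the left regular representation. $C^*_r(G)$ is the operator norm closure of the linear span of $\{\lambda(g)\mid g\in G\}$ in the algebra $B(\ell^2(G))$ of bounded operators. It is simple if it has no non-trivial two-sided ideals. Normalized trace: on a unital $C^*$-algebra $A$, a linear map $\sigma:A\to\mathbb C$ with $\sigma(1)=1$, $\sigma(a^*a)\ge0$ and $\sigma(ab)=\sigma(ba)$ for all $a,b\in A$. Infinite conjugacy classes: $G$ has infinite conjugacy classes (is icc) if it is infinite and all its conjugacy classes distinct from $\{1\}$ are infinite. Elementary: a group is elementary if it has a cyclic subgroup of finite index (in particular finite groups are elementary); otherwise it is non-elementary. Relative hyperbolicity (Osin's definition): Let $G$ be a group, $\{H_\lambda\}_{\lambda\in\Lambda}$ a collection of subgroups of $G$ (called peripheral subgroups) and $X\subseteq G$ a subset, which for convenience is assumed to satisfy $X^{-1}=X$. $X$ is a relative generating set of $G$ with respect to $\{H_\lambda\}_{\lambda\in\Lambda}$ if $G$ is generated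 by $X\cup\bigcup_{\lambda}H_\lambda$. Then $G$ is a quotient of $\mathcal F=(\ast_{\lambda\in\Lambda}H_\lambda)*F(X)$, where $F(X)$ is the free group with basis $X$. If $\mathcal R\subseteq \mathcal F$ is such that the kernel of the natural epimorphism $\mathcal F\to G$ is the normal closure of $\mathcal R$ in $\mathcal F$, one says $G$ has the relative presentation $\langle X,\{H_\lambda\}_{\lambda\in\Lambda}\mid R=1,\ R\in\mathcal R\rangle$; it is finite if $X$ and $\mathcal R$ are finite. Put $\mathcal H=\bigsqcup_{\lambda\in\Lambda}(H_\lambda\setminus\{1\})$. A finite relative presentation satisfies a linear relative isoperimetric inequality if there is $C>0$ such that every word $w$ in the alphabet $X\cup\mathcal H$ representing $1$ in $G$ can be written, with equality in $\mathcal F$, as $w=\prod_{i=1}^k f_i^{-1}R_i^{\pm1}f_i$ with $R_i\in\mathcal R$, $f_i\in \mathcal F$ and $k\le C\|w\|$, where $\|w\|$ is the length of the word $w$. The group $G$ is hyperbolic relative to $\{H_\lambda\}_{\lambda\in\Lambda}$ if it admits a finite relative presentation satisfying a linear relative isoperimetric inequality. The collection consists of proper subgroups if $H_\lambda\ne G$ for all $\lambda\in\Lambda$. *)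

(* Defs.v *)
From HB Require Import structures.
From mathcomp Require Import all_boot all_order all_algebra generic_quotient.
From mathcomp Require Import all_classical all_reals all_analysis complex.
From mathcomp Require Import showcase.summability.
From mathcomp Require Import ring.

Set Implicit Arguments.
Unset Strict Implicit.
Unset Printing Implicit Defensive.

Import Order.TTheory GRing.Theory Num.Theory.
Import numFieldNormedType.Exports.
Import ComplexField.Normc.

Local Open Scope classical_set_scope.
Local Open Scope complex_scope.
Local Open Scope quotient_scope.
Local Open Scope ring_scope.

Section Ell2.
Variables (R : realType) (G : groupType).

Definition sqnorm (f : G -> R[i]) : \bar R :=
  \esum_(g in [set: G]) (normc (f g) ^+ 2)%:E.

Definition square_summable : {pred G -> R[i]} :=
  fun f => `[< (sqnorm f < +oo)%E >].

Lemma square_summableP (f : G -> R[i]) :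
  f \in square_summable <-> (sqnorm f < +oo)%E.
Proof. by rewrite unfold_in; split => /asboolP. Qed.

Lemma sqnorm_ge0 (f : G -> R[i]) : (0 <= sqnorm f)%E.
Proof. by apply: esum_ge0 => x _; rewrite lee_fin sqr_ge0. Qed.

Lemma normc_sqr (z : R[i]) : normc z ^+ 2 = complex.Re z ^+ 2 + complex.Im z ^+ 2.
Proof. by case: z => a b /=; rewrite sqr_sqrtr// addr_ge0// sqr_ge0. Qed.

Lemma sqnormD (f g : G -> R[i]) :
  (sqnorm (f \+ g)%R <= (sqnorm f + sqnorm g) + (sqnorm f + sqnorm g))%E.
Proof.
have p h x : (0 <= (normc (h x : R[i]) ^+ 2)%:E)%E by rewrite lee_fin sqr_ge0.
rewrite /sqnorm -!esumD; do ?[by move=> *; rewrite ?adde_ge0 ?p].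
apply: le_esum => x _; rewrite -!EFinD lee_fin !normc_sqr /=.
case: (f x) (g x) => [a b] [c d] /=.
rewrite -subr_ge0; set e := (X in 0 <= X).
have -> : e = (a - c) ^+ 2 + (b - d) ^+ 2 by rewrite /e; ring.
by rewrite addr_ge0 ?sqr_ge0.
Qed.

Lemma sqnormZ (c : R[i]) (f : G -> R[i]) :
  (sqnorm (c \*: f)%R <= (normc c ^+ 2)%:E * sqnorm f)%E.
Proof.
apply: ge_ereal_sup => _ [A [finA _] <-].
under eq_fsbigr do rewrite normcM exprMn EFinM.
rewrite -ge0_mule_fsumr; last by move=> x; rewrite lee_fin sqr_ge0.
rewrite lee_wpmul2l ?lee_fin ?sqr_ge0//.
by apply: ereal_sup_ubound; exists A.
Qed.

Lemma square_summable_submod : submod_closed square_summable.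
Proof.
split=> [|c f g /square_summableP fS /square_summableP gS].
  apply/square_summableP; rewrite /sqnorm esum1// => x _.
  by have -> : (0 : G -> R[i]) x = 0 by []; rewrite normc0 expr0n.
apply/square_summableP; apply: le_lt_trans (sqnormD _ _) _.
have cfS : (sqnorm (c \*: f)%R < +oo)%E.
  apply: le_lt_trans (sqnormZ _ _) _.
  by rewrite lte_mul_pinfty// lee_fin sqr_ge0.
by rewrite !lte_add_pinfty.
Qed.

HB.instance Definition _ :=
  GRing.isSubmodClosed.Build R[i] (G -> R[i]) square_summable
    square_summable_submod.

Record ell2 := Ell2 { ell2_fun :> G -> R[i]; _ : ell2_fun \in square_summable }.

HB.instance Definition _ := [isSub for ell2_fun].
HB.instance Definition _ := [Choice of ell2 by <:].
HB.instance Definition _ := [SubChoice_isSubLmodule of ell2 by <:].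

Definition ell2_norm (f : ell2) : R := Num.sqrt (fine (sqnorm f)).

Definition ell2_dot (f h : ell2) : R[i] :=
  sum (fun g => f g * (h g)^*%C : R[i]^o).

Definition translate (g : G) (f : G -> R[i]) : G -> R[i] :=
  fun h => f (g^-1 * h)%g.

Lemma translate_square_summable (g : G) (f : ell2) :
  translate g f \in square_summable.
Proof.
apply/square_summableP; case: f => f /= /square_summableP.
rewrite /sqnorm (@reindex_esum _ _ _ setT setT (fun h => g^-1 * h)%g)//.
split=> // [x y _ _ /mulgI//|y _].
by exists (g * y)%g; rewrite // mulKg.
Qed.

Definition left_regular (g : G) (f : ell2) : ell2 :=
  Ell2 (translate_square_summable g f).
End Ell2.

(* Operators are functions from [ell2 R G] to itself, with the pointwise linear
   structure, composition as product and [id] as unit. *)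
Section Operators.
Variables (R : realType) (G : groupType).
Local Notation E := (ell2 R G).
Implicit Types (a b : E -> E) (A I : set (E -> E)) (sigma : (E -> E) -> R[i]).

Definition bounded_op : set (E -> E) :=
  [set a | linear a /\
    exists M : R, forall f, ell2_norm (a f) <= M * ell2_norm f].

Definition op_norm a : R :=
  sup [set ell2_norm (a f) | f in [set f | ell2_norm f <= 1]].

Definition op_adjoint a b : Prop :=
  forall f h, ell2_dot (a f) h = ell2_dot f (b h).

Definition op_closure A : set (E -> E) :=
  [set a | bounded_op a /\
    forall e : R, 0 < e -> exists2 b, A b & op_norm (a - b) < e].

Definition left_regular_span : set (E -> E) :=
  [set a | exists s : seq (R[i] * G),
    a = \sum_(p <- s) p.1 *: @left_regular R G p.2].

Definition reduced_Cstar : set (E -> E) := op_closure left_regular_span.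

Definition two_sided_ideal A I : Prop :=
  [/\ I `<=` A, I 0,
      forall (c : R[i]) a b, I a -> I b -> I (c *: a + b) &
      forall a b, A a -> I b -> I (a \o b) /\ I (b \o a)].

Definition simple_algebra A : Prop :=
  forall I, two_sided_ideal A I -> I = [set 0] \/ I = A.

(* A trace on [A] is encoded as a function on all maps, of which only the values
   on [A] matter. The adjoint enters as a relation: every bounded operator has
   exactly one adjoint. *)
Definition normalized_trace A sigma : Prop :=
  [/\ forall (c : R[i]) a b, A a -> A b ->
        sigma (c *: a + b) = c * sigma a + sigma b,
      sigma id = 1,
      forall a a', A a -> A a' -> op_adjoint a a' -> 0 <= sigma (a' \o a) &
      forall a b, A a -> A b -> sigma (a \o b) = sigma (b \o a)].

Definition has_unique_trace A : Prop :=
  exists2 sigma, normalized_trace A sigma &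
    forall tau, normalized_trace A tau -> forall a, A a -> tau a = sigma a.
End Operators.
Arguments reduced_Cstar R G : clear implicits.

Section Groups.
Variable G : groupType.
Implicit Types (K N S : set G).
Local Open Scope group_scope.

Definition subgroup K : Prop := group_closed [in K].

Record subgroupType := Subgroup {
  subgroup_set :> set G;
  subgroup_setP : subgroup subgroup_set }.

Definition normal_subgroup N : Prop :=
  subgroup N /\ forall x g, N x -> N (x ^ g).

Definition generated S : set G := smallest subgroup S.

Definition normal_closure S : set G := smallest normal_subgroup S.

Definition finite_index K : Prop :=
  finite_set (range (fun x => [set x * k | k in K])).

Definition elementary : Prop := exists g, finite_index (generated [set g]).

Definition icc : Prop :=
  infinite_set [set: G] /\
  forall x : G, x != 1 -> infinite_set (range (fun g => x ^ g)).

Definition no_nontrivial_finite_normal_subgroup : Prop :=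
  forall N, normal_subgroup N -> finite_set N -> N = [set 1].
End Groups.

Section FreeProduct.
Variables (G : groupType) (Lambda : Type).
Variables (H : Lambda -> subgroupType G) (X : set G).
Local Open Scope group_scope.

(* [FpGen x true] stands for the basis element [x] of the free group on [X] and
   [FpGen x false] for its formal inverse, which is unrelated to the basis
   element given by the inverse of [x] in [G]. *)
Inductive fp_letter :=
| FpGen of set_type X & bool
| FpPer l of set_type (H l).

Inductive fp_eq : seq fp_letter -> seq fp_letter -> Prop :=
| fp_refl u : fp_eq u u
| fp_sym u v : fp_eq u v -> fp_eq v u
| fp_trans u v w : fp_eq u v -> fp_eq v w -> fp_eq u w
| fp_cat u u' v v' : fp_eq u u' -> fp_eq v v' -> fp_eq (u ++ v) (u' ++ v')
| fp_gen x b : fp_eq [:: FpGen x b; FpGen x (~~ b)] [::]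
| fp_per1 l (h : set_type (H l)) : val h = 1 -> fp_eq [:: FpPer h] [::]
| fp_perM l (h k m : set_type (H l)) : val m = val h * val k ->
    fp_eq [:: FpPer h; FpPer k] [:: FpPer m].

Let fp_eqb (u v : {classic seq fp_letter}) : bool := `[< fp_eq u v >].

Lemma fp_eqb_equiv : equiv_class_of fp_eqb.
Proof.
split=> [u|u v|v u w]; rewrite /fp_eqb.
- by apply/asboolP; exact: fp_refl.
- by apply/asboolP/asboolP; exact: fp_sym.
- by move=> /asboolP uv /asboolP vw; apply/asboolP; apply: fp_trans vw.
Qed.

Definition fp_equiv_rel := EquivRelPack fp_eqb_equiv.

Definition free_product := {eq_quot fp_equiv_rel}.
HB.instance Definition _ := Choice.on free_product.

Definition fp_class (u : seq fp_letter) : free_product :=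
  \pi_{eq_quot fp_equiv_rel} (u : {classic seq fp_letter}).

Definition fp_word (f : free_product) : seq fp_letter :=
  repr (f : {eq_quot fp_equiv_rel}).

Lemma fp_wordK f : fp_class (fp_word f) = f.
Proof. exact: reprK. Qed.

Lemma fp_classP u v : fp_class u = fp_class v <-> fp_eq u v.
Proof.
rewrite /fp_class; split=> [/eqmodP /asboolP//|uv].
by apply/eqmodP/asboolP.
Qed.

Lemma fp_classK u : fp_eq (fp_word (fp_class u)) u.
Proof. by apply/fp_classP; rewrite fp_wordK. Qed.

Definition per_elt l x (Hx : x \in (H l : set G)) : set_type (H l) :=
  exist _ x Hx.

Lemma per_invP l (h : set_type (H l)) : (val h)^-1 \in (H l : set G).
Proof.
case: (subgroup_setP (H l)) => H1 HV; rewrite -[_^-1]mul1g.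
by apply: HV => //; exact: (valP h).
Qed.

Definition fp_inv_letter (a : fp_letter) : fp_letter :=
  match a with
  | FpGen x b => FpGen x (~~ b)
  | FpPer l h => FpPer (per_elt (per_invP h))
  end.

Definition fp_inv_word (u : seq fp_letter) := rev (map fp_inv_letter u).

Lemma fp_letterV a : fp_eq [:: fp_inv_letter a; a] [::].
Proof.
case: a => [x b|l h] /=.
  by rewrite -[in FpGen x b](negbK b); exact: fp_gen.
have one_H : 1 \in (H l : set G) by case: (subgroup_setP (H l)).
pose e : set_type (H l) := per_elt one_H.
by apply: (@fp_trans _ [:: FpPer e]); [apply: fp_perM; rewrite /= mulVg|apply: fp_per1].
Qed.

Lemma fp_letterVr a : fp_eq [:: a; fp_inv_letter a] [::].
Proof.
case: a => [x b|l h] /=; first exact: fp_gen.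
have one_H : 1 \in (H l : set G) by case: (subgroup_setP (H l)).
pose e : set_type (H l) := per_elt one_H.
by apply: (@fp_trans _ [:: FpPer e]); [apply: fp_perM; rewrite /= mulgV|apply: fp_per1].
Qed.

Lemma fp_mid u v w : fp_eq v [::] -> fp_eq (u ++ v ++ w) (u ++ w).
Proof.
move=> v0; apply: fp_cat; first exact: fp_refl.
by rewrite -[w in X in fp_eq _ X]cat0s; apply: fp_cat => //; exact: fp_refl.
Qed.

Lemma fp_wordVl u : fp_eq (fp_inv_word u ++ u) [::].
Proof.
elim: u => [|a u IH]; first exact: fp_refl.
rewrite /fp_inv_word /= rev_cons cat_rcons.
apply: fp_trans IH.
exact: (@fp_mid (fp_inv_word u) [:: fp_inv_letter a; a] u (fp_letterV a)).
Qed.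

Lemma fp_wordVr u : fp_eq (u ++ fp_inv_word u) [::].
Proof.
elim/last_ind: u => [|u a IH]; first exact: fp_refl.
rewrite /fp_inv_word map_rcons rev_rcons cat_rcons.
apply: fp_trans IH.
exact: (@fp_mid u [:: a; fp_inv_letter a] _ (fp_letterVr a)).
Qed.

Lemma fp_inv_cat u v : fp_inv_word (u ++ v) = fp_inv_word v ++ fp_inv_word u.
Proof. by rewrite /fp_inv_word map_cat rev_cat. Qed.

Definition fp_one := fp_class [::].
Definition fp_mul f g := fp_class (fp_word f ++ fp_word g).
Definition fp_inv f := fp_class (fp_inv_word (fp_word f)).

Lemma fp_mulA : associative fp_mul.
Proof.
move=> f g h; apply/fp_classP.
apply: (@fp_trans _ (fp_word f ++ (fp_word g ++ fp_word h))).
  by apply: fp_cat; [exact: fp_refl|exact: fp_classK].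
rewrite catA; apply: fp_sym.
by apply: fp_cat; [exact: fp_classK|exact: fp_refl].
Qed.

Lemma fp_mul1 : left_id fp_one fp_mul.
Proof.
move=> f; rewrite -[RHS]fp_wordK; apply/fp_classP.
by rewrite -[X in fp_eq _ X]cat0s; apply: fp_cat; [exact: fp_classK|exact: fp_refl].
Qed.

Lemma fp_mulr1 : right_id fp_one fp_mul.
Proof.
move=> f; rewrite -[RHS]fp_wordK; apply/fp_classP.
by rewrite -[X in fp_eq _ X]cats0; apply: fp_cat; [exact: fp_refl|exact: fp_classK].
Qed.

Lemma fp_mulV : left_inverse fp_one fp_inv fp_mul.
Proof.
move=> f; apply/fp_classP; apply: fp_trans (fp_wordVl (fp_word f)).
by apply: fp_cat; [exact: fp_classK|exact: fp_refl].
Qed.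

Lemma fp_mulVr : right_inverse fp_one fp_inv fp_mul.
Proof.
move=> f; apply/fp_classP; apply: fp_trans (fp_wordVr (fp_word f)).
by apply: fp_cat; [exact: fp_refl|exact: fp_classK].
Qed.

HB.instance Definition _ :=
  isGroup.Build free_product fp_mulA fp_mul1 fp_mulr1 fp_mulV fp_mulVr.

Definition fp_letter_val (a : fp_letter) : G :=
  match a with
  | FpGen x b => if b then val x else (val x)^-1
  | FpPer l h => val h
  end.

Definition fp_word_val (u : seq fp_letter) : G := \prod_(a <- u) fp_letter_val a.

Lemma fp_word_val_eq u v : fp_eq u v -> fp_word_val u = fp_word_val v.
Proof.
rewrite /fp_word_val; elim=> {u v} //.
- by move=> u v w _ -> _.
- by move=> u u' v v' _ e _ e'; rewrite !big_cat /= e e'.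
- by move=> x [] /=; rewrite !big_cons !big_nil mulg1 (mulgV, mulVg).
- by move=> l h h1; rewrite big_cons !big_nil mulg1 /= h1.
- by move=> l h k m e; rewrite !big_cons !big_nil !mulg1 /= e.
Qed.

Definition fp_epi (f : free_product) : G := fp_word_val (fp_word f).

Lemma fp_epi_class u : fp_epi (fp_class u) = fp_word_val u.
Proof. exact/fp_word_val_eq/fp_classK. Qed.

Lemma fp_epiM : {morph fp_epi : f g / f * g}.
Proof. by move=> f g; rewrite [LHS]fp_epi_class /fp_word_val big_cat. Qed.

Lemma fp_epi1 : fp_epi 1 = 1.
Proof. by rewrite [LHS]fp_epi_class /fp_word_val big_nil. Qed.

HB.instance Definition _ :=
  isUMagmaMorphism.Build free_product G fp_epi (fp_epi1, fp_epiM).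

Definition rel_letter : Type :=
  (set_type X + {l : Lambda & set_type (H l `\` [set 1])})%type.

Lemma rel_perP l (h : set_type (H l `\` [set 1])) : val h \in (H l : set G).
Proof. by have := valP h; rewrite !inE => -[]. Qed.

Definition rel_letter_fp (a : rel_letter) : free_product :=
  match a with
  | inl x => fp_class [:: FpGen x true]
  | inr (existT l h) =>
      fp_class [:: FpPer (per_elt (rel_perP h))]
  end.

Definition rel_word_fp (w : seq rel_letter) : free_product :=
  \prod_(a <- w) rel_letter_fp a.

(* Each item (f, r, e) of [s] contributes the conjugate by [f] of the relator
   [r], inverted when [e] is false. *)
Definition relator_product (s : seq (free_product * free_product * bool)) :
  free_product :=
  \prod_(c <- s) (c.1.1^-1 * (if c.2 then c.1.2 else c.1.2^-1) * c.1.1).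

Definition relative_generating : Prop :=
  generated (X `|` \bigcup_l (H l : set G)) = [set: G].

Definition relative_presentation (Rel : set free_product) : Prop :=
  relative_generating /\ [set f | fp_epi f = 1] = normal_closure Rel.

(* The field [R] is only the range of the isoperimetric constant. *)
Definition linear_isoperimetric (R : realType) (Rel : set free_product) : Prop :=
  exists2 C : R, (0 < C)%R &
    forall w : seq rel_letter, fp_epi (rel_word_fp w) = 1 ->
    exists s : seq (free_product * free_product * bool),
      [/\ forall c, c \in s -> Rel c.1.2,
          rel_word_fp w = relator_product s &
          ((size s)%:R <= C * (size w)%:R)%R].
End FreeProduct.

Definition relatively_hyperbolic (R : realType) (G : groupType)
    (Lambda : Type) (H : Lambda -> subgroupType G) : Prop :=
  exists (X : set G) (Rel : set (free_product H X)),
    [/\ finite_set X, forall x, X x -> X x^-1%g, finite_set Rel,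
        relative_presentation Rel & linear_isoperimetric R Rel].

(* Main.v *)
(* (iv) => (i), (ii): let [l] be the word length of [G] over [X] and the peripheral
   subgroups. A path that avoids the ball of radius [r] about a point of a geodesic
   is at least quadratic in [r] in length: integrate a 1-form supported in that ball
   along the loop and compare with the linear isoperimetric inequality. Hence
   triangles are thin, and the four-point condition holds. Weights supported on a
   single peripheral coset show in the same way that [l] is unbounded and that the
   action of [G] on itself is acylindrical enough to make bounded-displacement
   elements a finite normal subgroup, hence trivial. So [G] is icc, and any finite
   set of non-trivial elements can be conjugated to elements that are long in a
   direction transverse to a loxodromic element, which gives Powers' property. It
   makes the averages of [lambda x], [x != 1], over suitable conjugates arbitrarily
   small in norm, so that averages of [a] converge to [tr a]. Therefore a non-zero
   ideal contains an invertible element, and every trace is [tr].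

   (i), (ii) => (iv): the average [p] of [lambda] over a finite normal subgroup [N]
   is a central projection; it generates a proper ideal, and [a |-> #|N| tr (p a)] is
   a second trace, unless [N] is trivial. *)

(* In the graph of the relative length every peripheral coset has diameter at most one, so balls may
   be infinite and no finiteness can be read off them. What is finite is the set of peripheral
   letters that occur in the relators. Take a function on a coset that changes by at most one under
   these letters: its changes along the edges of the coset, added up over a loop, are bounded
   linearly by the length of the loop, whatever the rest of the peripheral subgroup looks like. This
   estimate yields the unboundedness of the length and also weak proper discontinuity, the
   substitute for properness behind the later finiteness arguments. Van Kampen diagrams are avoided
   by integer weights on paths: a conjugate of a relator has the weight of the relator at another
   base point. On the analytic side a trace is assumed positive but not continuous. Continuity is
   recovered from a square root of [id - a] for small self-adjoint [a]; this is why completeness,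
   adjoints and limits inside the algebra are developed. The constants lost there are harmless. *)
Require Import Defs.
From mathcomp Require Import all_boot all_order all_algebra finmap.
From mathcomp Require Import all_classical all_reals all_analysis complex.
From mathcomp Require Import showcase.summability zify ring lra.
Set Implicit Arguments.
Unset Strict Implicit.
Unset Printing Implicit Defensive.
Local Open Scope classical_set_scope.

(* Copies of the group operations at a fixed carrier: canonical instances reach
   [mul] along several paths, which [lia] would treat as different atoms. *)
Section Operations.
Variable G : groupType.
Definition gone : G := 1%g.
Definition gmul (x y : G) : G := (x * y)%g.
Definition ginv (x : G) : G := (x^-1)%g.
Definition gexp (x : G) n : G := (x ^+ n)%g.
End Operations.
Arguments gone {G}.

Declare Scope gops_scope.
Delimit Scope gops_scope with h.
Arguments gmul {G} (x y)%_h.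
Arguments ginv {G} x%_h.
Arguments gexp {G} x%_h n%_N.
Notation "1" := gone : gops_scope.
Notation "x * y" := (gmul x y) : gops_scope.
Notation "x ^-1" := (ginv x) : gops_scope.
Notation "x ^+ n" := (gexp x n) : gops_scope.

Section OperationsTheory.
Variable G : groupType.
Implicit Types x y z : G.
Lemma gmulA x y z : (x * (y * z))%h = (x * y * z)%h. Proof. exact: mulgA. Qed.
Lemma gmul1 x : (x * 1)%h = x. Proof. exact: mulg1. Qed.
Lemma gmul1l x : (1 * x)%h = x. Proof. exact: mul1g. Qed.
Lemma gmulV x : (x * x^-1)%h = 1%h. Proof. exact: mulgV. Qed.
Lemma gmulVl x : (x^-1 * x)%h = 1%h. Proof. exact: mulVg. Qed.
Lemma gmulK y x : (x * y * y^-1)%h = x. Proof. exact: mulgK. Qed.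
Lemma gmulVK y x : (x * y^-1 * y)%h = x. Proof. exact: mulgVK. Qed.
Lemma ginvK x : (x^-1^-1)%h = x. Proof. exact: invgK. Qed.
Lemma ginvM x y : ((x * y)^-1)%h = (y^-1 * x^-1)%h. Proof. exact: invgM. Qed.
Lemma ginv1 : (1^-1)%h = 1%h :> G. Proof. exact: invg1. Qed.
Lemma gexp0 x : (x ^+ 0)%h = 1%h. Proof. by []. Qed.
Lemma gexp1 x : (x ^+ 1)%h = x. Proof. by []. Qed.
Lemma gexpS x n : (x ^+ n.+1)%h = (x * x ^+ n)%h. Proof. exact: expgS. Qed.
Lemma gexpSr x n : (x ^+ n.+1)%h = (x ^+ n * x)%h. Proof. exact: expgSr. Qed.
Lemma gexpD x m n : (x ^+ (m + n))%h = (x ^+ m * x ^+ n)%h. Proof. exact: expgnDr. Qed.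
Lemma gexpV x n : (x^-1 ^+ n)%h = ((x ^+ n)^-1)%h. Proof. exact: expVgn. Qed.
Lemma gmulI x y z : (x * y)%h = (x * z)%h -> y = z. Proof. exact: mulgI. Qed.
End OperationsTheory.

Opaque gone gmul ginv gexp.

(** * Geodesics, paths around a ball, and triangles for an integer-valued length *)

Section GeodesicLength.
Variable G : groupType.
Implicit Types (g h o p q u x y z w : G).

Definition dist (l : G -> nat) (x y : G) : nat := l (x^-1 * y)%h.

Record geodesic_length (l : G -> nat) : Prop := GeodesicLength {
  len1 : l 1%h = 0;
  lenV : forall g : G, l g^-1%h = l g;
  lenM : forall g h : G, l (g * h)%h <= l g + l h;
  len_geodesic : forall (g : G) i, i <= l g ->
    exists p q : G, [/\ g = (p * q)%h, l p = i & l q = l g - i];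
  len_eq1 : forall g : G, l g = 0 -> g = 1%h }.

Variable l : G -> nat.
Hypothesis gl : geodesic_length l.
Local Notation d := (dist l).

(** Rewriting with these rules brackets products to the left and cancels adjacent inverses. *)
Definition gE := (@ginvM, @ginvK, @gmulA, @gmulK, @gmulVK, @gmulVl, @gmulV,
  @gmul1, @gmul1l, @ginv1).

Lemma distC x y : d x y = d y x.
Proof. by rewrite /dist -(lenV gl) !gE. Qed.

Lemma distMl g x y : d (g * x)%h (g * y)%h = d x y.
Proof. by rewrite /dist !gE. Qed.

Lemma dist_triangle x y z : d x z <= d x y + d y z.
Proof. by rewrite /dist; apply: leq_trans (lenM gl _ _); rewrite !gE. Qed.

Lemma dist1 x : d 1%h x = l x.
Proof. by rewrite /dist !gE. Qed.

Lemma dist1r x : d x 1%h = l x.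
Proof. by rewrite distC dist1. Qed.

Lemma distxx x : d x x = 0.
Proof. by rewrite /dist gmulVl (len1 gl). Qed.

Lemma dist_eq0 x y : d x y = 0 -> x = y.
Proof.
move=> /(len_eq1 gl) e; have := congr1 (fun z => x * z)%h e.
by rewrite !gE.
Qed.

Definition geodesic (c : nat -> G) x y : Prop :=
  [/\ c 0 = x, c (d x y) = y &
      forall i j, i <= j -> j <= d x y -> d (c i) (c j) = j - i].

Lemma exists_geodesic x y : exists c, geodesic c x y.
Proof.
have [n] := ubnP (d x y); elim: n y => // n IH y; rewrite ltnS => xyn.
case dxy: (d x y) => [|m].
  have <- := dist_eq0 dxy; exists (fun=> x); split=> // i j ij; rewrite !distxx.
  by rewrite leqn0 => /eqP j0; move: ij; rewrite j0 leqn0 => /eqP ->.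
have [p [q [e lp lq]]] : exists p q, [/\ (x^-1 * y)%h = (p * q)%h, l p = m &
    l q = d x y - m] by apply: (len_geodesic gl); rewrite -[l _]/(d x y) dxy.
pose z := (x * p)%h.
have dxz : d x z = m by rewrite /z /dist !gE.
have dzy : d z y = 1.
  have -> : y = (x * (p * q))%h by rewrite -e !gE.
  by rewrite /z /dist !gE lq dxy subSnn.
have [|c [c0 cm cd]] := IH z; first by rewrite dxz; lia.
rewrite dxz in cm cd.
exists (fun i => if i <= m then c i else y); split => //.
  by rewrite dxy ltnn.
move=> i j ij; rewrite dxy => jm.
have [jm'|jm'] := leqP j m; first by rewrite (leq_trans ij jm') cd.
have [im|im] := leqP i m; last by rewrite distxx; lia.
have dim := cd i m im (leqnn m); rewrite cm in dim.
have d0i := cd 0 i (leq0n i) im; rewrite c0 in d0i.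
have := dist_triangle (c i) z y; have := dist_triangle x (c i) y; lia.
Qed.

Definition avoid o r x y n : Prop := exists c : nat -> G,
  [/\ c 0 = x, c n = y, forall i, i < n -> d (c i) (c i.+1) <= 1 &
      forall i, i <= n -> r <= d o (c i)].

Lemma avoid_sym o r x y n : avoid o r x y n -> avoid o r y x n.
Proof.
move=> [c [c0 cn cs ca]]; exists (fun i => c (n - i)); split.
- by rewrite subn0.
- by rewrite subnn.
- move=> i ni; rewrite distC; have -> : n - i = (n - i.+1).+1 by lia.
  by apply: cs; lia.
- by move=> i ni; apply: ca; lia.
Qed.

Lemma avoid_cat o r x y z m n :
  avoid o r x y m -> avoid o r y z n -> avoid o r x z (m + n).
Proof.
move=> [c [c0 cn cs ca]] [c' [c'0 c'n c's c'a]].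
exists (fun i => if i <= m then c i else c' (i - m)); split => //.
- have [|_] := leqP (m + n) m; last by rewrite addKn.
  rewrite -{2}[m]addn0 leq_add2l leqn0 => /eqP n0.
  by rewrite n0 addn0 cn -c'n n0 c'0.
- move=> i imn; have [im|im] := leqP i.+1 m; first by rewrite (ltnW im); apply: cs.
  have [im'|im'] := leqP i m.
    have -> : i = m by lia.
    rewrite cn -c'0 subSnn; apply: c's; lia.
  by rewrite subSn; [apply: c's|]; lia.
- move=> i imn; have [im|im] := leqP i m; [exact: ca|apply: c'a]; lia.
Qed.

Lemma avoid_geodesic o r c x y i j : geodesic c x y -> i <= j -> j <= d x y ->
  (forall k, i <= k <= j -> r <= d o (c k)) -> avoid o r (c i) (c j) (j - i).
Proof.
move=> [_ _ cd] ij jN ca; exists (fun k => c (i + k)); split.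
- by rewrite addn0.
- by rewrite subnKC.
- by move=> k kij; rewrite cd; lia.
- by move=> k kij; apply: ca; lia.
Qed.

(** A geodesic from [x] stays within [d x y] of [x], too close to [x] to come within [r] of [o]. *)
Lemma avoid_short o r x y : r + d x y <= d o x -> avoid o r x y (d x y).
Proof.
move=> rxy; have [c cg] := exists_geodesic x y; have [c0 cn cd] := cg.
rewrite -{1}c0 -{1}cn -[X in avoid _ _ _ _ X]subn0.
apply: (avoid_geodesic cg) => // k /andP[_ kn].
have := cd 0 k (leq0n k) kn; rewrite c0.
have := dist_triangle o (c k) x; rewrite (distC (c k) x); lia.
Qed.

(** The bound [n] on the perimeter makes the condition hold trivially for large [t], which gives a
    starting point from which [t] can be lowered one unit at a time. *)
Definition thin n t : Prop := forall x y z c1 c2 c3,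
  geodesic c1 x y -> geodesic c2 x z -> geodesic c3 z y ->
  d x y + d x z + d z y <= n -> forall i, i <= d x y ->
  (exists2 j, j <= d x z & d (c1 i) (c2 j) <= t) \/
  (exists2 j, j <= d z y & d (c1 i) (c3 j) <= t).

Lemma geodesic_drop c x y j : geodesic c x y -> j <= d x y ->
  geodesic (fun k => c (j + k)) (c j) y.
Proof.
move=> [c0 cn cd] jn.
have dj : d (c j) y = d x y - j by rewrite -{1}cn cd.
split; first by rewrite addn0.
  by rewrite dj subnKC.
by move=> i k ik; rewrite dj => kn; rewrite cd; lia.
Qed.

Lemma geodesic_rev_take c x y j : geodesic c x y -> j <= d x y ->
  geodesic (fun k => c (j - k)) (c j) x.
Proof.
move=> [c0 cn cd] jn.
have dj : d (c j) x = j by rewrite distC -{1}c0 cd // subn0.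
split; first by rewrite subn0.
  by rewrite dj subnn.
by move=> i k ik; rewrite dj => kn; rewrite distC cd; lia.
Qed.

(* Away from its apex the triangle [z], [c2 j], [c3 j'] is long: follow [c2] for
   [8 * T] steps, cross to [c3] there, too far from [o] to come near it, and
   return along [c3]. *)
Lemma detour n T o x y z c2 c3 j j' : 0 < T -> thin n T ->
  geodesic c2 x z -> geodesic c3 z y -> d x y + d x z + d z y <= n ->
  (forall k, k <= d x z -> T <= d o (c2 k)) ->
  (forall k, k <= d z y -> T <= d o (c3 k)) ->
  j <= d x z -> j' <= d z y -> d o (c2 j) <= 3 * T -> d o (c3 j') <= 3 * T ->
  exists2 m, m <= 24 * T & avoid o T (c2 j) (c3 j') m.
Proof.
move=> T0 thT g2 g3 per far2 far3 jn jn' oj oj'.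
have [c20 c2n c2d] := g2; have [c30 c3n c3d] := g3.
have dpq : d (c2 j) (c3 j') <= 6 * T.
  by have := dist_triangle (c2 j) o (c3 j'); rewrite (distC _ o); lia.
have dpz : d (c2 j) z = d x z - j by rewrite -{1}c2n c2d.
have dzq : d z (c3 j') = j' by rewrite -{1}c30 c3d // subn0.
(* If the apex is within [8 * T] of [c2 j], going through it costs at most [8 * T + 14 * T]. *)
have [small|big] := leqP (d x z - j) (8 * T).
  exists ((d x z - j) + (j' - 0)).
    by have := dist_triangle z (c2 j) (c3 j'); rewrite (distC z (c2 j)); lia.
  apply: (@avoid_cat _ _ _ z).
    rewrite -{1}c2n; apply: (avoid_geodesic g2) => // k /andP[_]; exact: far2.
  rewrite -{1}c30; apply: (avoid_geodesic g3) => // k /andP[_ kj].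
  by apply: far3; lia.
pose s := c2 (j + 8 * T).
have [e eg] := exists_geodesic (c2 j) (c3 j').
have g1' := geodesic_drop g2 jn; have g3' := geodesic_rev_take g3 jn'.
have dqz : d (c3 j') z = j' by rewrite distC.
have per' : d (c2 j) z + d (c2 j) (c3 j') + d (c3 j') z <= n.
  have dxp : d x (c2 j) = j by rewrite -{1}c20 c2d // subn0.
  have dqy : d (c3 j') y = d z y - j' by rewrite -{1}c3n c3d.
  have := dist_triangle (c2 j) x (c3 j'); have := dist_triangle x y (c3 j').
  rewrite (distC _ x) (distC y); lia.
have dps : d (c2 j) s = 8 * T by rewrite /s c2d; lia.
have [|[k kn sk]|[k kn sk]] := thT _ _ _ _ _ _ g1' eg g3' per' (8 * T).
- by rewrite dpz; lia.
(* [s] is [8 * T] away from [c2 j], hence more than [T] away from the short side, whose length is at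
   most [6 * T]. *)
- have [e0 _ ed] := eg; have := ed 0 k (leq0n k) kn; rewrite e0.
  rewrite -/s in sk; have := dist_triangle (c2 j) (e k) s; rewrite (distC (e k) s); lia.
rewrite -/s dqz in sk kn; pose q' := c3 (j' - k); rewrite -/q' in sk.
have dq'q : d q' (c3 j') = k by rewrite /q' c3d; lia.
(* The three pieces have length at most [8 * T], [T] and [15 * T]. *)
exists ((j + 8 * T - j) + d s q' + (j' - (j' - k))).
  have := dist_triangle q' s (c3 j'); have := dist_triangle s (c2 j) (c3 j').
  rewrite (distC q' s) (distC s (c2 j)); lia.
apply: (@avoid_cat _ _ _ q'); first apply: (@avoid_cat _ _ _ s).
- apply: (avoid_geodesic g2); [lia|lia|] => i /andP[_ ij]; apply: far2; lia.
- apply: avoid_short; have := dist_triangle (c2 j) o s; rewrite (distC _ o); lia.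
- apply: (avoid_geodesic g3); [lia|lia|] => i /andP[_ ij]; apply: far3; lia.
Qed.

(** * From the quadratic bound to uniformly thin triangles and the four-point condition *)

Section Isoperimetry.
Variable K : nat.
Hypothesis avoid_quadratic : forall o r x y n, d x o + d o y = d x y ->
  avoid o r y x n -> r * (r - 1) <= K * (d x y + n).

(* If [o] is at distance [T] from the other two sides, then the points at
   distance [2 * T] from [o] on its side can be joined by a path of length [O(T)]
   around [o], which [avoid_quadratic] forbids for large [T]. *)
Lemma thin_step n t : 30 * K + 1 < t.+1 -> thin n t.+1 -> thin n t.
Proof.
move=> Kt thT x y z c1 c2 c3 g1 g2 g3 per i iN; apply: contrapT => /not_orP[no2 no3].
have [T TE] : exists T, T = t.+1 by eexists.
rewrite -TE in Kt thT; pose o := c1 i.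
have far2 k : k <= d x z -> T <= d o (c2 k).
  by move=> kn; rewrite TE ltnNge; apply/negP => le; apply: no2; exists k.
have far3 k : k <= d z y -> T <= d o (c3 k).
  by move=> kn; rewrite TE ltnNge; apply/negP => le; apply: no3; exists k.
have [c10 c1n c1d] := g1; have [c20 c2n c2d] := g2; have [c30 c3n c3d] := g3.
pose onside p := (exists2 k, k <= d x z & p = c2 k) \/ (exists2 k, k <= d z y & p = c3 k).
have join p q : onside p -> onside q -> d o p <= 3 * T -> d o q <= 3 * T ->
    exists2 m, m <= 24 * T & avoid o T p q m.
  have same (c : nat -> G) x' y' (k k' : nat) : geodesic c x' y' ->
      (forall k, k <= d x' y' -> T <= d o (c k)) -> k <= d x' y' -> k' <= d x' y' ->
      d o (c k) <= 3 * T -> d o (c k') <= 3 * T ->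
      exists2 m, m <= 24 * T & avoid o T (c k) (c k') m.
    wlog kk' : k k' / k <= k'.
      move=> wl cg cf kn kn' dk dk'; have [kk'|/ltnW kk'] := leqP k k'; first exact: wl.
      by have [m mT /avoid_sym] := wl _ _ kk' cg cf kn' kn dk' dk; exists m.
    move=> cg cf kn kn' dk dk'; exists (k' - k).
      have [_ _ cd] := cg; have := dist_triangle (c k) o (c k').
      by rewrite cd // (distC _ o); lia.
    by apply: (avoid_geodesic cg) => // i' /andP[_ ik]; apply: cf; lia.
  move=> [[k kn ->]|[k kn ->]] [[k' kn' ->]|[k' kn' ->]] dk dk'.
  - exact: same g2 far2 _ _ _ _.
  - by apply: (detour _ thT g2 g3) => //; lia.
  - have [|m mT /avoid_sym] := detour (j := k') (j' := k) _ thT g2 g3 per far2 far3 kn' kn dk' dk; first lia.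
    by exists m.
  - exact: same g3 far3 _ _ _ _.
have exit i' : i' <= d x y -> d o (c1 i') = 2 * T ->
    exists p, [/\ onside p, d o p <= 3 * T & exists2 m, m <= T & avoid o T (c1 i') p m].
  move=> in' di'.
  have [[k kn dk]|[k kn dk]] := thT _ _ _ _ _ _ g1 g2 g3 per i' in'.
    exists (c2 k); split; [by left; exists k| |].
      have := dist_triangle o (c1 i') (c2 k); lia.
    by exists (d (c1 i') (c2 k)) => //; apply: avoid_short; lia.
  exists (c3 k); split; [by right; exists k| |].
    have := dist_triangle o (c1 i') (c3 k); lia.
  by exists (d (c1 i') (c3 k)) => //; apply: avoid_short; lia.
have stay p : onside p -> T <= d o p -> avoid o T p p 0.
  by move=> _ op; exists (fun=> p); split.
have [p [a [al [sp dp [mp mpT ap]] ai]]] : exists p a, [/\ a <= i,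
    [/\ onside p, d o p <= 3 * T & exists2 m, m <= T & avoid o T (c1 a) p m] &
    i - a <= 2 * T].
  have [iT|iT] := leqP (2 * T) i.
    have [||p pP] := exit (i - 2 * T); [lia|by rewrite distC c1d; lia|].
    by exists p, (i - 2 * T); split=> //; lia.
  (* The side ends before distance [2 * T]; its end [x] also lies on [c2] and is its own exit. *)
  have dox : d o x = i by rewrite distC -{1}c10 c1d // subn0.
  have sx : onside x by left; exists 0.
  have oxT : T <= d o x by have := far2 0 (leq0n _); rewrite c20.
  exists x, 0; split => //; last lia.
  by split => //; [lia|exists 0 => //; rewrite c10; exact: stay].
have [q [b [bl bN [sq dq [mq mqT aq]] bi]]] : exists q b, [/\ i <= b, b <= d x y,
    [/\ onside q, d o q <= 3 * T & exists2 m, m <= T & avoid o T (c1 b) q m] &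
    b - i <= 2 * T].
  have [iT|iT] := leqP (i + 2 * T) (d x y).
    have [||q qP] := exit (i + 2 * T); [lia|by rewrite c1d; lia|].
    by exists q, (i + 2 * T); split=> //; lia.
  have doy : d o y = d x y - i by rewrite -{1}c1n c1d.
  have sy : onside y by right; exists (d z y).
  have oyT : T <= d o y by have := far3 _ (leqnn _); rewrite c3n.
  exists y, (d x y); split => //; last lia.
  by split => //; [lia|exists 0 => //; rewrite c1n; exact: stay].
have [m mT apq] := join q p sq sp dq dp.
have path := avoid_cat (avoid_cat aq apq) (avoid_sym ap).
have dab : d (c1 a) (c1 b) = b - a by apply: c1d => //; apply: leq_trans bl.
have doab : d (c1 a) o + d o (c1 b) = d (c1 a) (c1 b).
  by rewrite dab /o !c1d //; lia.
have := avoid_quadratic doab path; rewrite dab.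
(* The segment has length at most [4 * T], the two exits at most [T] each, and the path joining them
   at most [24 * T]. *)
have : K * (b - a + (mq + m + mp)) <= K * (30 * T) by rewrite leq_mul2l; lia.
move=> h1 h2; have : T * (T - 1) <= T * (30 * K).
  by apply: leq_trans h2 (leq_trans h1 _); lia.
by rewrite leq_pmul2l; lia.
Qed.

(** Any [t] above the perimeter bound works trivially, and [thin_step] lowers it to a value that no
    longer depends on [n]. *)
Lemma thin_all n : thin n (30 * K + 1).
Proof.
have down t : thin n (30 * K + 1 + t) -> thin n (30 * K + 1).
  elim: t => [|t IH]; first by rewrite addn0.
  by rewrite addnS => /thin_step h; apply/IH/h; lia.
apply: (down n) => x y z c1 c2 c3 g1 g2 _ per i iN; left; exists 0 => //.
have [c10 _ c1d] := g1; have [-> _ _] := g2.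
by rewrite distC -{1}c10 c1d //; lia.
Qed.

Lemma thin_four_point x y z w :
  d x y + d z w <= d x z + d y w + 6 * (30 * K + 2) \/
  d x y + d z w <= d x w + d y z + 6 * (30 * K + 2).
Proof.
have [t tE] : exists t, t = 30 * K + 1 by eexists.
have th := thin_all; rewrite -tE in th.
have [c cg] := exists_geodesic x y; have [c0 cn cd] := cg.
have [c2 g2] := exists_geodesic x w; have [c3 g3] := exists_geodesic w y.
have [e2 h2] := exists_geodesic x z; have [e3 h3] := exists_geodesic z y.
have [c20 c2n c2d] := g2; have [c30 c3n c3d] := g3.
have [e20 e2n e2d] := h2; have [e30 e3n e3d] := h3.
pose near i := [exists j : 'I_(d w y).+1, d (c i) (c3 j) <= t].
have ex : exists i, near i && (i <= d x y).
  exists (d x y); rewrite leqnn andbT; apply/existsP; exists ord_max.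
  by rewrite /= cn c3n distxx.
(* The first point of [c] close to [c3] is close to [c2] as well, because its predecessor is not
   close to [c3]: it is a centre of the triangle [x], [y], [w]. *)
case: (ex_minnP ex) => i /andP[/existsP[/= j ij] iN] imin.
have [j2 j2N ij2] : exists2 j2, j2 <= d x w & d (c i) (c2 j2) <= t.+1.
  case: i iN imin {ij} => [|i] iN imin; first by exists 0 => //; rewrite c0 c20 distxx.
  have [[j2 ? ij2]|[j3 j3N ij3]] := th _ _ _ _ _ _ _ cg g2 g3 (leqnn _) i (ltnW iN).
    exists j2 => //; have := dist_triangle (c i.+1) (c i) (c2 j2).
    by rewrite (distC (c i.+1) (c i)) cd ?leqnSn //; lia.
  have : i.+1 <= i; last by rewrite ltnn.
  apply: imin; rewrite (ltnW iN) andbT; apply/existsP.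
  by exists (Ordinal (j3N : j3 < (d w y).+1)).
have [j3 [j3N dow]] : exists j3, j3 <= d w y /\ d (c i) (c3 j3) <= t.
  by exists j; rewrite -ltnS ltn_ord.
pose o := c i; rewrite -/o in ij2 dow.
have xo : d x o = i by rewrite -{1}c0 cd // subn0.
have oy : d o y = d x y - i by rewrite -{1}cn cd.
have xj2 : d x (c2 j2) + d (c2 j2) w = d x w.
  by rewrite -{1}c20 -{1}c2n !c2d //; lia.
have j3y : d w (c3 j3) + d (c3 j3) y = d w y.
  by rewrite -{1}c30 -{1}c3n !c3d //; lia.
have t1 := dist_triangle x (c2 j2) o; have t2 := dist_triangle o (c2 j2) w.
have t3 := dist_triangle o (c3 j3) w; have t4 := dist_triangle o (c3 j3) y.
rewrite (distC (c2 j2) o) in t1; rewrite (distC (c3 j3) w) in t3.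
(* The centre [o] is also close to one of the other sides of the triangle [x], [y], [z]; which one
   decides the alternative. *)
have [[k kN ok]|[k kN ok]] := th _ _ _ _ _ _ _ cg h2 h3 (leqnn _) i iN.
  have xk : d x (e2 k) + d (e2 k) z = d x z.
    by rewrite -{1}e20 -{1}e2n !e2d //; lia.
  have := dist_triangle x (e2 k) w; have := dist_triangle z (e2 k) w.
  have := dist_triangle (e2 k) o w; rewrite -/o in ok.
  rewrite (distC (e2 k) o) (distC z (e2 k)) (distC y w); lia.
have xk : d z (e3 k) + d (e3 k) y = d z y.
  by rewrite -{1}e30 -{1}e3n !e3d //; lia.
have := dist_triangle y (e3 k) w; have := dist_triangle z (e3 k) w.
have := dist_triangle (e3 k) o w; rewrite -/o in ok.
rewrite (distC (e3 k) o) (distC y (e3 k)) (distC y z) (distC y w); lia.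
Qed.
End Isoperimetry.
End GeodesicLength.

(** * Loxodromic elements, independent axes and Powers' sets for a hyperbolic length *)

Section HyperbolicLength.
Variable G : groupType.
Implicit Types (b c : bool) (e f g h k p q s t u v w x y z : G).

(** [four_point] is Gromov's condition, and [len_wpd] is weak proper discontinuity: only finitely
    many elements move both 1 and [w] by at most [K]. The finite set may depend on [w], so no
    uniform acylindricity is required. *)
Record hyperbolic_length (l : G -> nat) (dl : nat) : Prop := HyperbolicLength {
  hyp_geodesic_length :> geodesic_length l;
  four_point : forall x y z w : G,
    dist l x y + dist l z w <= dist l x z + dist l y w + dl \/
    dist l x y + dist l z w <= dist l x w + dist l y z + dl;
  len_wpd : forall K (w : G), 2 * K + 2 <= l w ->
    exists s : seq G, forall g : G, l g <= K -> l (w^-1 * g * w)%h <= K -> g \in s;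
  len_unbounded : forall n, exists g : G, n <= l g }.

Variables (l : G -> nat) (dl : nat).
Hypothesis hl : hyperbolic_length l dl.
Local Notation d := (dist l).

Let distC := distC hl.
Let distMl := distMl l.
Let dist_triangle := dist_triangle hl.
Let dist1 := dist1 l.
Let dist1r := dist1r hl.

Lemma four_point_at x y z w :
  d x y + d z w <= d x z + d y w + dl \/ d x y + d z w <= d x w + d y z + dl.
Proof. exact: (four_point hl). Qed.

Lemma four_point1 x y z :
  d x y + l z <= d x z + l y + dl \/ d x y + l z <= l x + d y z + dl.
Proof. by have := four_point_at x y z 1%h; rewrite !dist1r. Qed.

(* Twice the Gromov product of x and y at 1. *)
Definition gprod x y := l x + l y - d x y.

Lemma gprodC x y : gprod x y = gprod y x.
Proof. by rewrite /gprod distC addnC. Qed.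

Lemma dist_len x y : [/\ d x y <= l x + l y, l x <= d x y + l y & l y <= d x y + l x].
Proof.
have := dist_triangle x 1%h y; have := dist_triangle 1%h x y.
have := dist_triangle 1%h y x.
by rewrite !dist1 !dist1r (distC y x); split; lia.
Qed.

Lemma gprod_min x y z : gprod x y <= gprod x z + dl \/ gprod y z <= gprod x z + dl.
Proof.
rewrite /gprod.
have [? ? ?] := dist_len x y; have [? ? ?] := dist_len x z.
have [? ? ?] := dist_len y z.
have := four_point1 x z y; rewrite (distC z y); lia.
Qed.

(** A local criterion: this much growth from [k] to its square forces linear growth of all
    powers. *)
Definition loxodromic k := l k + 2 * dl + 1 <= l (k * k)%h.

Lemma len_expS k n : loxodromic k -> l (k ^+ n)%h + dl + 1 <= l (k ^+ n.+1)%h.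
Proof.
move=> hk; elim: n => [|n IHn].
  rewrite gexp0 gexp1 (len1 hl); have := lenM hl k k.
  by move: hk; rewrite /loxodromic; lia.
(* The first alternative would make [k ^+ n.+1] shorter than [k ^+ n], against the induction
   hypothesis; the second is the claim. *)
have := four_point_at 1%h (k * k)%h k (k ^+ n.+2)%h.
have -> : d 1%h (k * k)%h = l (k * k)%h by rewrite dist1.
have -> : d k (k ^+ n.+2)%h = l (k ^+ n.+1)%h by rewrite gexpS /dist !gE.
have -> : d 1%h k = l k by rewrite dist1.
have -> : d (k * k)%h (k ^+ n.+2)%h = l (k ^+ n)%h by rewrite 2!gexpS /dist !gE.
have -> : d 1%h (k ^+ n.+2)%h = l (k ^+ n.+2)%h by rewrite dist1.
have -> : d (k * k)%h k = l k by rewrite distC /dist !gE.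
by move: hk; rewrite /loxodromic; lia.
Qed.

Lemma len_exp_ge k n : loxodromic k -> n <= l (k ^+ n)%h.
Proof. by move=> hk; elim: n => // n IH; have := len_expS n hk; lia. Qed.

Lemma dist_exp k i j : i <= j -> d (k ^+ i)%h (k ^+ j)%h = l (k ^+ (j - i))%h.
Proof. by move=> ij; rewrite /dist -[in (k ^+ j)%h](subnKC ij) gexpD !gE. Qed.

Lemma len_exp_homo k m n : loxodromic k -> m <= n -> l (k ^+ m)%h <= l (k ^+ n)%h.
Proof.
move=> hk; elim: n => [|n IH] mn; first by have -> : m = 0 by lia.
have [->//|mn'] := eqVneq m n.+1.
have := len_expS n hk; have := IH _; lia.
Qed.

Lemma len_expD k i j : loxodromic k ->
  l (k ^+ i)%h + l (k ^+ j)%h <= l (k ^+ (i + j))%h + l k + dl.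
Proof.
move=> hk; case: j => [|j]; first by rewrite addn0 gexp0 (len1 hl); lia.
have := four_point_at 1%h (k ^+ i.+1)%h (k ^+ i)%h (k ^+ (i + j.+1))%h.
rewrite !dist1 (distC (k ^+ i.+1)%h (k ^+ i)%h) !dist_exp; try lia.
have -> : i.+1 - i = 1 by lia.
have -> : i + j.+1 - i = j.+1 by lia.
have -> : i + j.+1 - i.+1 = j by lia.
rewrite gexp1; have := len_expS i hk; have := len_expS j hk; lia.
Qed.

Lemma loxodromicV k : loxodromic k -> loxodromic k^-1%h.
Proof. by rewrite /loxodromic -ginvM !(lenV hl). Qed.

(** Cut an element of length [N + N] in the middle and let [a] and [b] be its two ends seen from
    there; their Gromov product vanishes. If neither is loxodromic, each shares about half its
    length with its inverse, and then the powers of [a * b] cannot backtrack. *)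
Lemma exists_loxodromic : exists k, loxodromic k.
Proof.
have [N NE] : exists N, N = 6 * dl + 2 by eexists.
have [g0 g0N] := len_unbounded hl (N + N).
have [g [_ [_ gN _]]] := len_geodesic hl g0N.
have Ng : N <= l g by lia.
have [p [q [gE' pN qN]]] := len_geodesic hl Ng.
have dab : d q p^-1%h = N + N.
  by rewrite distC /dist ginvK -gE' gN.
have qN' : l q = N by lia.
have pN' : l p^-1%h = N by rewrite (lenV hl).
move: (p^-1%h : G) pN' dab => a aN dba.
move: {qN} q gE' qN' dba => b _ bN dba.
have [h|h] := leqP (l a + 2 * dl + 1) (l (a * a)%h); first by exists a.
have [h'|h'] := leqP (l b + 2 * dl + 1) (l (b * b)%h); first by exists b.
exists (a * b)%h; rewrite /loxodromic.
have e1 := distMl; have dV x : l x^-1%h = l x by rewrite (lenV hl).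
have daV : d a a^-1%h = l (a * a)%h by rewrite distC /dist !gE.
have dbV : d b b^-1%h = l (b * b)%h by rewrite distC /dist !gE.
have dabV : d b a^-1%h = l (a * b)%h by rewrite distC /dist !gE.
have dbaV : d a b^-1%h = l (b * a)%h by rewrite distC /dist !gE.
have d1 : d a (a * b)%h = N by rewrite /dist !gE.
have d2 : d b^-1%h (b^-1 * a^-1)%h = N by rewrite /dist !gE dV.
have d3 : l (b^-1 * a^-1)%h = l (a * b)%h by rewrite -ginvM dV.
have d4 : d (b^-1 * a^-1)%h (a * b)%h = l ((a * b) * (a * b))%h by rewrite /dist !gE.
have ab2 : l (a * b)%h <= 2 * N by have := lenM hl a b; lia.
have f1 := four_point1 a b a^-1%h.
have f2 := four_point1 b a b^-1%h.
have f3 := four_point_at 1%h (a * b)%h a b^-1%h.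
have f4 := four_point_at 1%h (b^-1 * a^-1)%h (a * b)%h b^-1%h.
rewrite !dist1 in f3 f4; rewrite (distC b a) in f2 dba.
rewrite (distC (a * b)%h a) in f3; rewrite (distC (b^-1 * a^-1)%h b^-1%h) in f4.
have dVa := dV a; have dVb := dV b; lia.
Qed.

(** Let [n] be the first index at which the second orbit is as long as [e ^+ m]. Both points lie
    near geodesics to the far ends, at almost the same distance from 1, so a large Gromov product of
    the ends brings them together. *)
Lemma fellow_travel e f u i j m : loxodromic e -> loxodromic f -> l f = l e ->
  l u + 2 * dl + l e < l (e ^+ m)%h -> m <= i ->
  2 * l (e ^+ m)%h + 2 * l e <= gprod (e ^+ i)%h (u * f ^+ j)%h ->
  exists2 n, n <= j & d (e ^+ m)%h (u * f ^+ n)%h <= 2 * l e + 3 * dl.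
Proof.
move=> he hf fe um mi hg.
pose x := (e ^+ i)%h; pose y := (u * f ^+ j)%h.
have ly : l (e ^+ m)%h + l e <= l y.
  have [? ? ?] := dist_len x y; move: hg; rewrite /gprod -/x -/y; lia.
have ex : exists n, l (e ^+ m)%h <= l (u * f ^+ n)%h by exists j; rewrite -/y; lia.
case: (ex_minnP ex) => n nP nmin.
have nj : n <= j by apply: nmin; rewrite -/y; lia.
exists n => //.
have zub : l (u * f ^+ n)%h <= l (e ^+ m)%h + l e.
  case: n nP nmin nj => [|n] nP nmin nj; first by move: nP; rewrite gexp0 gmul1; lia.
  have : l (u * f ^+ n)%h < l (e ^+ m)%h by rewrite ltnNge; apply/negP => /nmin; lia.
  have := lenM hl (u * f ^+ n)%h f; rewrite -gmulA -gexpSr; lia.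
set z := (u * f ^+ n)%h in nP zub *.
have g1 : 2 * l (e ^+ m)%h <= gprod (e ^+ m)%h x + l e + dl.
  rewrite /gprod /x dist_exp //; have := len_expD m (i - m) he.
  by rewrite subnKC //; have := lenM hl (e ^+ m)%h (e ^+ (i - m))%h; rewrite -gexpD subnKC //; lia.
have g2 : 2 * l z <= gprod z y + l e + 2 * dl.
  have duz : d u z = l (f ^+ n)%h by rewrite /dist /z !gE.
  have duy : d u y = l (f ^+ j)%h by rewrite /dist /y !gE.
  have dzy : d z y = l (f ^+ (j - n))%h by rewrite /z /y distMl dist_exp.
  have fp := four_point_at u y z 1%h.
  rewrite !dist1r (distC y z) in fp.
  have := len_expD n (j - n) hf; rewrite subnKC // fe.
  have [? ? ?] := dist_len u z; have [? ? ?] := dist_len z y.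
  rewrite /gprod; lia.
have [? ? ?] := dist_len (e ^+ m)%h z.
have := gprod_min (e ^+ m)%h x y; have := gprod_min (e ^+ m)%h y z.
rewrite (gprodC y z) [gprod _ z]/gprod; move: hg; rewrite -/x -/y; lia.
Qed.

(** Two such elements differ by one that moves 1 and [w] by at most [2 * K]; this explains
    [4 * K + 2]. *)
Lemma len_wpd2 K w w' : 4 * K + 2 <= l w ->
  exists s : seq G, forall g, l g <= K -> d w' (g * w)%h <= K -> g \in s.
Proof.
move=> hw; have [[g0 [g0K g0w]]|no] :=
  pselect (exists g, l g <= K /\ d w' (g * w)%h <= K); last first.
  by exists [::] => g gK gw; case: no; exists g.
have [s sP] := len_wpd hl (K := 2 * K) (w := w) ltac:(lia).
exists [seq (g0 * x)%h | x <- s] => g gK gw.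
apply/mapP; exists (g0^-1 * g)%h; last by rewrite !gE.
apply: sP; first by have := lenM hl g0^-1%h g; rewrite (lenV hl); lia.
have := dist_triangle (g0 * w)%h w' (g * w)%h; rewrite (distC _ w').
by rewrite {1}/dist !gE; lia.
Qed.

Definition sgn b k : G := if b then k else k^-1%h.

Lemma loxodromic_sgn b k : loxodromic k -> loxodromic (sgn b k).
Proof. by case: b => //; apply: loxodromicV. Qed.

Lemma len_sgn b k n : l (sgn b k ^+ n)%h = l (k ^+ n)%h.
Proof. by case: b => //=; rewrite gexpV (lenV hl). Qed.

Lemma len_sgn1 b k : l (sgn b k) = l k.
Proof. by have := len_sgn b k 1; rewrite !gexp1. Qed.

(** For each [n] finiteness is [len_wpd2], and only finitely many [n] occur: [n] is at most the
    length of [k ^+ n], which differs from that of [k ^+ N] by a bounded amount. *)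
Lemma quasi_stabilizer_finite k C N : loxodromic k -> 6 * C + 3 <= N ->
  exists Z : seq G, forall b c n v, l v <= C ->
    d (sgn b k ^+ N)%h (v * sgn c k ^+ n)%h <= C -> v \in Z.
Proof.
move=> hk hN.
have ex (t : bool * bool * nat) : exists Z : seq G, forall v, l v <= C ->
    d (sgn t.1.1 k ^+ N)%h (v * sgn t.1.2 k ^+ t.2)%h <= C -> v \in Z.
  case: t => [[b c] n] /=.
  have [big|small] := leqP (4 * C + 2) (l (sgn c k ^+ n)%h).
    exact: len_wpd2.
  exists [::] => v vC dv; exfalso; have := len_exp_ge N hk.
  have [_ + _] := dist_len (sgn b k ^+ N)%h (v * sgn c k ^+ n)%h.
  have := lenM hl v (sgn c k ^+ n)%h; rewrite !len_sgn in small *; lia.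
have [Z ZP] := choice ex.
pose B := l (k ^+ N)%h + 2 * C.
exists (flatten [seq Z r | r <- [seq (bc, n) | bc <- [seq (b, c) | b <- [:: true; false], c <- [:: true; false]], n <- iota 0 B.+1]]) => b c n v vC dv.
apply/flatten_mapP; exists (b, c, n); last exact: ZP.
apply/allpairsP; exists ((b, c), n); split => //; first by case: b c dv => [] [].
rewrite mem_iota [_.2]/= add0n ltnS leq0n /B /=.
have := len_exp_ge n hk.
have [_ _ +] := dist_len (sgn b k ^+ N)%h (v * sgn c k ^+ n)%h.
have := lenM hl v^-1%h (v * sgn c k ^+ n)%h; rewrite gmulA gmulVl gmul1l (lenV hl) !len_sgn.
lia.
Qed.

(** Membership in the cyclic subgroup of [k], with natural exponents only. *)
Definition zpow k x := exists m n, x = (k ^+ m * (k ^+ n)^-1)%h.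

Lemma gexp_comm k m n : (k ^+ m * (k ^+ n)^-1)%h = ((k ^+ n)^-1 * k ^+ m)%h.
Proof. by apply: (@gmulI _ (k ^+ n)%h); rewrite gmulA -gexpD addnC gexpD !gE. Qed.

Lemma zpowM k x y : zpow k x -> zpow k y -> zpow k (x * y)%h.
Proof.
move=> [m [n ->]] [m' [n' ->]]; exists (m + m'), (n' + n).
by rewrite !gexpD !gE -(gmulA _ _ (k ^+ m')%h) -gexp_comm !gE.
Qed.

Lemma zpowV k x : zpow k x -> zpow k x^-1%h.
Proof. by move=> [m [n ->]]; exists n, m; rewrite !gE. Qed.

Lemma zpow_sgn b k n : zpow k (sgn b k ^+ n)%h.
Proof.
case: b; [exists n, 0 | exists 0, n]; rewrite /= gexp0 !gE //.
by rewrite gexpV.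
Qed.

Lemma zpow_exp k x n : zpow k x -> zpow k (x ^+ n)%h.
Proof.
move=> kx; elim: n => [|n IH]; first by exists 0, 0; rewrite !gexp0 !gE.
by rewrite gexpS; apply: zpowM.
Qed.

(** Geometrically, the axis of [k] and its translate by [u] have no common end at infinity. *)
Definition independent k u :=
  exists C, forall b c i j, gprod (sgn b k ^+ i)%h (u * sgn c k ^+ j)%h <= C.

(** A translate that follows the axis for a long time yields an element of the finite set [Z] at
    each of many positions [m]. One position places [u] in a double coset of [Z]; two positions with
    the same element, found by pigeonhole, show that [u] conjugates a power of [k] into the cyclic
    subgroup of [k]. *)
Lemma not_independent_pow k : loxodromic k -> exists Z : seq G,
  forall u, ~ independent k u ->
    (exists v x y, [/\ v \in Z, zpow k x, zpow k y & u = (x * v * y)%h]) /\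
    (exists b m x, [/\ 0 < m, zpow k x & (sgn b k ^+ m * u)%h = (u * x)%h]).
Proof.
move=> hk; pose C := 2 * l k + 3 * dl; have [N NE] : exists N, N = 6 * C + 3 by eexists.
have [Z ZP] := quasi_stabilizer_finite (C := C) (N := N) hk ltac:(lia).
exists Z => u nu; pose m0 := l u + 2 * dl + l k + 1.
(* [m] runs through [size Z + 1] positions from [m0] on, and each is compared with the position
   [m + N]. *)
have [M ME] : exists M, M = m0 + size Z + N by eexists.
have [b [c [i [j ij]]]] : exists b c i j,
    2 * l (k ^+ M)%h + 2 * l k <= gprod (sgn b k ^+ i)%h (u * sgn c k ^+ j)%h.
  apply: contrapT => no; apply: nu; exists (2 * l (k ^+ M)%h + 2 * l k) => b c i j.
  rewrite leqNgt; apply/negP => lt; apply: no; exists b, c, i, j; lia.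
have Mi : M <= i.
  rewrite leqNgt; apply/negP => iM.
  have := len_exp_homo hk (ltnW iM).
  have [_ _ +] := dist_len (sgn b k ^+ i)%h (u * sgn c k ^+ j)%h.
  have [_ + _] := dist_len (sgn b k ^+ i)%h (u * sgn c k ^+ j)%h.
  have := len_expS 0 hk; rewrite gexp0 gexp1 (len1 hl).
  move: ij; rewrite /gprod !len_sgn; lia.
have ft m : m0 <= m <= M -> exists n, d (sgn b k ^+ m)%h (u * sgn c k ^+ n)%h <= C.
  move=> /andP[m0m mM].
  have := @fellow_travel (sgn b k) (sgn c k) u i j m (loxodromic_sgn b hk)
    (loxodromic_sgn c hk); rewrite !len_sgn1 !len_sgn => /(_ erefl) FT.
  have h1 := len_exp_ge m hk; have h2 := len_exp_homo hk mM.
  have [|||n _ ?] := FT; last by exists n.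
  - by rewrite /m0 in m0m; lia.
  - by lia.
  - by lia.
have vP m : m0 <= m <= m0 + size Z ->
    exists n, ((sgn b k ^+ m)^-1 * u * sgn c k ^+ n)%h \in Z.
  move=> /andP[m1 m2].
  have [n dn] := ft m ltac:(lia).
  have [n' dn'] := ft (m + N) ltac:(lia).
  exists n; have [nn|nn] := leqP n n'.
    apply: (ZP b c (n' - n)); first by move: dn; rewrite /dist !gE.
    rewrite -(distMl (sgn b k ^+ m)%h) -gexpD !gE.
    by rewrite -gmulA -gexpD subnKC.
  apply: (ZP b (~~ c) (n - n')); first by move: dn; rewrite /dist !gE.
  have -> : (sgn (~~ c) k ^+ (n - n'))%h = ((sgn c k ^+ (n - n'))^-1)%h.
    by case: (c); rewrite /= gexpV ?ginvK.
  rewrite -(distMl (sgn b k ^+ m)%h) -gexpD !gE.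
  have e : (sgn c k ^+ n)%h = (sgn c k ^+ n' * sgn c k ^+ (n - n'))%h.
    by rewrite -gexpD subnKC // ltnW.
  by rewrite e !gE.
split.
  have [n hn] := vP m0 ltac:(lia).
  exists ((sgn b k ^+ m0)^-1 * u * sgn c k ^+ n)%h, (sgn b k ^+ m0)%h, (sgn c k ^+ n)^-1%h.
  by split=> //; [exact: zpow_sgn|apply/zpowV/zpow_sgn|rewrite !gE].
have [f fP] := choice (fun m : 'I_(size Z).+1 => vP (m0 + m) ltac:(move: (ltn_ord m); lia)).
have [F FE] : exists F : 'I_(size Z).+1 -> G,
    forall m, F m = ((sgn b k ^+ (m0 + m))^-1 * u * sgn c k ^+ f m)%h by eexists.
have {}fP m : F m \in Z by rewrite FE.
have [m [n [mn Fmn]]] : exists m n : 'I_(size Z).+1, m < n /\ F m = F n.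
  apply: contrapT => no.
  have Finj : injective F.
    move=> m n Fmn; case: (ltngtP m n) => [lt|lt|/ord_inj //]; case: no.
      by exists m, n; exact: conj lt Fmn.
    by exists n, m; exact: conj lt (esym Fmn).
  have : size (map F (enum 'I_(size Z).+1)) <= size Z.
    apply: uniq_leq_size; first by rewrite map_inj_uniq ?enum_uniq.
    by move=> _ /mapP[m _ ->]; exact: fP.
  by rewrite size_map size_enum_ord ltnn.
exists b, (n - m), (sgn c k ^+ f n * (sgn c k ^+ f m)^-1)%h; split.
- by rewrite subn_gt0.
- by apply: zpowM; [exact: zpow_sgn|apply/zpowV/zpow_sgn].
have e : (u * sgn c k ^+ f m)%h = ((sgn b k ^+ (n - m))^-1 * u * sgn c k ^+ f n)%h.
  apply: (@gmulI _ (sgn b k ^+ (m0 + m))^-1%h); rewrite gmulA -FE Fmn FE.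
  by rewrite !gmulA -ginvM -gexpD; do ?congr (gmul _ _); congr (ginv (gexp _ _)); lia.
have := congr1 (fun y => (sgn b k ^+ (n - m) * y * (sgn c k ^+ f m)^-1)%h) e.
by rewrite !gE.
Qed.

(** Divide the exponent of [y] by [m]: multiples of [m] pass through [v], and only the remainder
    stays in front. *)
Lemma zpow_coset k v m x y : 0 < m -> zpow k x -> (k ^+ m * v)%h = (v * x)%h ->
  zpow k y -> exists r z, [/\ r <= m, zpow k z & (y * v)%h = (k ^+ r * v * z)%h].
Proof.
move=> m0 kx e [i [j ->]].
have ea (a : nat) : (k ^+ (m * a) * v)%h = (v * x ^+ a)%h.
  elim: a => [|a IH]; first by rewrite muln0 !gexp0 !gE.
  by rewrite mulnS gexpD -gmulA IH gmulA e gexpS gmulA.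
have [ij|ij] := leqP j i.
  exists ((i - j) %% m), (x ^+ ((i - j) %/ m))%h; split.
  - by rewrite ltnW // ltn_mod.
  - exact: zpow_exp.
  rewrite -[RHS]gmulA -ea [RHS]gmulA -gexpD mulnC addnC -divn_eq.
  by rewrite gexp_comm -{1}(subnKC ij) gexpD !gE.
pose a := ((j - i) %/ m).+1.
have ja : j - i <= m * a.
  by rewrite /a mulnS mulnC {1}(divn_eq (j - i) m) addnC leq_add2r ltnW // ltn_mod.
exists (m * a - (j - i)), (x ^+ a)^-1%h; split.
- by rewrite leq_subLR /a mulnS {2}(divn_eq (j - i) m) addnC mulnC leq_add2r leq_addr.
- by apply/zpowV/zpow_exp.
have -> : (k ^+ i * (k ^+ j)^-1)%h = ((k ^+ (j - i))^-1)%h.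
  by rewrite -{1}(subnK (ltnW ij)) gexpD !gE.
rewrite -[RHS]gmulA.
have <- : ((k ^+ (m * a))^-1 * v)%h = (v * (x ^+ a)^-1)%h.
  apply: (@gmulI _ (k ^+ (m * a))%h); by rewrite [RHS]gmulA ea !gE.
rewrite gmulA; congr (_ * _)%h.
have -> : (k ^+ (m * a))%h = (k ^+ (j - i) * k ^+ (m * a - (j - i)))%h.
  by rewrite -gexpD subnKC.
by rewrite !gE.
Qed.

Definition virtually_cyclic :=
  exists k (V : seq G), forall g, exists2 v, v \in V & zpow k (v^-1 * g)%h.

(** Otherwise [G] is a union of finitely many double cosets of the cyclic subgroup of [k], and each
    is a finite union of left cosets because its representative commensurates that subgroup. *)
Lemma exists_independent k : loxodromic k -> ~ virtually_cyclic ->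
  exists u, independent k u.
Proof.
move=> hk nvc; apply: contrapT => no.
have [Z ZP] := not_independent_pow hk.
have {}ZP u := ZP u (fun i => no (ex_intro _ u i)).
have ex v : exists m, 0 < m /\ exists2 x, zpow k x & (k ^+ m * v)%h = (v * x)%h.
  have [_ [b [m [x [m0 kx e]]]]] := ZP v; exists m; split => //.
  case: b e => /= e; first by exists x.
  exists x^-1%h; first exact: zpowV.
  rewrite gexpV in e; apply: (@gmulI _ (k ^+ m)^-1%h).
  by rewrite [RHS]gmulA e !gE.
have [f fP] := choice ex.
apply: nvc; exists k, (flatten [seq [seq (k ^+ r * v)%h | r <- iota 0 (f v).+1] | v <- Z]).
move=> g; have [[v [x [y [vZ kx ky ->]]]] _] := ZP g.
have [m0 [x' kx' e]] := fP v.
have [r [z [rm kz e']]] := zpow_coset m0 kx' e kx.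
exists (k ^+ r * v)%h; last by rewrite e' !gE; exact: zpowM.
apply/flatten_mapP; exists v => //; apply/mapP; exists r => //.
by rewrite mem_iota add0n ltnS.
Qed.

Lemma exists_len n : exists w, l w = n.
Proof.
have [g ng] := len_unbounded hl n.
by have [w [_ [_ wn _]]] := len_geodesic hl ng; exists w.
Qed.

Lemma gprod_mulr x y u : gprod x (y * u)%h <= gprod x y + 2 * l u.
Proof.
have := lenM hl y u; have := dist_triangle x (y * u)%h y.
have -> : d (y * u)%h y = l u by rewrite distC /dist !gE.
have [? ? ?] := dist_len x y; have [? ? ?] := dist_len x (y * u)%h.
rewrite /gprod; lia.
Qed.

Lemma gexpJ u k n : ((u * k * u^-1) ^+ n)%h = (u * k ^+ n * u^-1)%h.
Proof.
elim: n => [|n IH]; first by rewrite !gexp0 !gE.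
by rewrite gexpS IH gexpS !gE.
Qed.

Lemma sgnJ b u k n : (sgn b (u * k * u^-1)%h ^+ n)%h = (u * sgn b k ^+ n * u^-1)%h.
Proof.
rewrite -gexpJ; congr (_ ^+ _)%h; by case: b; rewrite /= ?gE.
Qed.

Hypothesis nvc : ~ virtually_cyclic.

Lemma independent_axes : exists k1 k2 C, loxodromic k1 /\
  forall b c i j, [/\ gprod (sgn b k1 ^+ i)%h (sgn c k2 ^+ j)%h <= C,
    i <= l (sgn b k1 ^+ i)%h + C & j <= l (sgn c k2 ^+ j)%h + C].
Proof.
have [k hk] := exists_loxodromic; have [u [C uC]] := exists_independent hk nvc.
exists k, (u * k * u^-1)%h, (C + 2 * l u); split => // b c i j.
rewrite sgnJ; split; last 1 first.
- have := len_exp_ge j hk; rewrite -(len_sgn c).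
  have := dist_len u^-1%h (sgn c k ^+ j * u^-1)%h.
  rewrite /dist !gE (lenV hl) => -[_ _ _].
  have := lenM hl (u^-1 * (u * sgn c k ^+ j * u^-1))%h u.
  have := lenM hl u^-1%h (u * sgn c k ^+ j * u^-1)%h.
  by rewrite !gE (lenV hl); lia.
- have := gprod_mulr (sgn b k ^+ i)%h (u * sgn c k ^+ j)%h u^-1%h.
  by have := uC b c i j; rewrite (lenV hl); lia.
- by have := len_exp_ge i hk; rewrite len_sgn; lia.
Qed.

(** Of two independent axes at most one can point towards [t]; hence a constant that does not depend
    on [t]. *)
Lemma transverse_axis : exists C, forall t, exists h,
  forall b n, n <= l (sgn b h ^+ n)%h + C /\ gprod (sgn b h ^+ n)%h t <= C.
Proof.
have [k1 [k2 [C [_ kC]]]] := independent_axes.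
exists (C + dl) => t.
have [all1|] := pselect (forall b n, gprod (sgn b k1 ^+ n)%h t <= C + dl).
  by exists k1 => b n; split => //; have [_ + _] := kC b b n n; lia.
move=> /existsNP[b /existsNP[i bi]].
exists k2 => c j; have [h1 _ h2] := kC b c i j; split; first lia.
have := gprod_min (sgn b k1 ^+ i)%h t (sgn c k2 ^+ j)%h.
by rewrite (gprodC t); lia.
Qed.

Lemma gprod_moved t g : l g <= gprod t g + d t (g * t)%h.
Proof.
have := dist_triangle t (g * t)%h g.
have -> : d (g * t)%h g = l t by rewrite distC /dist !gE.
have [? ? ?] := dist_len t g; rewrite /gprod; lia.
Qed.

(** If [g] moves [t] much less than it moves 1, then [g] and [t] lie in the same direction from 1,
    so what points away from [t] points away from [g]. *)
Lemma gprod_away C g t y : gprod y t <= C -> C + dl + d t (g * t)%h < l g ->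
  gprod y g <= C + dl.
Proof.
move=> yt big; have := gprod_moved t g.
by have := gprod_min t g y; rewrite (gprodC t y) (gprodC g y); lia.
Qed.

(** Up to a bounded error, the geodesic from [u] to [g * u] passes through 1 and [g]. *)
Lemma dist_translate C g u : gprod u g <= C -> gprod u g^-1%h <= C ->
  2 * C + dl < 2 * l g -> 2 * l u + l g <= d u (g * u)%h + 2 * C + dl.
Proof.
move=> h1 h2 big; have := four_point_at u g 1%h (g * u)%h.
have -> : d 1%h (g * u)%h = d u g^-1%h by rewrite distC /dist !gE.
have -> : d g (g * u)%h = l u by rewrite /dist !gE.
rewrite (distC g) !dist1 (dist1r u).
have [? ? ?] := dist_len u g; have [? ? ?] := dist_len u g^-1%h.
move: h1 h2; rewrite /gprod (lenV hl); lia.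
Qed.

(** Both ends of one axis and one end of an independent axis form a tripod at 1. An element of
    bounded displacement nearly keeps its far ends, so it moves the centre by at most [K0], whatever
    its displacement bound [K]. Then [len_wpd] at one fixed [w0] suffices. *)
Lemma bounded_displacement_finite : exists s : seq G,
  forall x, (exists K, forall w, l (w^-1 * x * w)%h <= K) -> x \in s.
Proof.
have [k1 [k2 [C0 [hk kC]]]] := independent_axes.
have [C CE] : exists C, C = C0 + l k1 + dl by eexists.
pose K0 := 3 * C + 4 * dl.
have bd x K : (forall w, l (w^-1 * x * w)%h <= K) -> l x <= K0.
  (* The legs are taken long compared with [K], which for this reason does not enter [K0]. *)
  move=> xK; have [n nE] : exists n, n = K + 2 * C + 2 * dl + 1 by eexists.
  pose y1 := (sgn true k1 ^+ n)%h; pose y2 := (sgn false k1 ^+ n)%h.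
  pose y3 := (sgn true k2 ^+ n)%h.
  have [h13 n1 n3] := kC true true n n; have [h23 n2 _] := kC false true n n.
  rewrite -/y1 -/y2 -/y3 in h13 n1 n3 h23 n2.
  have h12 : gprod y1 y2 <= C.
    rewrite /gprod; have -> : d y1 y2 = l (k1 ^+ (n + n))%h.
      by rewrite distC /dist /y1 /y2 /= gexpV ginvK gexpD.
    by rewrite /y1 /y2 !len_sgn; have := len_expD n n hk; lia.
  pose z y := (x^-1 * y)%h.
  have lz y : l (z y) = d x y by [].
  have dz y y' : d (z y) (z y') = d y y' by rewrite /z distMl.
  have yz y : d y (z y) <= K.
    by rewrite distC /dist /z !gE.
  have e (y y' : G) : n <= l y + C0 -> n <= l y' + C0 -> gprod y y' <= C ->
      d x y + d x y' <= l y + l y' + C + 2 * dl /\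
      (l x + l y <= d x y + C + dl \/ l x + l y' <= d x y' + C + dl).
    move=> ny ny' gyy'.
    have := four_point1 y y' x; rewrite (distC y x) (distC y' x).
    have := gprod_min y (z y) (z y'); have := gprod_min y' (z y') y.
    rewrite (gprodC y' y) (gprodC (z y') y).
    have [] := dist_len y y'; have [] := dist_len y (z y).
    have [] := dist_len y' (z y'); have [] := dist_len (z y) (z y').
    have := yz y; have := yz y'; move: gyy'; rewrite /gprod !lz dz.
    lia.
  have := e y1 y2 n1 n2 h12; have := e y1 y3 n1 n3 ltac:(lia).
  have := e y2 y3 n2 n3 ltac:(lia); rewrite /K0; lia.
have [w0 lw0] := exists_len (2 * K0 + 2).
have [s sP] := len_wpd hl (K := K0) (w := w0) ltac:(lia).
exists s => x [K xK]; apply: sP; first exact: bd xK.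
apply: (bd _ K) => w; have := xK (w0 * w)%h; by rewrite !gE.
Qed.

Hypothesis displaces : forall f, f <> 1%h ->
  forall K, exists w, K < l (w^-1 * f * w)%h.

(** If every point away from [t] were moved by at most [K], so would be a large ball about a far
    point [k] of a transverse axis. The conjugate of [f] by [k] would then be a non-trivial element
    of a finite set given by [len_wpd]; the radius [rho] is fixed beforehand so that each
    non-trivial element of that set moves some point of the ball about 1 by more than [K]. *)
Lemma displace_away : exists C, forall f K t, f <> 1%h ->
  exists2 u, gprod u t <= C & K < l (u^-1 * f * u)%h.
Proof.
have [C Ch] := transverse_axis; exists (C + dl) => f K t f1.
apply: contrapT => no.
have {}no u : gprod u t <= C + dl -> l (u^-1 * f * u)%h <= K.
  by move=> ut; rewrite leqNgt; apply/negP => lt; apply: no; exists u.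
have [h hP] := Ch t.
have [w0 lw0] := exists_len (2 * K + 2).
have [s sP] := len_wpd hl (K := K) (w := w0) ltac:(lia).
have [rho rhoP] : exists rho, forall g, g \in s -> g <> 1%h ->
    exists2 w, l w <= rho & K < l (w^-1 * g * w)%h.
  elim: s {sP} => [|g s [rho IH]]; first by exists 0.
  have [g1|g1] := pselect (g = 1%h).
    by exists rho => g' + g'1; rewrite inE => /orP[/eqP e|/IH]; [by case: g'1; rewrite e|apply].
  have [w gw] := displaces g1 K; exists (maxn rho (l w)) => g' + g'1.
  rewrite inE => /orP[/eqP ->|/IH /(_ g'1) [w' ? ?]].
    by exists w => //; rewrite leq_maxr.
  by exists w' => //; rewrite leq_max; apply/orP; left.
pose k := (sgn true h ^+ (maxn rho (l w0) + 2 * C + 2 * dl + 1))%h.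
have [lk kt] := hP true (maxn rho (l w0) + 2 * C + 2 * dl + 1); rewrite -/k in lk kt.
have near w : l w <= maxn rho (l w0) -> l (w^-1 * (k^-1 * f * k) * w)%h <= K.
  move=> lw; have := no (k * w)%h; rewrite !gE; apply.
  have := gprod_min (k * w)%h k t; have := gprod_min k (k * w)%h t.
  have [? ? ?] := dist_len k (k * w)%h.
  have dkw : d k (k * w)%h = l w by rewrite /dist !gE.
  move: kt; rewrite /gprod (distC _ k) dkw; lia.
have fk1 : (k^-1 * f * k)%h <> 1%h.
  move=> e; apply: f1; have := congr1 (fun x => k * x * k^-1)%h e; by rewrite !gE.
have fs : (k^-1 * f * k)%h \in s.
  apply: sP; last by apply: near; rewrite leq_maxr.
  by have := near 1%h; rewrite !gE (len1 hl); apply.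
have [w lw] := rhoP _ fs fk1; rewrite ltnNge near //.
by rewrite leq_max lw.
Qed.

(** Treat one element at a time. The new conjugator [u] points away from [s^-1], hence from the
    conjugates that are already long and from their inverses; by [dist_translate] these keep length
    at least [K]. *)
Lemma displace_all (F : seq G) K : (forall f, f \in F -> f <> 1%h) ->
  exists s, forall f, f \in F -> K <= l (s^-1 * f * s)%h.
Proof.
have [C hC] := displace_away.
elim: F K => [|f F IH] K F1; first by exists 1%h.
have [m mP] : exists m, forall g, g \in F -> l g <= m.
  elim: F {IH F1} => [|g F [m IH]]; first by exists 0.
  exists (maxn m (l g)) => g'; rewrite inE leq_max => /orP[/eqP ->|/IH ->//].
  by rewrite leqnn orbT.
have [|s sP] := IH (K + m + 2 * C + 5 * dl + 1).
  by move=> g gF; apply: F1; rewrite inE gF orbT.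
have fs1 : (s^-1 * f * s)%h <> 1%h.
  move=> e; apply: (F1 f); first by rewrite inE eqxx.
  by have := congr1 (fun x => s * x * s^-1)%h e; rewrite !gE.
have [u us ufK] := hC (s^-1 * f * s)%h K s^-1%h fs1.
exists (s * u)%h => g; rewrite inE => /orP[/eqP ->|gF].
  by rewrite !gE; move: ufK; rewrite !gE => /ltnW.
pose g' := (s^-1 * g * s)%h; have lg' := sP _ gF; rewrite -/g' in lg'.
have lg := mP _ gF.
have d1 : d s^-1%h (g' * s^-1)%h = l g by rewrite /dist !gE.
have d2 : d s^-1%h (g'^-1 * s^-1)%h = l g by rewrite /dist !gE (lenV hl).
have p1 := @gprod_away C g' s^-1%h u us ltac:(lia).
have p2 := @gprod_away C g'^-1%h s^-1%h u us ltac:(rewrite (lenV hl); lia).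
have := dist_translate p1 p2 ltac:(lia).
have -> : l ((s * u)^-1 * g * (s * u))%h = d u (g' * u)%h by rewrite /dist !gE.
lia.
Qed.

Lemma gprod_shift e y : gprod y e + gprod (e^-1 * y)%h e^-1%h = 2 * l e.
Proof.
rewrite /gprod; have -> : d (e^-1 * y)%h e^-1%h = l y.
  by rewrite -(lenV hl) /dist !gE.
have [? ? ?] := dist_len y e; move: (distC y e); rewrite {2}/dist (lenV hl); lia.
Qed.

(** Seen from [s], the set [D] consists of the points in the direction of 1. Each [s^-1 * f * s] is
    long but moves [s^-1] by only [l f], so it is directed like [s^-1], and [f^-1] throws the
    complement of [D] into [D]. Powers of an element transverse to [s^-1] make the translates
    disjoint. *)
Lemma powers_sets (F : seq G) n : (forall f, f \in F -> f <> 1%h) ->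
  exists (D : G -> bool) (g : nat -> G),
    (forall f x, f \in F -> ~~ D x -> D (f^-1 * x)%h) /\
    (forall i j x, i < n -> j < n -> D ((g i)^-1 * x)%h -> D ((g j)^-1 * x)%h -> i = j).
Proof.
move=> F1; have [C0 ax] := transverse_axis.
have [C CE] : exists C, C = C0 + dl by eexists.
have [m mP] : exists m, forall g, g \in F -> l g <= m.
  elim: F {F1} => [|g F [m IH]]; first by exists 0.
  exists (maxn m (l g)) => g'; rewrite inE leq_max => /orP[/eqP ->|/IH ->//].
  by rewrite leqnn orbT.
have [s sP] := displace_all (m + 2 * C + 2 * dl + 1) F1.
have [h hP] := ax s^-1%h.
pose D x := C < gprod (s^-1 * x)%h s^-1%h.
(* With this [N] every positive power of [h ^+ N] is longer than [C], which contradicts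
   [gprod_shift] if two translates meet. *)
pose N := 2 * C + 2 * dl + 1 + C0.
exists D, (fun i => h ^+ (N * i) * s^-1)%h; split.
  move=> f x fF; rewrite /D -leqNgt => xC; rewrite ltnNge; apply/negP => fxC.
  pose f' := (s^-1 * f * s)%h; have lf' := sP _ fF; rewrite -/f' in lf'.
  have lf := mP _ fF.
  have d1 : d s^-1%h (f' * s^-1)%h = l f by rewrite /dist !gE.
  have d2 : d s^-1%h (f'^-1 * s^-1)%h = l f by rewrite /dist !gE (lenV hl).
  have p1 := @gprod_away C f' s^-1%h _ xC ltac:(lia).
  have p2 := @gprod_away C f'^-1%h s^-1%h _ fxC ltac:(rewrite (lenV hl); lia).
  have := gprod_shift f' (s^-1 * x)%h.
  have -> : (f'^-1 * (s^-1 * x) = s^-1 * (f^-1 * x))%h by rewrite /f' !gE.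
  lia.
move=> i j x; wlog ij : i j / i < j.
  by move=> wl ? ? ? ?; case: (ltngtP i j) => // lt; [|apply/esym]; apply: wl.
move=> _ _; rewrite /D => hi hj; exfalso.
pose e := (h ^+ (N * (j - i)))%h.
have [le et] := hP true (N * (j - i)); have [_ eVt] := hP false (N * (j - i)).
rewrite /= gexpV -/e in le et eVt.
have Nij : N <= N * (j - i) by rewrite leq_pmulr // subn_gt0.
pose y := ((h ^+ (N * i))^-1 * x)%h.
have yE : (s^-1 * ((h ^+ (N * i) * s^-1)^-1 * x) = y)%h by rewrite !gE.
have eyE : (s^-1 * ((h ^+ (N * j) * s^-1)^-1 * x) = e^-1 * y)%h.
  rewrite /e /y; have -> : (h ^+ (N * j) = h ^+ (N * i) * h ^+ (N * (j - i)))%h.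
    by rewrite -gexpD -mulnDr subnKC // ltnW.
  by rewrite !gE.
rewrite yE in hi; rewrite eyE in hj.
have := gprod_shift e y.
have := gprod_min e y s^-1%h; have := gprod_min e^-1%h (e^-1 * y)%h s^-1%h.
by rewrite (gprodC e y) (gprodC e^-1%h) /N in le Nij *; lia.
Qed.
End HyperbolicLength.

Import Order.TTheory GRing.Theory Num.Theory.

(** * Integer weights of paths and the linear isoperimetric inequality *)

Section Cocycles.
Variables (G : groupType) (Lambda : Type).
Variables (H : Lambda -> subgroupType G) (X : set G).
Local Notation FP := (free_product H X).
Local Open Scope ring_scope.

Definition rel_letter_val (a : rel_letter H X) : G :=
  match a with inl x => val x | inr (existT l h) => val h end.

Definition rel_word_val (w : seq (rel_letter H X)) : G :=
  foldr (fun a g => gmul (rel_letter_val a) g) gone w.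

Lemma rel_word_val_cat u v :
  rel_word_val (u ++ v) = gmul (rel_word_val u) (rel_word_val v).
Proof. by elim: u => [|a u IH] /=; rewrite ?gmul1l // IH gmulA. Qed.

Lemma rel_letter_fp_val a : fp_epi (rel_letter_fp a) = rel_letter_val a.
Proof.
by case: a => [x|[l h]] /=; rewrite fp_epi_class /fp_word_val big_seq1.
Qed.

Lemma rel_word_fp_val w : fp_epi (rel_word_fp w) = rel_word_val w.
Proof.
rewrite /rel_word_fp; elim: w => [|a w IH]; first by rewrite big_nil fp_epi1.
by rewrite big_cons fp_epiM IH rel_letter_fp_val.
Qed.

Section Cocycle.
Variables (jx : G -> G -> int) (th : Lambda -> G -> int).

(* Weighing the edges of a coset of [H l] by the differences of a potential
   [th l] makes the weight of a path compatible with the relations of [H l]. *)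
Definition letter_weight (a : fp_letter H X) (g : G) : int :=
  match a with
  | FpGen x true => jx g (gmul g (val x))
  | FpGen x false => - jx (gmul g (ginv (val x))) g
  | FpPer l h => th l (gmul g (val h)) - th l g
  end.

Fixpoint weight (u : seq (fp_letter H X)) (g : G) : int :=
  match u with
  | [::] => 0
  | a :: u' => letter_weight a g + weight u' (gmul g (fp_letter_val a))
  end.

Lemma fp_word_val_cons a u :
  fp_word_val (a :: u) = gmul (fp_letter_val a) (@fp_word_val G Lambda H X u).
Proof. by rewrite /fp_word_val big_cons. Qed.

Lemma weight_cat u v g :
  weight (u ++ v) g = weight u g + weight v (gmul g (fp_word_val u)).
Proof.
elim: u g => [|a u IH] g /=.
  by rewrite add0r /fp_word_val big_nil [gmul _ _]gmul1.
by rewrite IH addrA fp_word_val_cons gmulA.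
Qed.

Lemma weight_eq u v : fp_eq u v -> forall g, weight u g = weight v g.
Proof.
elim=> {u v} //.
- by move=> u v w _ IH _ IH' g; rewrite IH IH'.
- move=> u u' v v' e IH e' IH' g; rewrite !weight_cat IH IH'.
  by rewrite (fp_word_val_eq e).
- move=> x [] g /=; rewrite addr0.
    by rewrite gmulK subrr.
  by rewrite gmulVK addNr.
- by move=> l h /= h1 g; rewrite h1 [gmul g _]gmul1 subrr addr0.
- move=> l h k m /= -> g; rewrite !addr0 gmulA.
  by rewrite addrC subrKA.
Qed.

Definition fp_weight (f : FP) (g : G) : int := weight (fp_word f) g.

Lemma fp_weight_class u g : fp_weight (fp_class u) g = weight u g.
Proof. exact: weight_eq (fp_classK u) g. Qed.

Lemma fp_weightM (f f' : FP) g :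
  fp_weight (f * f')%g g = fp_weight f g + fp_weight f' (gmul g (fp_epi f)).
Proof. by rewrite [LHS]fp_weight_class weight_cat. Qed.

Lemma fp_weight1 g : fp_weight 1%g g = 0.
Proof. by rewrite [LHS]fp_weight_class. Qed.

Lemma fp_epiV (f : FP) : fp_epi (f^-1)%g = ginv (fp_epi f).
Proof. exact: (gmulfV (@fp_epi G Lambda H X)). Qed.

Lemma fp_weightV (f : FP) g :
  fp_weight (f^-1)%g g = - fp_weight f (gmul g (ginv (fp_epi f))).
Proof.
apply/eqP; rewrite -addr_eq0 -fp_epiV -fp_weightM mulVg.
by rewrite fp_weight1.
Qed.

(** The weights of a conjugator and of its inverse cancel, because the relator between them is a
    closed path. *)
Lemma relator_weight (Rel : set FP) (B : nat) :
  (forall r, Rel r -> fp_epi r = 1%g) ->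
  (forall r g, Rel r -> `|fp_weight r g| <= B%:Z) ->
  forall s g, (forall c, c \in s -> Rel c.1.2) ->
  `|fp_weight (relator_product s) g| <= (size s * B)%:Z.
Proof.
move=> ker bnd s g; rewrite /relator_product.
elim: s g => [|[[f r] e] s IH] g sR.
  by rewrite big_nil fp_weight1 normr0.
have rR : Rel r by apply: (sR (f, r, e)); rewrite inE eqxx.
rewrite big_cons fp_weightM; apply: (le_trans (ler_normD _ _)).
rewrite /= mulSn PoszD lerD //; last first.
  by apply: IH => c cs; apply: sR; rewrite inE cs orbT.
set t := (if e then r else r^-1)%g.
have t1 : fp_epi t = 1%g.
  by rewrite /t; case: (e); rewrite ?fp_epiV ker //; exact: ginv1.
have tB h : `|fp_weight t h| <= B%:Z.
  by rewrite /t; case: (e); rewrite ?fp_weightV ?normrN bnd.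
rewrite !fp_weightM fp_epiM t1 mulg1 fp_weightV fp_epiV.
by rewrite addrAC addNr add0r.
Qed.

Definition rel_letter_weight (a : rel_letter H X) (g : G) : int :=
  match a with
  | inl x => jx g (gmul g (val x))
  | inr (existT l h) => th l (gmul g (val h)) - th l g
  end.

Fixpoint rel_weight (w : seq (rel_letter H X)) (g : G) : int :=
  match w with
  | [::] => 0
  | a :: w' => rel_letter_weight a g + rel_weight w' (gmul g (rel_letter_val a))
  end.

Lemma rel_weight_fp w g : fp_weight (rel_word_fp w) g = rel_weight w g.
Proof.
rewrite /rel_word_fp; elim: w g => [|a w IH] g.
  by rewrite big_nil fp_weight1.
rewrite big_cons fp_weightM IH rel_letter_fp_val /=; congr (_ + _).
by case: a => [x|[l h]] /=; rewrite fp_weight_class /= addr0.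
Qed.

Lemma rel_weight_cat u v g :
  rel_weight (u ++ v) g = rel_weight u g + rel_weight v (gmul g (rel_word_val u)).
Proof.
elim: u g => [|a u IH] g /=; first by rewrite add0r gmul1.
by rewrite IH addrA gmulA.
Qed.
End Cocycle.

(** The isoperimetric constant is rounded up to a natural number. It is fixed before the weights,
    which may therefore be adapted to the loop. *)
Lemma loop_weight (R : realType) (Rel : set FP) :
  (forall r, Rel r -> fp_epi r = 1%g) -> linear_isoperimetric R Rel ->
  exists C : nat, forall jx th (B : nat),
    (forall r g, Rel r -> `|fp_weight jx th r g| <= B%:Z) ->
    forall w g, rel_word_val w = gone ->
    `|rel_weight jx th w g| <= (C * size w * B)%:Z.
Proof.
move=> ker [C C0 iso]; exists (Num.bound C) => jx th B bnd w g w1.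
have [|s [sR sE ss]] := iso w; first by rewrite rel_word_fp_val.
rewrite -rel_weight_fp sE; apply: le_trans (relator_weight ker bnd _ sR) _.
rewrite lez_nat leq_mul2r; apply/orP; right.
rewrite -(ler_nat R) natrM; apply: (le_trans ss).
rewrite ler_wpM2r //; apply/ltW; apply: le_lt_trans (ler_norm _) _.
by have := archi_boundP (normr_ge0 C); rewrite /Num.bound normr_id.
Qed.
End Cocycles.

Section Subgroups.
Variable (G : groupType).
Implicit Types (K : subgroupType G) (x y : G).

Lemma subgroup1 K : (K : set G) gone.
Proof. by have [K1 _] := subgroup_setP K; apply: set_mem. Qed.

Lemma subgroupV K x : (K : set G) x -> (K : set G) (ginv x).
Proof.
have [K1 KV] := subgroup_setP K => /mem_set Kx; apply: set_mem.
by rewrite -[ginv x]gmul1l; exact: KV.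
Qed.

Lemma subgroupM K x y : (K : set G) x -> (K : set G) y -> (K : set G) (gmul x y).
Proof.
have [K1 KV] := subgroup_setP K => Kx /subgroupV Ky.
by rewrite -[y]ginvK; apply: set_mem; apply: KV; apply: mem_set.
Qed.
End Subgroups.

(** * The word length relative to the peripheral subgroups *)

Section WordLength.
Variables (G : groupType) (Lambda : Type).
Variables (H : Lambda -> subgroupType G) (X : set G).
Hypothesis XV : forall x, X x -> X (ginv x).
Hypothesis gen : relative_generating H X.
Local Notation rval := (@rel_letter_val G Lambda H X).
Local Notation wval := (@rel_word_val G Lambda H X).
Implicit Types (g h x y o p : G).

Lemma rel_letter_X x : X x -> exists a, rval a = x.
Proof. by move=> Xx; exists (inl (exist _ x (mem_set Xx))). Qed.

Lemma rel_letter_H i x : (H i : set G) x -> x <> gone -> exists a, rval a = x.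
Proof.
move=> Hx x1; have Hx' : (H i `\` [set 1%g]) x by split.
by exists (inr (existT _ i (exist _ x (mem_set Hx')))).
Qed.

Lemma rel_letter_inv a : exists b, rval b = ginv (rval a).
Proof.
case: a => [[x Xx]|[i [h Hh]]] /=; first exact/rel_letter_X/XV/set_mem.
have [Hh' h1] := set_mem Hh; apply: (@rel_letter_H i); first exact: subgroupV.
by move=> e; apply: h1; rewrite /= -[h]ginvK e; exact: ginv1.
Qed.

Lemma rel_word_inv w : exists2 w', size w' = size w & wval w' = ginv (wval w).
Proof.
elim: w => [|a w [w' sw' vw']]; first by exists [::] => //=; rewrite ginv1.
have [b vb] := rel_letter_inv a; exists (w' ++ [:: b]).
  by rewrite size_cat addn1 /= sw'.
by rewrite rel_word_val_cat vw' /= vb !gE.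
Qed.

Lemma exists_rel_word g : exists w, wval w = g.
Proof.
have : generated (X `|` \bigcup_l (H l : set G)) g by rewrite gen.
move=> /(_ [set g | exists w, wval w = g]); apply; split.
  split; first by apply: mem_set; exists [::].
  move=> x y /set_mem[u <-] /set_mem[v <-]; apply: mem_set.
  have [v' _ vv'] := rel_word_inv v; exists (u ++ v').
  by rewrite rel_word_val_cat vv'.
move=> x [Xx|[i _ Hx]].
  by have [a <-] := rel_letter_X Xx; exists [:: a]; rewrite /= gmul1.
have [->|x1] := pselect (x = gone); first by exists [::].
by have [a <-] := rel_letter_H Hx x1; exists [:: a]; rewrite /= gmul1.
Qed.

Definition is_word_length (l : G -> nat) :=
  (forall g, exists2 w, size w = l g & wval w = g) /\
  (forall w, l (wval w) <= size w).

Lemma exists_word_length : exists l, is_word_length l.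
Proof.
have ex g : exists n, `[< exists2 w, size w = n & wval w = g >].
  by have [w wg] := exists_rel_word g; exists (size w); apply/asboolP; exists w.
exists (fun g => ex_minn (ex g)); split=> [g|w].
  by case: ex_minnP => n /asboolP[w]; exists w.
by case: ex_minnP => n _; apply; apply/asboolP; exists w.
Qed.

Variable l : G -> nat.
Hypothesis wl : is_word_length l.

Lemma word_length_geodesic : geodesic_length l.
Proof.
have [ex le] := wl; split.
- by apply/eqP; rewrite -leqn0 -[0]/(size (@nil (rel_letter H X))); exact: le.
- have lV g : l (ginv g) <= l g.
    have [w sw wg] := ex g; have [w' sw' vw'] := rel_word_inv w.
    by rewrite -sw -sw' -wg -vw'; exact: le.
  by move=> g; apply/eqP; rewrite eqn_leq lV -{1}[g]ginvK lV.
- have lM g h : l (gmul g h) <= l g + l h.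
    have [u su ug] := ex g; have [v sv vh] := ex h.
    by rewrite -su -sv -size_cat -ug -vh -rel_word_val_cat; exact: le.
  exact: lM.
- move=> g i ig; have [w sw wg] := ex g.
  exists (wval (take i w)), (wval (drop i w)).
  have e : g = gmul (wval (take i w)) (wval (drop i w)).
    by rewrite -rel_word_val_cat cat_take_drop.
  have lt := le (take i w); have ld := le (drop i w).
  rewrite size_takel ?sw // in lt; rewrite size_drop sw in ld.
  have : l g <= l (wval (take i w)) + l (wval (drop i w)).
    have [u su eu] := ex (wval (take i w)); have [v sv ev] := ex (wval (drop i w)).
    by rewrite -su -sv -size_cat {1}e -eu -ev -rel_word_val_cat; exact: le.
  by split => //; lia.
- by move=> g g0; have [w + <-] := ex g; rewrite g0 => /size0nil ->.
Qed.
Let gl := word_length_geodesic.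
Local Notation d := (dist l).

Lemma len_rel_letter a : l (rval a) <= 1.
Proof. by have [_ le] := wl; have := le [:: a]; rewrite /= gmul1. Qed.

Lemma len_peripheral i x : (H i : set G) x -> l x <= 1.
Proof.
move=> Hx; have [->|x1] := pselect (x = gone); first by rewrite (len1 gl).
by have [a <-] := rel_letter_H Hx x1; exact: len_rel_letter.
Qed.

Lemma len_fp_letter (a : fp_letter H X) : l (fp_letter_val a) <= 1.
Proof.
case: a => [[x Xx] b|i [h Hh]] /=; last exact: (len_peripheral (set_mem Hh)).
have [a ax] := rel_letter_X (set_mem Xx).
have lx : l x <= 1 by rewrite -ax; exact: len_rel_letter.
by case: b => //; rewrite (_ : l _ = l x) //; exact: (lenV gl).
Qed.

Lemma rel_letter_of_len g : l g <= 1 -> g = gone \/ exists a, rval a = g.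
Proof.
have [ex _] := wl; have [[|a [|b w]] <- <-] := ex g => //= _; [by left|right].
by exists a; rewrite gmul1.
Qed.

Lemma dist_step g x : d g (gmul g x) = l x.
Proof. by rewrite /dist !gE. Qed.

(** [area_th] measures [psi] from this point: the coset has diameter at most one, so the difference
    is -1, 0 or 1 even if the coset is infinite. *)
Lemma exists_coset_rep : exists rep : Lambda -> G -> G, forall i g,
  (forall h, (H i : set G) h -> rep i (gmul g h) = rep i g) /\ d g (rep i g) <= 1.
Proof.
(* The default [gone] of [xget] never occurs, since the coset contains [g]. *)
exists (fun i g => xget gone [set y | (H i : set G) (gmul (ginv g) y)]) => i g.
split=> [h Hh|]; last first.
  apply: (@len_peripheral i); set P := [set y | _].
  have : P (xget gone P); last by [].
  by apply: xgetPex; exists g; rewrite /P /= gmulVl; exact: subgroup1.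
congr xget; apply/seteqP; split=> y /= Hy.
  have := subgroupM Hh Hy; by rewrite !gE.
have := subgroupM (subgroupV Hh) Hy; by rewrite !gE.
Qed.

(** * The 1-form [W d psi] on relators and along geodesics *)

Section Area.
Local Open Scope ring_scope.
Variables (rep : Lambda -> G -> G) (psi W : G -> nat).
Hypothesis repP : forall i g,
  (forall h, (H i : set G) h -> rep i (gmul g h) = rep i g) /\ (d g (rep i g) <= 1)%N.
Hypothesis psi_lip : forall g h, (psi h <= psi g + d g h)%N.
Hypothesis W_lip : forall g h, (W h <= W g + d g h)%N.

(* With [psi] and the radial function [W] as coordinates, these weights integrate
   the 1-form [W d psi]; a relator, being of bounded length, has bounded integral,
   so by the linear isoperimetric inequality the integral over a loop is at most
   linear in its length. *)
Definition area_jx g h : int := (W g)%:Z * ((psi h)%:Z - (psi g)%:Z).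
Definition area_th i g : int := (W g)%:Z * ((psi g)%:Z - (psi (rep i g))%:Z).
Local Notation J := (letter_weight area_jx area_th).

Lemma norm_mul_le (m e : int) (D : nat) :
  `|m| <= D%:Z -> `|e| <= 1 -> `|m * e| <= D%:Z.
Proof. by move=> mD e1; rewrite normrM -[D%:Z]mulr1 ler_pM. Qed.

Lemma psi_step g h : (d g h <= 1)%N -> `|(psi h)%:Z - (psi g)%:Z| <= 1.
Proof.
have := psi_lip g h; have := psi_lip h g; rewrite (distC gl h g); lia.
Qed.

(** Comparison with the exact form [c d psi]. On a peripheral edge each endpoint contributes one
    error [D], hence the factor 2. *)
Lemma letter_area (a : fp_letter H X) g (c : int) (D : nat) :
  `|(W g)%:Z - c| <= D%:Z -> `|(W (gmul g (fp_letter_val a)))%:Z - c| <= D%:Z ->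
  `|J a g - c * ((psi (gmul g (fp_letter_val a)))%:Z - (psi g)%:Z)| <= (2 * D)%:Z.
Proof.
have la := len_fp_letter a; have := psi_step (g := g) (h := gmul g (fp_letter_val a)).
rewrite dist_step => /(_ la); case: a la => [x [] /=|i h /=] la ps gc gac.
- rewrite /area_jx -mulrBl; apply: (@le_trans _ _ D%:Z); last by lia.
  exact: norm_mul_le.
- rewrite /area_jx -mulrN opprB -mulrBl; apply: (@le_trans _ _ D%:Z); last by lia.
  exact: norm_mul_le.
have Hh : (H i : set G) (val h) by exact/set_mem/(valP h).
have [/(_ _ Hh) re dr] := repP i g; have [_ dr'] := repP i (gmul g (val h)).
have e1 := psi_step dr; have e2 := psi_step dr'.
rewrite /area_th re in e2 *; set r := rep i g in e1 e2 *.
have -> : (W (gmul g (val h)))%:Z * ((psi (gmul g (val h)))%:Z - (psi r)%:Z) -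
    (W g)%:Z * ((psi g)%:Z - (psi r)%:Z) -
    c * ((psi (gmul g (val h)))%:Z - (psi g)%:Z) =
    ((W (gmul g (val h)))%:Z - c) * ((psi (gmul g (val h)))%:Z - (psi r)%:Z) -
    ((W g)%:Z - c) * ((psi g)%:Z - (psi r)%:Z) by ring.
apply: le_trans (ler_normB _ _) _; rewrite mul2n -addnn PoszD.
by apply: lerD; apply: norm_mul_le => //; rewrite distrC.
Qed.

Lemma weight_area (u : seq (fp_letter H X)) g (c : int) (D : nat) :
  `|(W g)%:Z - c| + (size u)%:Z <= D%:Z ->
  `|weight area_jx area_th u g -
    c * ((psi (gmul g (@fp_word_val G Lambda H X u)))%:Z - (psi g)%:Z)|
  <= (2 * D * size u)%:Z.
Proof.
elim: u g => [|a u IH] g hD.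
  by rewrite /fp_word_val big_nil [gmul _ _]gmul1 /= subrr mulr0 subr0 normr0.
rewrite fp_word_val_cons gmulA /=; set g' := gmul g (fp_letter_val a).
have la : (d g g' <= 1)%N by rewrite dist_step len_fp_letter.
have w1 := W_lip g g'; have w2 := W_lip g' g; rewrite (distC gl g' g) in w2.
have la' := @letter_area a g c D; rewrite -/g' in la'.
have {}IH := IH g'; move: hD; rewrite /= => hD.
have -> : J a g + weight area_jx area_th u g' -
    c * ((psi (gmul g' (fp_word_val u)))%:Z - (psi g)%:Z) =
  (J a g - c * ((psi g')%:Z - (psi g)%:Z)) + (weight area_jx area_th u g' -
    c * ((psi (gmul g' (fp_word_val u)))%:Z - (psi g')%:Z)) by ring.
apply: le_trans (ler_normD _ _) _; rewrite mulnS PoszD lerD //.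
  by apply: la'; lia.
by apply: IH; lia.
Qed.

(** On a closed path [c d psi] integrates to zero; take for [c] the value of [W] at the base
    point. *)
Lemma relator_area (u : seq (fp_letter H X)) g (M : nat) : (size u <= M)%N ->
  fp_word_val u = gone -> `|weight area_jx area_th u g| <= (2 * M * M)%:Z.
Proof.
move=> uM u1; have := @weight_area u g (W g)%:Z (size u).
rewrite u1 gmul1 !subrr normr0 mulr0 subr0 add0r => /(_ (lexx _)) h.
by apply: (le_trans h); rewrite lez_nat !leq_mul.
Qed.

(** On a peripheral edge the difference of [psi] from the representative goes from 0 to 1 or from -1
    to 0, so the weight is the value of [W] at one of the two ends. *)
Lemma rel_letter_area a g : psi (gmul g (rval a)) = (psi g).+1 ->
  (W g)%:Z - 1 <= rel_letter_weight area_jx area_th a g /\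
  0 <= rel_letter_weight area_jx area_th a g.
Proof.
have la := len_rel_letter a.
case: a la => [x|[i [h hP]]] /= la; rewrite /area_jx /area_th => ps.
  rewrite ps; have -> : (psi g).+1%:Z - (psi g)%:Z = 1 by lia.
  by rewrite mulr1; split; lia.
have Hh : (H i : set G) h by have [] := set_mem hP.
have [/(_ _ Hh) re dr] := repP i g; have [_ dr'] := repP i (gmul g h).
rewrite ps re; have e1 := psi_step dr; have := psi_step dr'.
rewrite ps re; set r := rep i g in e1 *.
have w1 := W_lip g (gmul g h); have w2 := W_lip (gmul g h) g.
rewrite (distC gl _ g) dist_step in w1 w2.
move=> e2; have [e|e] : (psi g)%:Z - (psi r)%:Z = 0 \/ (psi g)%:Z - (psi r)%:Z = -1 by lia.
  have -> : (psi g).+1%:Z - (psi r)%:Z = 1 by lia.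
  by rewrite e mulr0 mulr1 subr0; split; lia.
have -> : (psi g).+1%:Z - (psi r)%:Z = 0 by lia.
by rewrite e mulr0 mulrN1 sub0r opprK; split; lia.
Qed.

Lemma psi_word w g : (psi (gmul g (wval w)) <= psi g + size w)%N.
Proof.
apply: leq_trans (psi_lip g _) _; rewrite leq_add2l dist_step.
by have [_ le] := wl; exact: le.
Qed.

Lemma geodesic_area_ge0 w g : psi (gmul g (wval w)) = (psi g + size w)%N ->
  0 <= rel_weight area_jx area_th w g.
Proof.
elim: w g => [|a w IH] g //=; rewrite gmulA => e.
have := psi_word w (gmul g (rval a)); have := psi_word [:: a] g.
rewrite /= gmul1 => h1 h2.
have [|_ h3] := @rel_letter_area a g; first lia.
by apply: addr_ge0 => //; apply: IH; lia.
Qed.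

Lemma word_far w g o : (d o (gmul g (wval w)) <= d o g + size w)%N.
Proof.
have := dist_triangle gl o g (gmul g (wval w)); rewrite dist_step.
by have [_ le] := wl; have := le w; lia.
Qed.

(** Each letter at distance [d] from [o] contributes at least [r - d - 1], and these add up to a
    triangular number. *)
Lemma geodesic_area o r w g : (forall p, W p = r - d o p)%N ->
  psi (gmul g (wval w)) = (psi g + size w)%N ->
  d o (gmul g (wval w)) = (d o g + size w)%N -> (r <= d o g + size w)%N ->
  ((r - d o g) * (r - d o g - 1))%:Z <= 2 * rel_weight area_jx area_th w g.
Proof.
move=> WE; elim: w g => [|a w IH] g e1 e2 rw.
  by have -> : (r - d o g = 0)%N by move: rw => /=; lia.
have [small|big] := leqP r (d o g).
  have -> : (r - d o g = 0)%N by lia.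
  by rewrite mul0n; have := geodesic_area_ge0 e1; lia.
have := psi_word w (gmul g (rval a)); have := psi_word [:: a] g.
have := word_far w (gmul g (rval a)) o; have := word_far [:: a] g o.
move: e1 e2 rw; rewrite /= gmul1 gmulA addn1 => e1 e2 rw h1 h2 h3 h4.
have ps : psi (gmul g (rval a)) = (psi g).+1 by lia.
have dp : d o (gmul g (rval a)) = (d o g).+1 by lia.
have [wa _] := rel_letter_area ps; rewrite WE in wa.
have := IH (gmul g (rval a)); rewrite ps dp addSnnS => /(_ _ _ _).
move=> /(_ ltac:(lia) ltac:(lia) ltac:(lia)).
have [m mE] : exists m, (r - d o g = m.+1)%N by exists (r - d o g).-1; lia.
have -> : (r - (d o g).+1 = m)%N by lia.
rewrite mE in wa *; have -> : (m.+1 * (m.+1 - 1) = 2 * m + m * (m - 1))%N.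
  by case: (m) => // k; nia.
by rewrite PoszD mulrDr => h; apply: lerD => //; lia.
Qed.

Lemma path_word n (c : nat -> G) : (forall i, (i < n)%N -> (d (c i) (c i.+1) <= 1)%N) ->
  (forall i, (i <= n)%N -> W (c i) = 0%N) ->
  exists w, [/\ (size w <= n)%N, gmul (c 0%N) (wval w) = c n &
    rel_weight area_jx area_th w (c 0%N) = 0].
Proof.
elim: n c => [|n IH] c cs W0; first by exists [::]; rewrite /= gmul1.
have [|i ni|w [sw wn w0]] := IH (fun i => c i.+1).
- by move=> i ni; apply: cs.
- by apply: W0.
have d01 := cs 0%N (ltn0Sn n); rewrite /dist in d01.
have [e|[a e]] := rel_letter_of_len d01.
  have e0 : c 0%N = c 1%N by apply: (dist_eq0 gl); rewrite /dist e (len1 gl).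
  by exists w; split; [lia|rewrite e0|rewrite e0].
have ce : gmul (c 0%N) (rval a) = c 1%N by rewrite e !gE.
exists (a :: w); split => //=; first by rewrite gmulA ce.
rewrite ce w0 addr0; have W0' := W0 0%N isT; have W1 := W0 1%N isT.
case: a e ce => [x|[i h]] /= e ce; rewrite /area_jx /area_th ?ce ?W0' ?W1 !mul0r //.
Qed.
End Area.

(** * Quadratic bound, weak proper discontinuity and unboundedness of the relative length *)

Section RelativelyHyperbolic.
Variables (R : realType) (Rel : set (free_product H X)).
Hypothesis finX : finite_set X.
Hypothesis finRel : finite_set Rel.
Hypothesis pres : relative_presentation Rel.
Hypothesis iso : linear_isoperimetric R Rel.

Lemma relator_ker r : Rel r -> fp_epi r = 1%g.
Proof.
move=> Rr; have [_ e] := pres.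
have : normal_closure Rel r by move=> N [_ /(_ _ Rr)].
by rewrite -e.
Qed.

Lemma relator_ker_word r : Rel r -> fp_word_val (fp_word r) = gone.
Proof. exact: relator_ker. Qed.

Lemma relator_size : exists M, forall r, Rel r -> (size (fp_word r) <= M)%N.
Proof.
have [s sE] := (finite_seqP Rel).1 finRel.
exists (\max_(r <- s) size (fp_word r)) => r; rewrite sE => rs.
exact: (@leq_bigmax_seq _ s xpredT (fun r => size (fp_word r)) r rs isT).
Qed.

(* On the geodesic through [o] the form [W d psi] with [W g = r - d o g] integrates
   to at least [r * (r - 1) / 2], and it vanishes on a path avoiding the ball. *)
Lemma avoid_quadratic : exists K, forall o r x y n, d x o + d o y = d x y ->
  avoid l o r y x n -> r * (r - 1) <= K * (d x y + n).
Proof.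
have [M MP] := relator_size; have [C CP] := loop_weight relator_ker iso.
have [rep repP] := exists_coset_rep; have [ex le] := wl.
(* [2 * M * M] bounds the weight of a relator, [C] the number of relators per letter of the loop,
   and the outer 2 clears the half in the triangular number. *)
exists (2 * (C * (2 * M * M))) => o r x y n oxy [c [c0 cn cs ca]].
pose psi g := d x g; pose W g := r - d o g.
have psi_lip g h : psi h <= psi g + d g h by exact: (dist_triangle gl).
have W_lip g h : W h <= W g + d g h.
  by rewrite /W; have := dist_triangle gl o h g; rewrite (distC gl h g); lia.
have [w [sw wn w0]] := @path_word rep psi W n c cs ltac:(move=> i /ca; rewrite /W; lia).
have [u su vu] := ex (gmul (ginv x) o); have [v sv vv] := ex (gmul (ginv o) y).
have ou : gmul x (wval u) = o by rewrite vu !gE.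
have yv : gmul o (wval v) = y by rewrite vv !gE.
have loop : wval (u ++ v ++ w) = gone.
  rewrite !rel_word_val_cat; apply: (@gmulI _ x).
  by rewrite !gmulA ou yv -c0 wn cn gmul1.
have au := geodesic_area_ge0 repP psi_lip W_lip (w := u) (g := x).
have av := geodesic_area repP psi_lip W_lip (o := o) (r := r) (w := v) (g := o) (fun=> erefl).
have psix : psi x = 0 by rewrite /psi (distxx gl).
have roy : r <= d o y by have := ca 0 (leq0n n); rewrite c0.
rewrite ou psix su in au; rewrite yv sv (distxx gl) subn0 in av.
have {}au := au erefl; have {}av := av (esym oxy) erefl roy.
have rel_bound r0 g : Rel r0 ->
    (`|fp_weight (area_jx psi W) (area_th rep psi W) r0 g| <= (2 * M * M)%:Z)%R.
  move=> Rr; apply: (relator_area repP psi_lip W_lip); first exact: MP.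
  exact: relator_ker_word.
have := CP _ _ _ rel_bound (u ++ v ++ w) x loop.
rewrite !rel_weight_cat ou yv -{1}c0 w0 addr0 !size_cat su sv => h.
have -> : d x y = l (ginv x * o)%h + l (ginv o * y)%h by rewrite -oxy.
move: h; set A := rel_weight _ _ u x in au *; set B := rel_weight _ _ v o in av *.
have : C * (l (x^-1 * o)%h + (l (o^-1 * y)%h + size w)) * (2 * M * M) <=
    C * (2 * M * M) * (l (x^-1 * o)%h + l (o^-1 * y)%h + n).
  by rewrite mulnAC -addnA leq_mul2l !leq_add2l sw orbT.
rewrite -[2 * (C * _) * _]mulnA; lia.
Qed.

Section Potentials.
Local Open Scope ring_scope.
Variables (i0 : Lambda) (lev : G -> nat) (V : set G).
Hypothesis VH : forall g h, (H i0 : set G) h -> V g <-> V (gmul g h).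

(** [V] is a union of cosets of [H i0], so no letter of [H i0] crosses its boundary and the cut-off
    creates no jump. *)
Definition potential (i : Lambda) (g : G) : int :=
  if `[< i = i0 /\ V g >] then (lev g)%:Z else 0.
Local Notation rw := (rel_weight (fun _ _ => 0) potential).
Local Notation rlw := (rel_letter_weight (fun _ _ => 0) potential).

Lemma potential_in g : V g -> potential i0 g = (lev g)%:Z.
Proof. by move=> Vg; rewrite /potential asboolT. Qed.

Definition per_letter (a : rel_letter H X) : Prop :=
  match a with inl _ => False | inr (existT i _) => i = i0 end.

Lemma potential_letter_off a g :
  (per_letter a -> V g -> V (gmul g (rval a)) -> lev (gmul g (rval a)) = lev g) ->
  rlw a g = 0.
Proof.
case: a => [//|[i [h hP]]] /= off; rewrite /potential.
have [ii|ii] := pselect (i = i0); last first.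
  by rewrite !asboolF ?subrr // => -[].
have Hh : (H i0 : set G) h by rewrite -ii; have [] := set_mem hP.
have [Vg|nVg] := pselect (V g); last first.
  by rewrite !asboolF ?subrr // => -[_ Vx]; apply: nVg => //; apply/(VH _ Hh).
have Vgh := (VH g Hh).1 Vg.
by rewrite !asboolT // (off ii Vg Vgh) subrr.
Qed.

Lemma potential_word_off w g :
  (forall k a, onth w k = Some a -> per_letter a -> V (gmul g (wval (take k w))) ->
     V (gmul g (wval (take k.+1 w))) ->
     lev (gmul g (wval (take k.+1 w))) = lev (gmul g (wval (take k w)))) ->
  rw w g = 0.
Proof.
elim: w g => [//|a w IH] g off /=.
rewrite potential_letter_off; last first.
  by move=> pa Vg Vga; have := off 0%N a erefl pa; rewrite /= take0 /= !gmul1; apply.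
rewrite add0r; apply: IH => k b kb.
by have := off k.+1 b kb; rewrite /= !gmulA.
Qed.

Lemma potential_letter_inv a : exists b, rval b = ginv (rval a) /\
  forall g, rlw b (gmul g (rval a)) = - rlw a g.
Proof.
case: a => [[x Xx]|[i [h hP]]] /=.
  by exists (inl (exist _ (ginv x) (mem_set (XV (set_mem Xx))))); rewrite oppr0.
have [Hh h1] := set_mem hP.
have hP' : (H i `\` [set 1%g]) (ginv h).
  split; first exact: subgroupV.
  by move=> e; apply: h1; rewrite /= -[h]ginvK e; exact: ginv1.
exists (inr (existT _ i (exist _ (ginv h) (mem_set hP')))); split => // g.
by rewrite /= gmulK opprB.
Qed.

Lemma potential_word_inv w : exists w', [/\ size w' = size w,
  wval w' = ginv (wval w) & forall g, rw w' (gmul g (wval w)) = - rw w g].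
Proof.
elim: w => [|a w [w' [sw' vw' pw']]].
  by exists [::]; split => //=; rewrite ?ginv1 // oppr0.
have [b [vb pb]] := potential_letter_inv a; exists (w' ++ [:: b]); split.
- by rewrite size_cat addn1 /= sw'.
- by rewrite rel_word_val_cat vw' /= vb !gE.
- move=> g; rewrite rel_weight_cat /= gmulA pw' vw' gmulK pb addr0.
  by rewrite opprD addrC.
Qed.
End Potentials.

(** Inverses are listed too, so that distances measured by these elements are symmetric. *)
Fixpoint peripheral_vals (u : seq (fp_letter H X)) : seq G :=
  match u with
  | [::] => [::]
  | FpPer _ h :: u' => [:: val h, ginv (val h) & peripheral_vals u']
  | _ :: u' => peripheral_vals u'
  end.

Lemma exists_peripheral_letters : exists Om : seq G,
  (forall r, Rel r -> {subset peripheral_vals (fp_word r) <= Om}) /\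
  (forall x, x \in Om -> ginv x \in Om).
Proof.
have [s sE] := (finite_seqP Rel).1 finRel.
have invS u x : x \in peripheral_vals u -> ginv x \in peripheral_vals u.
  elim: u => [//|[//|i h] u IH] /=; rewrite !inE.
  move=> /or3P[/eqP->|/eqP->|/IH ->]; rewrite ?ginvK ?eqxx ?orbT //.
exists (flatten [seq peripheral_vals (fp_word r) | r <- s]); split.
  move=> r; rewrite sE => rs x xr; apply/flatten_mapP; exists r => //.
by move=> x /flatten_mapP[r rs xr]; apply/flatten_mapP; exists r => //; exact: invS.
Qed.

Section Neighborhoods.
Variable Om : seq G.
Hypothesis OmV : forall x, x \in Om -> ginv x \in Om.

Definition nbhd (A : seq G) n : seq G :=
  iter n (fun B => B ++ [seq gmul a x | a <- B, x <- Om]) A.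

Lemma nbhd_le A m n : m <= n -> {subset nbhd A m <= nbhd A n}.
Proof.
elim: n => [|n IH]; first by rewrite leqn0 => /eqP ->.
rewrite leq_eqVlt ltnS => /orP[/eqP ->//|/IH mn] x /mn xn.
by rewrite mem_cat xn.
Qed.

Lemma nbhd_step A n g x : g \in nbhd A n -> x \in Om -> gmul g x \in nbhd A n.+1.
Proof.
by move=> gA xO; rewrite mem_cat; apply/orP; right; apply/allpairsP; exists (g, x).
Qed.

(** The distance from [A] to [g] by right multiplications with elements of [Om], truncated at
    [M.+1]. *)
Definition level A M g := \sum_(n < M.+1) (g \notin nbhd A n).

Lemma level_step A M g x : x \in Om -> level A M (gmul g x) <= (level A M g).+1.
Proof.
move=> xO; rewrite /level big_ord_recl [X in _ <= X.+1]big_ord_recr /=.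
have le (b : bool) : (b : nat) <= 1 by case: b.
have h : \sum_(i < M) (gmul g x \notin nbhd A i.+1) <= \sum_(i < M) (g \notin nbhd A i).
  apply: leq_sum => i _; case: (boolP (g \in nbhd A i)) => [gA|_]; last exact: le.
  by rewrite nbhd_step.
by apply: leq_trans (leq_add (le _) h) _; rewrite add1n ltnS leq_addr.
Qed.

Lemma level_dist A M g x : x \in Om ->
  (`|(level A M (gmul g x))%:Z - (level A M g)%:Z| <= 1)%R.
Proof.
move=> xO; have h1 := level_step A M g xO.
have := level_step A M (gmul g x) (OmV xO); rewrite gmulK; lia.
Qed.

Lemma level0 A M g : g \in A -> level A M g = 0.
Proof.
by move=> gA; apply: big1 => n _; rewrite (@nbhd_le A 0 n).
Qed.

Lemma level_max A M g : g \notin nbhd A M -> level A M g = M.+1.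
Proof.
move=> gA; rewrite /level -[RHS](card_ord M.+1) -sum1_card; apply: eq_bigr => n _.
have [/(nbhd_le (leq_ord n)) h|//] := boolP (g \in nbhd A n).
by rewrite h in gA.
Qed.
End Neighborhoods.

(** All peripheral letters of a relator are in [Om], and across such a letter the level changes by
    at most one. *)
Lemma potential_relator Om A M i0 V (u : seq (fp_letter H X)) g :
  (forall x, x \in Om -> ginv x \in Om) -> {subset peripheral_vals u <= Om} ->
  (forall g h, (H i0 : set G) h -> V g <-> V (gmul g h)) ->
  (`|weight (fun _ _ => 0) (potential i0 (level Om A M) V) u g| <= (size u)%:Z)%R.
Proof.
move=> OmV + VH; elim: u g => [|a u IH] g uO; first by rewrite normr0.
rewrite /= -add1n PoszD; apply: le_trans (ler_normD _ _) _; apply: lerD; last first.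
  by apply: IH => x xu; apply: uO; case: (a) => //= *; rewrite !inE xu !orbT.
case: a uO => [x []|i h] //= uO; rewrite ?oppr0 ?normr0 //.
have hO : val h \in Om by apply: uO; rewrite inE eqxx.
have Hh := set_mem (valP h); rewrite /potential.
have [ii|ii] := pselect (i = i0); last first.
  by rewrite !asboolF ?subrr ?normr0 // => -[].
have Hh' : (H i0 : set G) (val h) by rewrite -ii.
have [Vg|nVg] := pselect (V g).
  by rewrite !asboolT //; [exact: level_dist|split => //; exact: (VH g _ Hh').1].
by rewrite !asboolF ?subrr ?normr0 // => -[_ Vx]; apply: nVg => //; apply/(VH _ _ Hh').
Qed.

(** [Om] and [C] do not depend on [A], [M] and [V]. Hence a level jump of more than [C * size w]
    across one letter must be compensated by another letter of the loop inside [V]. *)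
Lemma potential_loop : exists (Om : seq G) (C : nat), forall i0 A M V w g,
  (forall g h, (H i0 : set G) h -> V g <-> V (gmul g h)) -> wval w = gone ->
  (`|rel_weight (fun _ _ => 0) (potential i0 (level Om A M) V) w g|
   <= (C * size w)%:Z)%R.
Proof.
have [M0 MP] := relator_size; have [C CP] := loop_weight relator_ker iso.
have [Om [OmR OmV]] := exists_peripheral_letters.
exists Om, (C * M0) => i0 A M V w g VH w1.
rewrite mulnAC; apply: CP => // r h Rr.
apply: le_trans (potential_relator _ _ _ OmV (OmR r Rr) VH) _.
by rewrite lez_nat MP.
Qed.

Lemma dist_prefix w g i j : i <= j -> j <= size w ->
  d (gmul g (wval (take i w))) (gmul g (wval (take j w))) <= j - i.
Proof.
move=> ij jw; have [_ le] := wl.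
rewrite distMl -[take j w](cat_take_drop i) take_takel // rel_word_val_cat dist_step.
by apply: leq_trans (le _) _; rewrite size_drop size_takel.
Qed.

Lemma dist_prefix_eq w i j : size w = l (wval w) -> i <= j -> j <= size w ->
  d (wval (take i w)) (wval (take j w)) = j - i.
Proof.
move=> sw ij jw; have := dist_prefix (w := w) gone ij jw; rewrite !gmul1l => h.
have := dist_prefix (w := w) gone (leq0n i) (leq_trans ij jw).
have := dist_prefix (w := w) gone jw (leqnn (size w)).
rewrite !gmul1l take0 /= take_size => h1 h2.
have := dist_triangle gl gone (wval (take i w)) (wval w).
have := dist_triangle gl (wval (take i w)) (wval (take j w)) (wval w).
rewrite (dist1 l (wval w)) -sw; lia.
Qed.

Lemma onth_size (T : Type) (s : seq T) k a : onth s k = Some a -> k < size s.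
Proof. by move=> e; rewrite -onthTE e. Qed.

(** The words [c], [w], [c'] and again [w] bound a quadrilateral with corners 1, [w0], [g] and
    [g * w0]. If its side from [g] to [g * w0] missed the finite set [A K.+1], built from [w] alone,
    then each peripheral letter of [c] would be the only one to see a suitable potential, so it
    could not leave the next set [A t.+1]. Following [c] up to [g] puts a corner of that side into
    the set. *)
Lemma word_length_wpd K w0 : 2 * K + 2 <= l w0 ->
  exists s : seq G, forall g : G, l g <= K -> l (ginv w0 * g * w0)%h <= K -> g \in s.
Proof.
move=> Kw0; have [ex le] := wl; have [Om [C CP]] := potential_loop.
have [w sw vw] := ex w0.
have [Xs XE] : exists Xs : seq G, forall x, X x -> x \in Xs.
  have [s sE] := (finite_seqP X).1 finX; exists s => x; by rewrite sE.
(* The number of letters of the quadrilateral is at most [n]. *)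
have [n nE] : exists n, n = 2 * K + 2 * l w0 by eexists.
pose M := C * n.
pose A0 := [seq wval (take k w) | k <- iota 0 (size w).+1].
pose next A := nbhd Om A M ++ [seq gmul a x | a <- A, x <- Xs].
pose A t := iter t next A0.
have A0P k : k <= size w -> wval (take k w) \in A0.
  by move=> kw; apply/mapP; exists k => //; rewrite mem_iota ltnS.
have Anext B : {subset B <= next B}.
  by move=> x xB; rewrite mem_cat (nbhd_le (leq0n M)).
have Ale s t : s <= t -> {subset A s <= A t}.
  elim: t => [|t IH]; first by rewrite leqn0 => /eqP ->.
  by rewrite leq_eqVlt ltnS => /orP[/eqP ->//|/IH st] x /st /Anext.
exists [seq gmul a (ginv (wval (take k w))) | a <- A K.+1, k <- iota 0 (size w).+1].
move=> g gK gwK.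
suff [k kw gk] : exists2 k, k <= size w & gmul g (wval (take k w)) \in A K.+1.
  apply/allpairsP; exists (gmul g (wval (take k w)), k); split => //.
    by rewrite mem_iota [_.2]/= ltnS.
  by rewrite !gE.
apply: contrapT => no.
have {}no k t : k <= size w -> t <= K.+1 -> gmul g (wval (take k w)) \notin A t.
  by move=> kw tK; apply/negP => h; apply: no; exists k => //; exact: Ale h.
have [c sc vc] := ex g; have [c' sc' vc'] := ex (ginv w0 * g * w0)%h.
have cA t : t <= size c -> wval (take t c) \in A t.
  elim: t => [|t IH] tc; first by have := A0P 0 isT; rewrite !take0.
  have {}IH := IH (ltnW tc); rewrite -/(A t).
  have [a [c2 ce]] : exists a c2, drop t c = a :: c2.
    case e: (drop t c) => [|a c2]; last by exists a, c2.
    by move: (congr1 size e) tc; rewrite size_drop /=; lia.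
  pose ct := wval (take t c); have ccat : c = take t c ++ a :: c2 by rewrite -ce cat_take_drop.
  have stc : size (take t c) = t by rewrite size_takel // ltnW.
  have takeS k : take (t + k.+1) c = take t c ++ a :: take k c2.
    by rewrite {1}ccat take_cat stc ltnNge leq_addr /= addKn.
  have ct1 : wval (take t.+1 c) = gmul ct (rval a).
    by rewrite -addn1 takeS take0 rel_word_val_cat /= gmul1.
  rewrite ct1; case: a ce ccat takeS ct1 => [x|[i0 h]] ce ccat takeS ct1.
    rewrite mem_cat; apply/orP; right; apply/allpairsP; exists (ct, val x).
    by split=> //; exact/XE/set_mem/(valP x).
  have Hh : (H i0 : set G) (val h) by have [] := set_mem (valP h).
  apply/negPn/negP => hnot; pose V := [set z | (H i0 : set G) (gmul (ginv ct) z)].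
  have hno : gmul ct (val h) \notin nbhd Om (A t) M.
    by apply/negP => hin; case/negP: hnot; rewrite mem_cat hin.
  have VH g' h' : (H i0 : set G) h' -> V g' <-> V (gmul g' h').
    move=> Hh'; rewrite /V /= gmulA; split=> [Hg|Hg]; first exact: subgroupM.
    by have := subgroupM Hg (subgroupV Hh'); rewrite gmulK.
  have Vd z z' : V z -> V z' -> d z z' <= 1.
    move=> Vz Vz'; apply: (@len_peripheral i0).
    by have := subgroupM (subgroupV Vz) Vz'; rewrite !gE.
  have Vct : V ct by rewrite /V /= gmulVl; exact: subgroup1.
  have Vct1 : V (gmul ct (val h)) by rewrite -VH.
  pose P := potential i0 (level Om (A t) M) V.
  have offP := potential_word_off (lev := level Om (A t) M) VH.
  have [w' [sw' vw' pw']] := potential_word_inv i0 (level Om (A t) M) V w.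
  have [c'' [sc'' vc'' pc'']] := potential_word_inv i0 (level Om (A t) M) V c'.
  have tK : t.+1 <= K by rewrite -sc in gK; exact: leq_trans gK.
  have cdist k m : k <= m -> m <= size c -> d (wval (take k c)) (wval (take m c)) = m - k.
    by move=> km mc; apply: dist_prefix_eq => //; rewrite sc vc.
  (* The vertices of [w] have level 0 and those of its translate by [g] have the maximal level, so
     neither side contributes. *)
  have w1 : rel_weight (fun _ _ => 0%R) P w gone = 0%R.
    apply: offP => k b kb _ _ _; have kw := onth_size kb; rewrite !gmul1l.
    by rewrite !level0 //; apply: (Ale 0) => //; apply: A0P => //; exact: ltnW.
  have wg : rel_weight (fun _ _ => 0%R) P w g = 0%R.
    have far k : k <= size w -> gmul g (wval (take k w)) \notin nbhd Om (A t) M.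
      move=> kw; have := no k t.+1 kw (leqW tK); rewrite /A /= mem_cat negb_or.
      by case/andP.
    by apply: offP => k b kb _ _ _; have kw := onth_size kb; rewrite !level_max // far // ltnW.
  (* [V] lies within [K] of 1, whereas [c'] starts at distance at least [2 * K + 2] from 1 and is
     too short to reach it. *)
  have c'w0 : rel_weight (fun _ _ => 0%R) P c' w0 = 0%R.
    apply: offP => k b kb _ Vk _; exfalso; have kc' := onth_size kb.
    have := Vd _ _ Vct Vk; have := dist_prefix w0 (leq0n k) (ltnW kc').
    have := cdist 0 t (leq0n t) (ltnW tc); rewrite !take0 /= gmul1 dist1 -/ct.
    have := dist_triangle gl gone ct (gmul w0 (wval (take k c'))).
    have := dist_triangle gl gone (gmul w0 (wval (take k c'))) w0.
    rewrite !dist1 (distC gl _ w0); lia.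
  (* [c] is geodesic and [V] has diameter at most one, so no other letter of [c] runs in [V]. *)
  have ct0 : rel_weight (fun _ _ => 0%R) P (take t c) gone = 0%R.
    apply: offP => k b kb _ + _; rewrite gmul1l => Vk; exfalso.
    have kt := onth_size kb; rewrite stc in kt.
    rewrite take_takel in Vk; last exact: ltnW.
    have := Vd _ _ Vk Vct1; rewrite -[gmul ct _]/(gmul ct (rval (inr (existT _ i0 h)))) -ct1.
    by rewrite cdist; lia.
  have c20 : rel_weight (fun _ _ => 0%R) P c2 (gmul ct (val h)) = 0%R.
    apply: offP => k b kb _ _; have kc2 := onth_size kb.
    have e : gmul (gmul ct (val h)) (wval (take k.+1 c2)) = wval (take (t + k.+2) c).
      by rewrite takeS rel_word_val_cat /= gmulA.
    have sc2 : size c = t + (size c2).+1 by rewrite ccat size_cat stc.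
    rewrite e => Ve; exfalso; have := Vd _ _ Vct Ve; rewrite cdist; lia.
  have loop : wval (c ++ w ++ c'' ++ w') = gone.
    by rewrite !rel_word_val_cat vc vw vc'' vw' vc' vw !gE.
  have := CP i0 (A t) M V _ gone VH loop; rewrite -/P !rel_weight_cat {1}ccat rel_weight_cat.
  rewrite ct0 gmul1l -/ct /= c20 gmul1l vc wg vw.
  have -> : gmul g w0 = gmul w0 (wval c') by rewrite vc' !gE.
  have ww' : rel_weight (fun _ _ => 0%R) P w' w0 = 0%R.
    by have := pw' gone; rewrite gmul1l vw -/P w1 oppr0.
  rewrite pc'' c'w0 vc'' gmulK ww'.
  rewrite /P !potential_in // level_max // level0 // !size_cat sw' sc'' sc sc' sw.
  have : C * (l g + (l w0 + (l (w0^-1 * g * w0)%h + l w0))) <= M.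
    by rewrite /M leq_mul2l nE; apply/orP; right; lia.
  lia.
have := cA _ (leqnn (size c)); rewrite take_size vc => /(Ale _ K.+1).
have := no 0 K.+1 (leq0n _) (leqnn _); rewrite take0 /= gmul1 => /negP h1 h2.
by apply/h1/h2; lia.
Qed.

(* The level function, cut off outside the coset, is a potential that no other
   letter of the loop sees. *)
Lemma isolated_letter : exists (Om : seq G) (C : nat), forall i a u v g,
  per_letter i a -> wval (u ++ a :: v) = gone -> gmul g (wval u) = gone ->
  (forall k b, onth u k = Some b -> per_letter i b ->
     ~ (H i : set G) (gmul g (wval (take k u)))) ->
  (forall k b, onth v k = Some b -> per_letter i b ->
     ~ (H i : set G) (gmul (rval a) (wval (take k v)))) ->
  rval a \in nbhd Om [:: gone] (C * (size u + size v).+1).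
Proof.
have [Om [C CP]] := potential_loop; exists Om, C => i a u v g pa loop gu offu offv.
apply/negPn/negP => hno; pose M := C * (size u + size v).+1.
have VH g' h' : (H i : set G) h' -> (H i : set G) g' <-> (H i : set G) (gmul g' h').
  move=> Hh'; split=> [Hg|Hg]; first exact: subgroupM.
  by have := subgroupM Hg (subgroupV Hh'); rewrite gmulK.
have := CP i [:: gone] M _ _ g VH loop; pose P := potential i (level Om [:: gone] M) (H i).
rewrite -/P rel_weight_cat /= gu gmul1l.
have offP := potential_word_off (lev := level Om [:: gone] M) VH.
rewrite -/P in offP; rewrite (offP u g); last first.
  by move=> k b kb pb Hk; case: (offu k b kb pb).
rewrite (offP v); last first.
  by move=> k b kb pb Hk; case: (offv k b kb pb).
have e : (rel_letter_weight (fun _ _ => 0) P a gone = M.+1)%R.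
  case: a pa loop offv hno => [//|[i' [h hP]]] /= ii loop offv hno.
  have Hh : (H i : set G) h by rewrite -ii; have [] := set_mem hP.
  have H1 := subgroup1 (H i).
  rewrite ii /P !potential_in ?gmul1l // level_max // level0 ?inE ?eqxx //.
  by rewrite subr0.
by rewrite e size_cat /= -/M addnS; lia.
Qed.

Fixpoint alternating (a b : rel_letter H X) n :=
  if n is n'.+1 then a :: b :: alternating a b n' else [::].

Lemma alternating_val a b n :
  wval (alternating a b n) = gexp (gmul (rval a) (rval b)) n.
Proof.
elim: n => [|n IH]; first by rewrite gexp0.
by rewrite /= IH gexpS gmulA.
Qed.

Lemma size_alternating a b n : size (alternating a b n) = n.*2.
Proof. by elim: n => //= n ->. Qed.

Definition off_coset i (w : seq (rel_letter H X)) g := forall k c,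
  onth w k = Some c -> per_letter i c -> ~ (H i : set G) (gmul g (wval (take k w))).

Lemma per_letterP i a : per_letter i a -> (H i : set G) (rval a).
Proof. by case: a => [//|[j [h hP]]] /= <-; have [] := set_mem hP. Qed.

Lemma off_coset_cat i u v g : off_coset i u g -> off_coset i v (gmul g (wval u)) ->
  off_coset i (u ++ v) g.
Proof.
move=> ou ov k c; rewrite onth_cat take_cat; case: ltnP => [_|uk kc pc].
  exact: ou.
by rewrite rel_word_val_cat gmulA; exact: ov kc pc.
Qed.

Lemma off_coset_cons i a v g : ~ (H i : set G) (rval a) ->
  off_coset i v (gmul g (rval a)) -> off_coset i (a :: v) g.
Proof.
move=> aH ov [|k] c /=; first by move=> [<-] /per_letterP.
by rewrite gmulA; exact: ov.
Qed.

Lemma alternating_off i a b n g : ~ (H i : set G) (rval b) ->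
  (forall j, j < n ->
    ~ (H i : set G) (gmul g (gexp (gmul (rval a) (rval b)) j))) ->
  off_coset i (alternating a b n) g.
Proof.
rewrite /off_coset => bH; elim: n g => [|n IH] g off k c; first by rewrite onth0n.
case: k => [[<-] _|[|k]] /=.
- by have := off 0 isT; rewrite gexp0.
- by move=> [<-] /per_letterP.
- move=> kc pc; rewrite gmulA gmulA -gmulA; rewrite gmulA -[gmul (gmul g _) _]gmulA.
  apply: (IH (gmul g (gmul (rval a) (rval b))) _ k c kc pc) => j jn.
  by rewrite -gmulA -gexpS; exact: (off j.+1).
Qed.

Hypothesis Hproper : forall i, (H i : set G) <> [set: G].

Lemma exists_letter_notin i : exists b, ~ (H i : set G) (rval b).
Proof.
apply: contrapT => no; apply: (Hproper (i := i)); apply/seteqP; split => // g _.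
have [w <-] := exists_rel_word g; elim: w => [|a w IH]; first exact: subgroup1.
by apply: subgroupM => //; apply: contrapT => na; apply: no; exists a.
Qed.

(* Products of copies of a long peripheral element and of a letter outside its
   peripheral subgroup pass through as many cosets as there are factors. *)
Lemma word_length_unbounded : ~ (exists s : seq G, forall g, g \in s) ->
  forall n, exists g, n <= l g.
Proof.
move=> infG D; apply: contrapT => no.
have {}no g : l g < D by rewrite ltnNge; apply/negP => h; apply: no; exists g.
have [ex le] := wl; have [Om [C CP]] := isolated_letter.
(* Each loop below has at most [2 * D + D] letters besides the isolated one. *)
pose L := C * (2 * D + D).+1.
have [[i [a [pa ha]]]|small] := pselect (exists i a, per_letter i a /\
    rval a \notin nbhd Om [:: gone] L); last first.
  (* Without a long peripheral letter finitely many values of letters remain, and bounded length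
     would make [G] finite. *)
  have [Xs XE] : exists Xs : seq G, forall x, X x -> x \in Xs.
    have [s sE] := (finite_seqP X).1 finX; exists s => x; by rewrite sE.
  pose S := Xs ++ nbhd Om [:: gone] L.
  have SP a : rval a \in S.
    rewrite mem_cat; case: a => [x|[i h]]; first by rewrite XE //; exact: set_mem (valP x).
    apply/orP; right; apply/negPn/negP => hno; apply: small.
    by exists i, (inr (existT _ i h)).
  apply: infG; pose B n := iter n (fun T => [:: gone] ++ [seq gmul x y | x <- S, y <- T]) [:: gone].
  have BP w n : size w <= n -> wval w \in B n.
    elim: n w => [|n IH] [|a w] //= wn; try by rewrite inE eqxx.
    rewrite in_cons; apply/orP; right.
    by apply/allpairsP; exists (rval a, wval w); split=> //; [exact: SP|exact: IH].
  exists (B D) => g; have [w sw <-] := ex g; apply: BP.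
  by rewrite sw; exact: ltnW.
have [b bH] := exists_letter_notin i.
have aH := per_letterP pa; pose p := gmul (rval a) (rval b).
have CL u v g : size u + size v <= 2 * D + D -> wval (u ++ a :: v) = gone ->
  gmul g (wval u) = gone -> off_coset i u g -> off_coset i v (rval a) -> False.
  move=> suv h1 h2 h3 h4; have := CP i a u v g pa h1 h2 h3 h4.
  by move=> /(nbhd_le (n := L)) hin; move/negP: ha; apply; apply: hin; rewrite leq_mul2l; lia.
have pH s : 0 < s <= D -> ~ (H i : set G) (gexp p s).
  elim/ltn_ind: s => -[//|[|s]] IH /andP[_ sD] Hs.
    by apply: bH; have := subgroupM (subgroupV aH) Hs; rewrite gexp1 /p !gE.
  have HV : (H i : set G) (ginv (gexp p s.+2)) by exact: subgroupV.
  have [w [w1 vw]] : exists w, size w <= 1 /\ wval w = ginv (gexp p s.+2).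
    have [e|ne] := pselect (ginv (gexp p s.+2) = gone); first by exists [::].
    by have [c vc] := rel_letter_H HV ne; exists [:: c]; rewrite /= gmul1.
  (* The second [a] is the isolated letter. The first one is not isolated: the closing letter [w]
     runs in the same coset. *)
  apply: (CL (alternating a b 1) (b :: alternating a b s ++ w) (ginv p)).
  - by rewrite /= size_cat size_alternating; lia.
  - rewrite rel_word_val_cat alternating_val /= rel_word_val_cat alternating_val vw.
    rewrite -/p gexp1; have -> : gexp p s.+2 = gmul p (gmul p (gexp p s)) by rewrite !gexpS.
    by rewrite {2 4}/p !gE.
  - by rewrite alternating_val gexp1 gmulVl.
  - apply: alternating_off => // -[|//] _; rewrite gexp0 gmul1 => /subgroupV.
    by rewrite ginvK -[p]gexp1; apply: (IH 1) => //; lia.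
  - apply: off_coset_cons => //; apply: off_coset_cat.
      by apply: alternating_off => // j js; rewrite -/p -gexpS; apply: IH; lia.
    rewrite alternating_val -/p -gexpS => -[|k] c.
      by move=> _ _; rewrite take0 gmul1; apply: IH; lia.
    by move=> kc; exfalso; have := onth_size kc; lia.
have [u su vu] := ex (ginv (gexp p D)).
have suD : size u < D by rewrite su.
(* In the loop closed by the geodesic word [u] the copy of [a] after [j] factors cannot be isolated,
   so [u] has a vertex in its coset. Different copies lie in different cosets by [pH], but [u] has
   fewer than [D] letters. *)
have exk (j : 'I_D) : exists k : 'I_(size u),
    (H i : set G) (gmul (gexp p (D - j)) (wval (take k u))).
  apply: contrapT => nok; have jD := ltn_ord j.
  have split3 : gexp p D = gmul (gmul (gexp p j) p) (gexp p (D - j.+1)).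
    by rewrite -gexpSr -gexpD subnKC.
  apply: (CL (alternating a b j) (b :: alternating a b (D - j.+1) ++ u) (ginv (gexp p j))).
  - by rewrite /= size_cat !size_alternating; lia.
  - rewrite rel_word_val_cat alternating_val /= rel_word_val_cat alternating_val vu.
    by rewrite -/p split3 {2}/p !gE.
  - by rewrite alternating_val gmulVl.
  - apply: alternating_off => // k kj Hk; apply: (pH (j - k)); first by lia.
    have -> : gexp p (j - k) = ginv (gmul (ginv (gexp p j)) (gexp p k)).
      by rewrite -{2}(subnKC (ltnW kj)) gexpD !gE.
    exact: subgroupV.
  - apply: off_coset_cons => //; apply: off_coset_cat.
      by apply: alternating_off => // k kj; rewrite -/p -gexpS; apply: pH; lia.
    rewrite alternating_val -/p -gexpS => k c kc pc Hk; apply: nok.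
    by exists (Ordinal (onth_size kc)) => /=; move: Hk; rewrite -subSn // subSS.
have [f fP] := choice exk.
have finj : injective f.
  have lt_absurd (j j' : 'I_D) : j < j' -> f j = f j' -> False.
    move=> jj' e; have h := fP j; have h' := fP j'; rewrite -e in h'.
    apply: (pH (j' - j)); first by have := ltn_ord j'; lia.
    have -> : gexp p (j' - j) = gmul (gmul (gexp p (D - j)) (wval (take (f j) u)))
       (ginv (gmul (gexp p (D - j')) (wval (take (f j) u)))).
      have -> : D - j = (j' - j) + (D - j') by have := ltn_ord j'; lia.
      by rewrite gexpD !gE.
    exact: subgroupM h (subgroupV h').
  move=> j j' e; case: (ltngtP (j : nat) j') => [lt|lt|/ord_inj //].
    by case: (lt_absurd j j').
  by case: (lt_absurd j' j).
have := leq_card f finj; rewrite !card_ord; lia.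
Qed.

Lemma relhyp_hyperbolic_length : ~ (exists s : seq G, forall g, g \in s) ->
  exists dl, hyperbolic_length l dl.
Proof.
move=> infG; have [K KP] := avoid_quadratic.
exists (6 * (30 * K + 2)); split.
- exact: gl.
- by move=> x y z w; apply: (thin_four_point gl) => o r x' y' n; exact: KP.
- exact: word_length_wpd.
- exact: word_length_unbounded.
Qed.
End RelativelyHyperbolic.
End WordLength.

(* Powers' property for non-elementary relatively hyperbolic groups *)
Transparent gone gmul ginv gexp.

(** The combinatorial condition that Powers used for free groups: the inverses of [F] throw the
    complement of [D] into [D], while [n] translates of [D] are disjoint. *)
Definition powers_property (G : groupType) := forall (F : seq G) n, 1%g \notin F ->
  exists (D : G -> bool) (g : nat -> G),
    (forall f x, f \in F -> ~~ D x -> D (f^-1 * x)%g) /\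
    (forall i j x, i < n -> j < n ->
       D ((g i)^-1 * x)%g -> D ((g j)^-1 * x)%g -> i = j).

Section Bridge.
Variables (R : realType) (G : groupType).
Hypothesis nonel : ~ elementary G.
Implicit Types (g x y w k : G).

Lemma nonelementary_infinite : infinite_set [set: G].
Proof.
move=> fin; apply: nonel; exists 1%g; rewrite /finite_index.
exact: finite_image.
Qed.

Lemma generated_subgroup (S : set G) : subgroup (generated S).
Proof.
split; first by apply: mem_set => K [[K1 _] _]; exact: set_mem.
move=> x y /set_mem Sx /set_mem Sy; apply: mem_set => K KS; apply: set_mem.
by have [[_ KV] _] := KS; apply: KV; apply: mem_set; [exact: Sx|exact: Sy].
Qed.

Lemma zpow_generated k x : zpow k x -> generated [set k] x.
Proof.
pose K := Subgroup (generated_subgroup [set k]).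
have Kk : (K : set G) k by move=> L [_ kL]; exact: kL.
have Kexp i : (K : set G) (gexp k i).
  elim: i => [|i IH]; first by rewrite gexp0; exact: subgroup1.
  by rewrite gexpS; exact: subgroupM.
move=> [m [n ->]]; rewrite -[generated _]/(K : set G).
exact: subgroupM (Kexp m) (subgroupV (Kexp n)).
Qed.

Lemma nonelementary_not_virtually_cyclic : ~ virtually_cyclic G.
Proof.
move=> [k [V kV]]; apply: nonel; exists k.
pose K := Subgroup (generated_subgroup [set k]).
pose coset (x : G) : set G := [set (x * m)%g | m in (K : set G)].
apply: (@sub_finite_set _ _ (coset @` [set` V])); last first.
  by apply: finite_image; apply/finite_seqP; exists V.
move=> _ [g _ <-]; have [v vV /zpow_generated vg] := kV g; exists v => //.
apply/seteqP; split=> _ [m mK <-].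
  exists (gmul (ginv (gmul (ginv v) g)) m); last first.
    by rewrite -/(gmul _ _) -/(gmul g m) !gE.
  exact: (@subgroupM _ K _ _ (@subgroupV _ K _ vg) mK).
exists (gmul (gmul (ginv v) g) m); last by rewrite -/(gmul _ _) -/(gmul v m) !gE.
exact: (@subgroupM _ K _ _ vg mK).
Qed.

Hypothesis relhyp : exists (Lambda : Type) (H : Lambda -> subgroupType G),
    (forall l, (H l : set G) <> [set: G]) /\ relatively_hyperbolic R H.

Lemma relhyp_length : exists l dl, @hyperbolic_length G l dl.
Proof.
have [Lambda [H [Hp [X [Rel [finX XV finR pres iso]]]]]] := relhyp.
have gen : relative_generating H X by case: pres.
have [l wl] := exists_word_length XV gen; exists l.
apply: (relhyp_hyperbolic_length XV gen wl finX finR pres iso Hp).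
move=> [s sP]; apply: nonelementary_infinite; apply/finite_seqP; exists s.
by apply/seteqP; split=> g // _; exact: sP.
Qed.

Lemma icc_no_finite_normal : icc G -> no_nontrivial_finite_normal_subgroup G.
Proof.
move=> [_ Gicc] N [[N1 _] NJ] finN; apply/seteqP; split=> x /=; last first.
  by move=> ->; exact: set_mem.
move=> Nx; apply: contrapT => /eqP x1; apply: (Gicc x x1).
by apply: sub_finite_set finN => _ [g _ <-]; exact: NJ.
Qed.

Hypothesis nofn : no_nontrivial_finite_normal_subgroup G.

Section Length.
Variables (l : G -> nat) (dl : nat).
Hypothesis hl : hyperbolic_length l dl.

Lemma bounded_displacement_trivial x K :
  (forall w, l (gmul (gmul (ginv w) x) w) <= K) -> x = gone.
Proof.
pose N := [set x | exists K, forall w, l (gmul (gmul (ginv w) x) w) <= K].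
have [s sP] := bounded_displacement_finite hl nonelementary_not_virtually_cyclic.
have Nn : normal_subgroup N.
  split; first split.
  - by apply: mem_set; exists 0 => w; rewrite !gE (len1 hl).
  - move=> y z /set_mem[Ky yK] /set_mem[Kz zK]; apply: mem_set.
    exists (Ky + Kz) => w; rewrite -[(y / z)%g]/(gmul y (ginv z)).
    have -> : gmul (gmul (ginv w) (gmul y (ginv z))) w =
      gmul (gmul (gmul (ginv w) y) w) (ginv (gmul (gmul (ginv w) z) w)) by rewrite !gE.
    by apply: leq_trans (lenM hl _ _) _; rewrite (lenV hl) leq_add.
  move=> y g [Ky yK]; exists Ky => w; have := yK (gmul g w).
  by rewrite -[(y ^ g)%g]/(gmul (ginv g) (gmul y g)) !gE.
have finN : finite_set N.
  apply: (@sub_finite_set _ _ [set` s]); last by apply/finite_seqP; exists s.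
  by move=> y yN; exact: sP.
move=> xK; have : N x by exists K.
by rewrite (nofn Nn finN).
Qed.

Lemma displaces x K : x <> gone -> exists w, K < l (gmul (gmul (ginv w) x) w).
Proof.
move=> x1; apply: contrapT => no; apply/x1/(bounded_displacement_trivial (K := K)) => w.
by rewrite leqNgt; apply/negP => h; apply: no; exists w.
Qed.

Lemma length_icc : icc G.
Proof.
split; first exact: nonelementary_infinite.
move=> x /eqP x1 fin; have [s sE] := (finite_seqP _).1 fin.
apply: x1; apply: (bounded_displacement_trivial (K := \max_(y <- s) l y)) => w.
have ys : (x ^ w)%g \in s.
  have : range (fun g => (x ^ g)%g) (x ^ w)%g by exists w.
  by rewrite sE.
have -> : gmul (gmul (ginv w) x) w = (x ^ w)%g by rewrite -gmulA.
exact: (@leq_bigmax_seq _ s xpredT l _ ys isT).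
Qed.

Lemma length_powers : powers_property G.
Proof.
move=> F n F1; apply: (powers_sets hl nonelementary_not_virtually_cyclic _ n).
  by move=> f f1 K; exact: displaces.
by move=> f fF f1; move/negP: F1; apply; rewrite -[1%g]f1.
Qed.
End Length.

Lemma relhyp_powers : icc G /\ powers_property G.
Proof.
by have [l [dl hl]] := relhyp_length; split; [exact: length_icc hl|exact: length_powers hl].
Qed.
End Bridge.

Import numFieldNormedType.Exports.
Import ComplexField.Normc.

(** * The normed space of square-summable functions *)

Section Ell2Theory.
Local Open Scope complex_scope.
Local Open Scope ring_scope.
Variables (R : realType) (G : groupType).
Local Notation E := (ell2 R G).
Local Notation C := R[i].
Implicit Types (f h : E) (x y g : G) (c : C).

Lemma ell2DE f h x : (f + h) x = f x + h x. Proof. by []. Qed.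
Lemma ell2NE f x : (- f) x = - f x. Proof. by []. Qed.
Lemma ell2ZE c f x : (c *: f) x = c * f x. Proof. by []. Qed.
Lemma ell20E x : (0 : E) x = 0. Proof. by []. Qed.

Lemma ell2P f h : (forall x, f x = h x) -> f = h.
Proof. by move=> e; apply: val_inj; apply: funext. Qed.

Definition fsum (f : G -> C) (B : {fset G}) : R := \sum_(x <- B) normc (f x) ^+ 2.

Lemma fsum_le_sqnorm (f : G -> C) B : ((fsum f B)%:E <= sqnorm f)%E.
Proof.
rewrite /sqnorm /fsum -sumEFin.
apply: ereal_sup_ubound; exists [set` B]; first by split.
by rewrite fsbig_finite // set_fsetK.
Qed.

Lemma sqnorm_le_fsum (f : G -> C) (c : \bar R) :
  (forall B, ((fsum f B)%:E <= c)%E) -> (sqnorm f <= c)%E.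
Proof.
move=> fc; apply: ge_ereal_sup => _ [A [finA _] <-].
rewrite fsbig_finite // sumEFin; exact: fc.
Qed.

Lemma fsum_subset (u : G -> C) (B B' : {fset G}) : (B `<=` B')%fset -> fsum u B <= fsum u B'.
Proof.
move=> BB'; rewrite /fsum [leRHS](big_fsetID _ (mem B)) /=.
have -> : [fset x in B' | x \in B]%fset = B.
  apply/fsetP => x; rewrite !inE /=; case xB: (x \in B); last by rewrite andbF.
  by rewrite andbT; exact: (fsubsetP BB').
by rewrite lerDl; apply: sumr_ge0 => x _; rewrite sqr_ge0.
Qed.

Definition sq (f : G -> C) : R := fine (sqnorm f).

Lemma sqE f : sqnorm f = (sq f)%:E.
Proof.
have /square_summableP ff : (f : G -> C) \in square_summable (R := R) (G := G) by case: f.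
by rewrite /sq fineK // ge0_fin_numE // sqnorm_ge0.
Qed.

Lemma fsum_le f B : fsum f B <= sq f.
Proof. by rewrite -lee_fin -sqE fsum_le_sqnorm. Qed.

Lemma sq_le f (c : R) : (forall B, fsum f B <= c) -> sq f <= c.
Proof. by move=> h; rewrite -lee_fin -sqE; apply: sqnorm_le_fsum => B; rewrite lee_fin. Qed.

Lemma sq_approx f (e : R) : 0 < e -> exists B, sq f - e < fsum f B.
Proof.
move=> e0; apply: contrapT => no; have : sq f <= sq f - e; last by lra.
apply: sq_le => B; rewrite leNgt; apply/negP => lt; apply: no; by exists B.
Qed.

Lemma sq_ge0 f : 0 <= sq f.
Proof. by apply: fine_ge0; exact: sqnorm_ge0. Qed.

Definition mk_ell2 (f : G -> C) (c : R) (fc : forall B, fsum f B <= c) : E.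
Proof.
apply: (@Ell2 _ _ f); apply/square_summableP.
by apply: (@le_lt_trans _ _ c%:E); [apply: sqnorm_le_fsum => B; rewrite lee_fin|exact: ltry].
Defined.

Local Notation nrm := (@ell2_norm R G).

Lemma nrmE f : nrm f = Num.sqrt (sq f). Proof. by []. Qed.

Lemma nrm_ge0 f : 0 <= nrm f. Proof. exact: sqrtr_ge0. Qed.

Lemma nrm_sq f : nrm f ^+ 2 = sq f. Proof. by rewrite sqr_sqrtr // sq_ge0. Qed.

Lemma nrm_le f (c : R) : 0 <= c -> (forall B, fsum f B <= c ^+ 2) -> nrm f <= c.
Proof.
move=> c0 fc; rewrite -(@ler_pXn2r _ 2) ?nnegrE ?nrm_ge0 // nrm_sq.
exact: sq_le.
Qed.

Lemma fsum_le_nrm f B : fsum f B <= nrm f ^+ 2.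
Proof. by rewrite nrm_sq; exact: fsum_le. Qed.

(** Young's inequality with a free parameter: the best [t] gives the triangle inequality, and
    letting [t] tend to 0 absorbs error terms in the proof of completeness. *)
Lemma normc_sqD (a b : C) (t : R) : 0 < t ->
  normc (a + b) ^+ 2 <= (1 + t) * normc a ^+ 2 + (1 + t^-1) * normc b ^+ 2.
Proof.
move=> t0; rewrite !normc_sqr; case: a b => [a a'] [b b'] /=.
have key (u v : R) : (u + v) ^+ 2 <= (1 + t) * u ^+ 2 + (1 + t^-1) * v ^+ 2.
  rewrite -subr_ge0; have -> : (1 + t) * u ^+ 2 + (1 + t^-1) * v ^+ 2 - (u + v) ^+ 2 =
    (t * u - v) ^+ 2 / t by field; rewrite gt_eqF.
  by rewrite divr_ge0 ?sqr_ge0 // ltW.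
by have := key a b; have := key a' b'; lra.
Qed.

Lemma fsumD (f h : G -> C) B (t : R) : 0 < t ->
  fsum (f \+ h) B <= (1 + t) * fsum f B + (1 + t^-1) * fsum h B.
Proof.
move=> t0; rewrite /fsum !mulr_sumr -big_split /=.
by apply: ler_sum => x _; exact: normc_sqD.
Qed.

Lemma nrmD f h : nrm (f + h) <= nrm f + nrm h.
Proof.
(* Strict upper bounds [a] and [b] keep [b / a] positive even when a norm is zero. *)
have key (a b : R) : nrm f < a -> nrm h < b -> nrm (f + h) <= a + b.
  move=> fa hb; have a0 := le_lt_trans (nrm_ge0 f) fa.
  have b0 := le_lt_trans (nrm_ge0 h) hb.
  apply: nrm_le => [|B]; first by lra.
  have t0 : 0 < b / a by rewrite divr_gt0.
  apply: le_trans (fsumD f h B t0) _.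
  have -> : (a + b) ^+ 2 = (1 + b / a) * a ^+ 2 + (1 + (b / a)^-1) * b ^+ 2.
    by field; rewrite !gt_eqF.
  apply: lerD; rewrite ler_pM2l ?addr_gt0 ?invr_gt0 //.
    by apply: le_trans (fsum_le_nrm _ _) _; rewrite ler_pXn2r ?nnegrE ?nrm_ge0 // ltW.
  by apply: le_trans (fsum_le_nrm _ _) _; rewrite ler_pXn2r ?nnegrE ?nrm_ge0 // ltW.
apply/ler_addgt0Pl => e e0; have := key (nrm f + e / 2) (nrm h + e / 2).
by move=> /(_ ltac:(lra) ltac:(lra)); lra.
Qed.

Lemma nrmZ c f : nrm (c *: f) = normc c * nrm f.
Proof.
have le c' f' : nrm (c' *: f') <= normc c' * nrm f'.
  have c0 : 0 <= normc c' by case: (c') => a b /=; exact: sqrtr_ge0.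
  apply: nrm_le => [|B]; first by rewrite mulr_ge0 // nrm_ge0.
  rewrite exprMn; apply: (@le_trans _ _ (normc c' ^+ 2 * fsum f' B)).
    by rewrite /fsum mulr_sumr; apply: ler_sum => x _; rewrite ell2ZE normcM exprMn.
  by rewrite ler_wpM2l ?sqr_ge0 // fsum_le_nrm.
apply/eqP; rewrite eq_le le /=; have [->|c0] := eqVneq c 0.
  by rewrite normc0 mul0r nrm_ge0.
have c1 : normc c != 0 by apply: contra_neq c0 => /eq0_normc.
have := le c^-1 (c *: f); rewrite scalerA mulVf // scale1r normcV.
by rewrite -[nrm f <= _](@ler_pM2l _ (normc c)) ?mulrA ?mulfV ?mul1r // lt0r c1;
  case: (c) => a b /=; exact: sqrtr_ge0.
Qed.

Lemma nrm0 : nrm 0 = 0.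
Proof. by rewrite -(scale0r (0 : E)) nrmZ normc0 mul0r. Qed.

Lemma nrmN f : nrm (- f) = nrm f.
Proof. by rewrite -scaleN1r nrmZ normcN normc1 mul1r. Qed.

Lemma nrmB f h : nrm (f - h) = nrm (h - f).
Proof. by rewrite -nrmN opprB. Qed.

Lemma normc_le_nrm f x : normc (f x) <= nrm f.
Proof.
have n0 : 0 <= normc (f x) by case: (f x) => a b /=; exact: sqrtr_ge0.
rewrite -(@ler_pXn2r _ 2) ?nnegrE ?nrm_ge0 //.
by apply: le_trans (fsum_le_nrm f [fset x]%fset); rewrite /fsum big_seq_fset1.
Qed.

Lemma nrm_eq0 f : nrm f = 0 -> f = 0.
Proof.
move=> f0; apply: ell2P => x; apply/eq0_normc/eqP.
have n0 : 0 <= normc (f x) by case: (f x) => a b /=; exact: sqrtr_ge0.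
by rewrite eq_le n0 andbT -f0 normc_le_nrm.
Qed.

Lemma nrm_sum (I : Type) (s : seq I) (F : I -> E) :
  nrm (\sum_(i <- s) F i) <= \sum_(i <- s) nrm (F i).
Proof.
elim: s => [|i s IH]; first by rewrite !big_nil nrm0.
by rewrite !big_cons; apply: le_trans (nrmD _ _) _; rewrite lerD2l.
Qed.

Lemma sq_le_nrm f h : (forall B, fsum f B <= sq h) -> nrm f <= nrm h.
Proof. by move=> fh; apply: nrm_le; rewrite ?nrm_ge0 // nrm_sq. Qed.

Lemma fsum_translate g (f : G -> C) B :
  fsum (translate g f) B = fsum f [fset (g^-1 * x)%g | x in B]%fset.
Proof.
rewrite /fsum big_imfset //= => x y _ _; exact: mulgI.
Qed.

Lemma nrm_left_regular g f : nrm (left_regular g f) = nrm f.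
Proof.
have le g' f' : nrm (left_regular g' f') <= nrm f'.
  by apply: sq_le_nrm => B; rewrite /= fsum_translate; exact: fsum_le.
apply/eqP; rewrite eq_le le /=; have e : left_regular g^-1%g (left_regular g f) = f.
  by apply: ell2P => x; rewrite /= /translate invgK mulKg.
by rewrite -{1}e; exact: le.
Qed.

Lemma left_regularM g x f : left_regular g (left_regular x f) = left_regular (g * x)%g f.
Proof. by apply: ell2P => y; rewrite /= /translate invgM mulgA. Qed.

Lemma left_regular1 f : left_regular 1%g f = f.
Proof. by apply: ell2P => y; rewrite /= /translate invg1 mul1g. Qed.

Lemma left_regular_linear g : linear (@left_regular R G g).
Proof. by move=> c f h; apply: ell2P. Qed.
End Ell2Theory.

(** * Limits of geometrically convergent sequences and completeness *)

Section GeometricLimits.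
Local Open Scope complex_scope.
Local Open Scope ring_scope.
Variable R : realType.

Lemma pow2_inv_small (K e : R) : 0 <= K -> 0 < e -> exists m, K / 2 ^+ m < e.
Proof.
move=> K0 e0; have [m mP] : exists m : nat, K / e < m%:R.
  exists (Num.bound (K / e)); by apply: archi_boundP; rewrite divr_ge0 // ltW.
exists m; rewrite ltr_pdivrMr ?exprn_gt0 // mulrC -ltr_pdivrMr //.
apply: lt_trans mP _; rewrite -natrX ltr_nat; exact: ltn_expl.
Qed.

Lemma ler_add_pow2 (x y K : R) : 0 <= K -> (forall m, x <= y + K / 2 ^+ m) -> x <= y.
Proof.
move=> K0 h; apply/ler_addgt0Pl => e e0; have [m me] := pow2_inv_small K0 e0.
by have := h m; rewrite addrC; lra.
Qed.

Lemma pow2_inv_ge0 (M : R) n : 0 <= M -> 0 <= M / 2 ^+ n.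
Proof. by move=> M0; rewrite divr_ge0 // exprn_ge0. Qed.

Lemma pow2_invS (M : R) n : M / 2 ^+ n = 2 * (M / 2 ^+ n.+1).
Proof. by rewrite exprS invfM; field; rewrite expf_neq0. Qed.

Lemma geometric_steps (T : Type) (dist : T -> T -> R) (u : nat -> T) (M : R) :
  (forall x, dist x x = 0) -> (forall x y z, dist x z <= dist x y + dist y z) ->
  (forall n, dist (u n.+1) (u n) <= M / 2 ^+ n) ->
  forall n m, (n <= m)%N -> dist (u m) (u n) <= 2 * (M / 2 ^+ n) - 2 * (M / 2 ^+ m).
Proof.
move=> d0 dT du n; elim=> [|m IH]; first by rewrite leqn0 => /eqP ->; rewrite d0; lra.
rewrite leq_eqVlt => /orP[/eqP <-|nm]; first by rewrite d0; lra.
have := IH nm; have := dT (u m.+1) (u m) (u n); have := du m.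
have := pow2_invS M m; lra.
Qed.

(** The limit is the supremum of the lower ends [u n - 2 * (M / 2 ^+ n)], all of which lie below
    every upper end. *)
Lemma geometric_limit (u : nat -> R) (M : R) : 0 <= M ->
  (forall n, `|u n.+1 - u n| <= M / 2 ^+ n) ->
  exists x, forall n, `|x - u n| <= 2 * (M / 2 ^+ n).
Proof.
move=> M0 du.
have st := @geometric_steps R (fun x y => `|x - y|) u M _ _ du.
have {}st n m : (n <= m)%N -> `|u m - u n| <= 2 * (M / 2 ^+ n) - 2 * (M / 2 ^+ m).
  apply: st => [x|x y z]; first by rewrite subrr normr0.
  by have := ler_normD (x - y) (y - z); rewrite addrA subrK.
have p0 n := pow2_inv_ge0 n M0.
pose S := range (fun n => u n - 2 * (M / 2 ^+ n)).
have ub n k : u n - 2 * (M / 2 ^+ n) <= u k + 2 * (M / 2 ^+ k).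
  have := p0 n; have := p0 k.
  have [nk|/ltnW nk] := leqP n k; have := st _ _ nk; rewrite ler_norml => /andP[]; lra.
exists (sup S) => n; rewrite ler_norml; apply/andP; split.
  have : u n - 2 * (M / 2 ^+ n) <= sup S; last by lra.
  apply: ub_le_sup; last by exists n.
  by exists (u 0%N + 2 * (M / 2 ^+ 0)) => _ [k _ <-]; exact: ub.
have : sup S <= u n + 2 * (M / 2 ^+ n); last by lra.
apply: ge_sup; first by exists (u 0%N - 2 * (M / 2 ^+ 0)), 0%N.
by move=> _ [k _ <-]; exact: ub.
Qed.
End GeometricLimits.

Section Completeness.
Local Open Scope complex_scope.
Local Open Scope ring_scope.
Variables (R : realType) (G : groupType).
Local Notation E := (ell2 R G).
Local Notation C := R[i].
Local Notation nrm := (@ell2_norm R G).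
Implicit Types (f h : E) (x y g : G) (c : C).

Lemma normc_ge0 (z : C) : 0 <= normc z.
Proof. by case: z => a b /=; exact: sqrtr_ge0. Qed.

Lemma normc_Re (z : C) : `|complex.Re z| <= normc z.
Proof.
rewrite -(@ler_pXn2r _ 2) ?nnegrE ?normr_ge0 ?normc_ge0 // normc_sqr real_normK ?num_real //.
by rewrite lerDl sqr_ge0.
Qed.

Lemma normc_Im (z : C) : `|complex.Im z| <= normc z.
Proof.
rewrite -(@ler_pXn2r _ 2) ?nnegrE ?normr_ge0 ?normc_ge0 // normc_sqr real_normK ?num_real //.
by rewrite lerDr sqr_ge0.
Qed.

Lemma normc_le_ReIm (z : C) : normc z <= `|complex.Re z| + `|complex.Im z|.
Proof.
rewrite -(@ler_pXn2r _ 2) ?nnegrE ?addr_ge0 ?normr_ge0 ?normc_ge0 // normc_sqr.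
rewrite -(real_normK (num_real (complex.Re z))) -(real_normK (num_real (complex.Im z))).
set a := `|_|; set b := `|_|.
have -> : (a + b) ^+ 2 = a ^+ 2 + b ^+ 2 + 2 * (a * b) by ring.
by rewrite lerDl mulr_ge0 // mulr_ge0 // normr_ge0.
Qed.

(** Take pointwise limits. On a finite set the limit is compared with a late term [f_ k], whose
    distance from [f_ n] is known in norm, while the pointwise errors on that set tend to 0. *)
Lemma ell2_complete (f_ : nat -> E) (M : R) : 0 <= M ->
  (forall n, nrm (f_ n.+1 - f_ n) <= M / 2 ^+ n) ->
  exists f, forall n, nrm (f - f_ n) <= 2 * (M / 2 ^+ n).
Proof.
move=> M0 df.
have st := @geometric_steps R E (fun f h => nrm (f - h)) f_ M _ _ df.
have {}st n m : (n <= m)%N -> nrm (f_ m - f_ n) <= 2 * (M / 2 ^+ n) - 2 * (M / 2 ^+ m).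
  apply: st => [f|f h k]; first by rewrite subrr nrm0.
  by have := nrmD (f - h) (h - k); rewrite addrA subrK.
have p0 n := pow2_inv_ge0 n M0.
have lim x : exists z : C, forall n, normc (z - f_ n x) <= 4 * (M / 2 ^+ n).
  have dx n : normc (f_ n.+1 x - f_ n x) <= M / 2 ^+ n.
    by apply: le_trans (df n); exact: (normc_le_nrm (f_ n.+1 - f_ n)).
  have [|a aP] := @geometric_limit R (fun n => complex.Re (f_ n x)) M M0.
    by move=> n; apply: le_trans (dx n); rewrite -raddfB; exact: normc_Re.
  have [|b bP] := @geometric_limit R (fun n => complex.Im (f_ n x)) M M0.
    by move=> n; apply: le_trans (dx n); rewrite -raddfB; exact: normc_Im.
  exists (a +i* b) => n; apply: le_trans (normc_le_ReIm _) _.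
  have := aP n; have := bP n; case: (f_ n x) => c d /=; lra.
have [F FP] := choice lim.
have bnd n B : fsum (fun x => F x - f_ n x) B <= (2 * (M / 2 ^+ n)) ^+ 2.
  set c := 2 * (M / 2 ^+ n); have c0 : 0 <= c by rewrite /c mulr_ge0.
  have step t : 0 < t -> fsum (fun x => F x - f_ n x) B <= (1 + t) * c ^+ 2.
    move=> t0; apply: (@ler_add_pow2 _ _ _ ((1 + t^-1) * ((#|` B|)%:R * (16 * M ^+ 2)))).
      apply: mulr_ge0; first by rewrite addr_ge0 // invr_ge0 ltW.
      by apply: mulr_ge0 => //; apply: mulr_ge0 => //; exact: sqr_ge0.
    move=> m; pose k := maxn n m.
    have -> : (fun x => F x - f_ n x) = (fun x => f_ k x - f_ n x) \+ (fun x => F x - f_ k x).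
      by apply: funext => x /=; rewrite [RHS]addrC addrA subrK.
    apply: le_trans (fsumD _ _ _ t0) _; apply: lerD.
      rewrite ler_pM2l; last by rewrite addr_gt0.
      apply: le_trans (fsum_le_nrm (f_ k - f_ n) _) _.
      rewrite ler_pXn2r ?nnegrE ?nrm_ge0 //.
      by have := st n k (leq_maxl _ _); have := p0 k; rewrite /c; lra.
    rewrite -!mulrA ler_pM2l ?addr_gt0 ?invr_gt0 //.
    apply: (@le_trans _ _ (\sum_(x <- B) (16 * (M ^+ 2 / 2 ^+ m)))).
      apply: ler_sum => x _; apply: (@le_trans _ _ ((4 * (M / 2 ^+ k)) ^+ 2)).
        by rewrite ler_pXn2r ?nnegrE ?normc_ge0 ?mulr_ge0.
      rewrite exprMn; have -> : (4 : R) ^+ 2 = 16 by ring.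
      rewrite ler_pM2l // exprMn exprVn ler_wpM2l ?sqr_ge0 // lef_pV2 ?posrE ?exprn_gt0 //.
      rewrite -exprM; apply: ler_weXn2l; first by lra.
      by rewrite /k; lia.
    rewrite big_const_seq iter_addr addr0 count_predT -mulr_natl.
    by rewrite -[size _]/(#|` B|); lra.
  have [c00|c00] := eqVneq c 0.
    by have := step 1 ltr01; rewrite c00 !expr0n /= mulr0.
  apply/ler_addgt0Pl => e e0; have c20 : 0 < c ^+ 2 by rewrite exprn_even_gt0.
  have := step (e / c ^+ 2) (divr_gt0 e0 c20).
  by rewrite mulrDl mul1r divfK ?gt_eqF // addrC.
have FB B : fsum F B <= 2 * (2 * (M / 2 ^+ 0)) ^+ 2 + 2 * sq (f_ 0%N).
  have FE : F = (fun x => F x - f_ 0%N x) \+ f_ 0%N.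
    by apply: funext => x /=; rewrite subrK.
  rewrite {1}FE; apply: le_trans (fsumD _ _ _ ltr01) _.
  by have := bnd 0%N B; have := fsum_le (f_ 0%N) B; rewrite invr1; lra.
exists (mk_ell2 FB) => n; apply: nrm_le; first by rewrite mulr_ge0.
by move=> B; exact: bnd.
Qed.
End Completeness.

(** * Unconditional sums and the inner product *)

Section InnerProduct.
Local Open Scope complex_scope.
Local Open Scope ring_scope.
Variables (R : realType) (G : groupType).
Local Notation E := (ell2 R G).
Local Notation C := R[i].
Local Notation nrm := (@ell2_norm R G).
Implicit Types (f h k : E) (x y g : G) (c z : C).

Definition has_sum (u : G -> C) z := forall e : R, 0 < e ->
  exists A : {fset G}, forall B : {fset G}, (A `<=` B)%fset ->
    normc (\sum_(x <- B) u x - z) < e.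

Lemma has_sum_unique u z z' : has_sum u z -> has_sum u z' -> z = z'.
Proof.
move=> hz hz'; apply/eqP; rewrite -subr_eq0; apply/eqP/eq0_normc/eqP.
rewrite eq_le normc_ge0 andbT; apply/ler_addgt0Pl => e e0; rewrite addr0.
have e20 : 0 < e / 2 by lra.
have [A AP] := hz _ e20; have [A' AP'] := hz' _ e20.
have := AP _ (fsubsetUl A A'); have := AP' _ (fsubsetUr A A').
set s := \sum_(x <- _) u x => h' h.
have -> : z - z' = (s - z') + - (s - z) by ring.
by have := le_normcD (s - z') (- (s - z)); rewrite normcN; lra.
Qed.

Lemma has_sum_sum u z : has_sum u z -> summability.sum (fun x => u x : C^o) = z.
Proof.
move=> uz; have PF : ProperFilter (@totally G) := totally_filter.
apply: cvg_lim; first exact: norm_hausdorff.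
apply/(@cvgrPdist_lt _ (C^o : normedModType C)) => e e0.
have [eIm eRe] : complex.Im e = 0 /\ 0 < complex.Re e.
  by move: e0; rewrite ltcE /= => /andP[/eqP].
have [A AP] := uz _ eRe; exists A => //= B AB.
rewrite /partial_sum -(big_seq_fsetE _ B xpredT u) /= distrC.
have -> : e = (complex.Re e)%:C by case: (e) eIm => a b /= ->.
by rewrite normc_def -normc_sqr sqrtr_sqr ger0_norm ?normc_ge0 // ltcR; exact: AP.
Qed.

Lemma has_sumD u v z z' : has_sum u z -> has_sum v z' ->
  has_sum (fun x => u x + v x) (z + z').
Proof.
move=> hu hv e e0; have e20 : 0 < e / 2 by lra.
have [A AP] := hu _ e20; have [A' AP'] := hv _ e20.
exists (A `|` A')%fset => B; rewrite fsubUset => /andP[/AP h1 /AP' h2].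
rewrite big_split /=; set s := \sum_(x <- _) u x in h1 *; set t := \sum_(x <- _) v x in h2 *.
have -> : s + t - (z + z') = (s - z) + (t - z') by ring.
by have := le_normcD (s - z) (t - z'); lra.
Qed.

Lemma has_sumZ c u z : has_sum u z -> has_sum (fun x => c * u x) (c * z).
Proof.
move=> hu e e0; have c1 : 0 < normc c + 1 by have := normc_ge0 c; lra.
have [A AP] := hu _ (divr_gt0 e0 c1); exists A => B /AP h.
rewrite -mulr_sumr -mulrBr normcM; move: h; rewrite ltr_pdivlMr //.
by have := normc_ge0 (\sum_(x <- B) u x - z); lra.
Qed.

Lemma has_sum_conj u z : has_sum u z -> has_sum (fun x => (u x)^*%C) z^*%C.
Proof.
move=> hu e e0; have [A AP] := hu _ e0; exists A => B /AP.
rewrite -raddf_sum -raddfB; set w := _ - z.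
by have -> : normc w^*%C = normc w by case: w => a b /=; rewrite sqrrN.
Qed.

Lemma has_sum_sq f : has_sum (fun x => (normc (f x) ^+ 2)%:C) (sq f)%:C.
Proof.
move=> e e0; have [A AP] := sq_approx f e0; exists A => B AB.
rewrite -raddf_sum -raddfB /=; rewrite expr0n addr0 sqrtr_sqr.
have h1 := fsum_le f B.
have h2 : fsum f A <= fsum f B := fsum_subset f AB.
by rewrite ltr_norml -/(fsum f B); apply/andP; split; lra.
Qed.

(** Polarisation reduces the convergence of inner products to that of four square norms. *)
Lemma mulc_conj_polar (a b : C) : a * b^*%C =
  4^-1 * (normc (a + b) ^+ 2)%:C + (- 4^-1 * (normc (a - b) ^+ 2)%:C +
  ('i * 4^-1 * (normc (a + 'i * b) ^+ 2)%:C + - ('i * 4^-1) * (normc (a - 'i * b) ^+ 2)%:C)).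
Proof.
rewrite !normc_sqr; case: a b => [a a'] [b b'] /=.
have -> : (4^-1 : C) = (4^-1 : R)%:C by rewrite fmorphV rmorph_nat.
by apply/eqP; rewrite eq_complex /=; apply/andP; split; apply/eqP; field.
Qed.

Lemma ell2_dotP f h : has_sum (fun x => f x * (h x)^*%C) (ell2_dot f h).
Proof.
have H : exists z, has_sum (fun x => f x * (h x)^*%C) z.
  exists (4^-1 * (sq (f + h))%:C + (- 4^-1 * (sq (f - h))%:C +
  ('i * 4^-1 * (sq (f + 'i *: h))%:C + - ('i * 4^-1) * (sq (f - 'i *: h))%:C))).
  under eq_fun do rewrite mulc_conj_polar.
  apply: has_sumD; last apply: has_sumD; last apply: has_sumD; apply: has_sumZ.
  - exact: (has_sum_sq (f + h)).
  - exact: (has_sum_sq (f - h)).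
  - exact: (has_sum_sq (f + 'i *: h)).
  - exact: (has_sum_sq (f - 'i *: h)).
by have [z hz] := H; rewrite /ell2_dot (has_sum_sum hz).
Qed.

Lemma dot_eq f h z : has_sum (fun x => f x * (h x)^*%C) z -> ell2_dot f h = z.
Proof. exact: has_sum_unique (ell2_dotP f h). Qed.

Lemma dotDl f f' h : ell2_dot (f + f') h = ell2_dot f h + ell2_dot f' h.
Proof.
apply: dot_eq; have := has_sumD (ell2_dotP f h) (ell2_dotP f' h).
by under eq_fun do rewrite -mulrDl.
Qed.

Lemma dotZl c f h : ell2_dot (c *: f) h = c * ell2_dot f h.
Proof.
apply: dot_eq; have := has_sumZ c (ell2_dotP f h).
by under eq_fun do rewrite mulrA.
Qed.

Lemma dotC f h : ell2_dot h f = (ell2_dot f h)^*%C.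
Proof.
apply: dot_eq; have := has_sum_conj (ell2_dotP f h).
have e (a b : C) : (a * b^*)^*%C = b * a^*%C by rewrite rmorphM /= conjcK mulrC.
by under eq_fun do rewrite e.
Qed.

Lemma dotDr f h h' : ell2_dot f (h + h') = ell2_dot f h + ell2_dot f h'.
Proof. by rewrite dotC dotDl rmorphD /= -!dotC. Qed.

Lemma dotZr c f h : ell2_dot f (c *: h) = c^*%C * ell2_dot f h.
Proof. by rewrite dotC dotZl rmorphM /= -!dotC. Qed.

Lemma dotNl f h : ell2_dot (- f) h = - ell2_dot f h.
Proof. by rewrite -scaleN1r dotZl mulN1r. Qed.

Lemma dotNr f h : ell2_dot f (- h) = - ell2_dot f h.
Proof. by rewrite dotC dotNl rmorphN /= -dotC. Qed.

Lemma dot0l h : ell2_dot 0 h = 0.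
Proof. by rewrite -(scale0r (0 : E)) dotZl mul0r. Qed.

Lemma dot0r h : ell2_dot h 0 = 0.
Proof. by rewrite dotC dot0l rmorph0. Qed.

Lemma dotff f : ell2_dot f f = (sq f)%:C.
Proof.
apply: dot_eq; have := has_sum_sq f; under eq_fun => x.
  have -> : (normc (f x) ^+ 2)%:C = f x * (f x)^*%C.
    rewrite normc_sqr; case: (f x) => a b.
    by apply/eqP; rewrite eq_complex /=; apply/andP; split; apply/eqP; ring.
  over.
by [].
Qed.

Lemma cauchy_schwarz f h : normc (ell2_dot f h) <= nrm f * nrm h.
Proof.
have [f0|f0] := eqVneq (nrm f) 0; first by rewrite (nrm_eq0 f0) dot0l normc0 nrm0 mul0r.
have [h0|h0] := eqVneq (nrm h) 0; first by rewrite (nrm_eq0 h0) dot0r normc0 nrm0 mulr0.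
have fp : 0 < nrm f by rewrite lt0r f0 nrm_ge0.
have hp : 0 < nrm h by rewrite lt0r h0 nrm_ge0.
apply/ler_addgt0Pl => e e0; have [A /(_ _ (fsubset_refl A)) hA] := ell2_dotP f h e0.
(* The weight for which the arithmetic-geometric inequality below adds up to exactly
   [nrm f * nrm h]. *)
pose t := nrm h / nrm f; have t0 : 0 < t by rewrite divr_gt0.
have : normc (\sum_(x <- A) f x * (h x)^*%C) <= nrm f * nrm h.
  apply: (@le_trans _ _ (\sum_(x <- A) normc (f x) * normc (h x))).
    elim: (A : seq G) => [|x s IH]; first by rewrite !big_nil normc0.
    rewrite !big_cons; apply: le_trans (le_normcD _ _) _; apply: lerD => //.
    by rewrite normcM; case: (h x) => a b /=; rewrite sqrrN.
  apply: (@le_trans _ _ (2^-1 * (t * fsum f A + t^-1 * fsum h A))).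
    rewrite /fsum !mulr_sumr -big_split /= mulr_sumr; apply: ler_sum => x _.
    set a := normc (f x); set b := normc (h x).
    rewrite -subr_ge0; have -> : 2^-1 * (t * a ^+ 2 + t^-1 * b ^+ 2) - a * b =
      (t * a - b) ^+ 2 / (2 * t) by field; rewrite gt_eqF.
    by rewrite divr_ge0 ?sqr_ge0 // mulr_ge0 // ltW.
  apply: (@le_trans _ _ (2^-1 * (t * nrm f ^+ 2 + t^-1 * nrm h ^+ 2))).
    rewrite ler_pM2l //; apply: lerD; rewrite ler_pM2l ?invr_gt0 //; exact: fsum_le_nrm.
  by rewrite le_eqVlt; apply/orP; left; apply/eqP; rewrite /t; field; rewrite f0 h0.
set s := \sum_(x <- A) _ in hA *; move=> hs.
have -> : ell2_dot f h = s + - (s - ell2_dot f h) by ring.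
by have := le_normcD s (- (s - ell2_dot f h)); rewrite normcN; lra.
Qed.

Lemma dot_left_regular g f h :
  ell2_dot (left_regular g f) h = ell2_dot f (left_regular g^-1%g h).
Proof.
apply: dot_eq => e e0; have [A AP] := ell2_dotP f (left_regular g^-1%g h) e0.
exists [fset (g * x)%g | x in A]%fset => B AB.
have := AP [fset (g^-1 * x)%g | x in B]%fset.
rewrite big_imfset /=; last by move=> x y _ _; exact: mulgI.
under eq_bigr do rewrite /translate invgK mulVKg.
apply; apply/fsubsetP => x xA; apply/imfsetP; exists (g * x)%g => /=.
  by apply: (fsubsetP AB); apply/imfsetP; exists x.
by rewrite mulKg.
Qed.

Lemma delta_fsum g B : fsum (fun x => (x == g)%:R : C) B <= 1.
Proof.
rewrite /fsum; have [gB|gB] := boolP (g \in B).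
  rewrite (big_fsetD1 g) //= eqxx normc1 expr1n big_seq big1 ?addr0 //.
  by move=> x; rewrite !inE => /andP[/negPf -> _]; rewrite normc0 expr0n.
rewrite big_seq big1 // => x xB; have -> : x == g = false.
  by apply/eqP => e; rewrite -e xB in gB.
by rewrite normc0 expr0n.
Qed.

Definition delta g : E := mk_ell2 (delta_fsum g).

Lemma deltaE g x : delta g x = (x == g)%:R. Proof. by []. Qed.

Lemma dot_delta f g : ell2_dot f (delta g) = f g.
Proof.
apply: dot_eq => e e0; exists [fset g]%fset => B; rewrite fsub1set => gB.
rewrite (big_fsetD1 g) //= eqxx rmorph1 mulr1 big_seq big1 ?addr0 ?subrr ?normc0 //.
by move=> x; rewrite !inE => /andP[/negPf -> _]; rewrite rmorph0 mulr0.
Qed.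

Lemma nrm_delta g : nrm (delta g) = 1.
Proof.
have : sq (delta g) = 1.
  by apply: complexI; rewrite -dotff dot_delta deltaE eqxx.
by rewrite nrmE => ->; rewrite sqrtr1.
Qed.

Lemma left_regular_delta g x : left_regular g (delta x) = delta (g * x)%g.
Proof.
apply: ell2P => y; rewrite /= /translate; congr (nat_of_bool _)%:R.
by rewrite -(inj_eq (@mulgI _ g)) mulVKg.
Qed.

Lemma finite_support_dense f (e : R) : 0 < e ->
  exists A : {fset G}, nrm (f - \sum_(x <- A) f x *: delta x) < e.
Proof.
move=> e0; have e20 : 0 < (e / 2) ^+ 2 by rewrite exprn_gt0 //; lra.
have [A AP] := sq_approx f e20; exists A.
apply: (@le_lt_trans _ _ (e / 2)); last by lra.
apply: nrm_le => [|B]; first by lra.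
have vE x : (f - \sum_(y <- A) f y *: delta y) x = if x \in A then 0 else f x.
  have -> : (f - \sum_(y <- A) f y *: delta y) x = f x - (\sum_(y <- A) f y *: delta y) x by [].
  have -> : (\sum_(y <- A) f y *: delta y) x = \sum_(y <- A) f y * (x == y)%:R.
    by elim: (A : seq G) => [|y s IH]; rewrite ?big_nil // !big_cons -IH.
  have [xA|xA] := boolP (x \in A).
    rewrite (big_fsetD1 x) //= eqxx mulr1 big_seq big1 ?addr0 ?subrr //.
    by move=> y; rewrite !inE eq_sym => /andP[/negPf -> _]; rewrite mulr0.
  rewrite big_seq big1 ?subr0 // => y yA; have -> : x == y = false.
    by apply/eqP => xy; rewrite xy yA in xA.
  by rewrite mulr0.
have -> : fsum (f - \sum_(y <- A) f y *: delta y) B = fsum f (B `\` A)%fset.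
  have -> : (f - \sum_(y <- A) f y *: delta y : G -> C) =
    (fun x => if x \in A then 0 else f x) by apply: funext => x; rewrite vE.
  rewrite /fsum (big_fsetID _ (mem A)) /= big_seq big1 ?add0r; last first.
    by move=> x; rewrite !inE /= => /andP[_ ->]; rewrite normc0 expr0n.
  have -> : [fset x in B | x \notin A]%fset = (B `\` A)%fset.
    by apply/fsetP => x; rewrite !inE andbC.
  by rewrite big_seq [RHS]big_seq; apply: eq_bigr => x; rewrite !inE => /andP[/negPf ->].
have : fsum f A + fsum f (B `\` A)%fset <= sq f; last by lra.
apply: le_trans (fsum_le f (A `|` B)%fset); rewrite /fsum [leRHS](big_fsetID _ (mem A)) /=.
have -> : [fset x in (A `|` B)%fset | x \in A]%fset = A.
  by apply/fsetP => x; rewrite !inE andb_orl; case: (x \in A) => //=; rewrite andbF.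
have -> : [fset x in (A `|` B)%fset | x \notin A]%fset = (B `\` A)%fset.
  by apply/fsetP => x; rewrite !inE; case: (x \in A) => //=; rewrite andbT.
by [].
Qed.
End InnerProduct.

(** * The reduced algebra as norm limits of finite convolutions *)

Section OperatorAlgebra.
Local Open Scope complex_scope.
Local Open Scope ring_scope.
Variables (R : realType) (G : groupType).
Local Notation E := (ell2 R G).
Local Notation C := R[i].
Local Notation nrm := (@ell2_norm R G).
Implicit Types (f h k : E) (x y g : G) (c z : C) (a b : E -> E) (s t : seq (C * G)).

Definition opb a (M : R) := forall f, nrm (a f) <= M * nrm f.

(** Convolution by a finitely supported function, given as a list in which a group element may be
    repeated. *)
Definition gconv s : E -> E := fun f => \sum_(p <- s) p.1 *: left_regular p.2 f.

Lemma left_regular_spanE a : left_regular_span a <-> exists s, a = gconv s.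
Proof.
by split=> -[s ->]; exists s; rewrite fct_sumE; apply: funext.
Qed.

Section Linear.
Local Open Scope complex_scope.
Local Open Scope ring_scope.
Variable a : E -> E.
Hypothesis al : linear a.

Lemma opD f h : a (f + h) = a f + a h.
Proof. by have := al 1 f h; rewrite !scale1r. Qed.

Lemma op0 : a 0 = 0.
Proof. by have := opD 0 0; rewrite addr0 => /eqP; rewrite -subr_eq0 opprD addNKr oppr_eq0 => /eqP. Qed.

Lemma opZ c f : a (c *: f) = c *: a f.
Proof. by have := al c f 0; rewrite op0 !addr0. Qed.

Lemma opN f : a (- f) = - a f.
Proof. by rewrite -scaleN1r opZ scaleN1r. Qed.

Lemma opB f h : a (f - h) = a f - a h.
Proof. by rewrite opD opN. Qed.

Lemma op_sum (I : Type) (r : seq I) (F : I -> E) :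
  a (\sum_(i <- r) F i) = \sum_(i <- r) a (F i).
Proof. by elim: r => [|i r IH]; rewrite ?big_nil ?op0 // !big_cons opD IH. Qed.
End Linear.

Lemma gconv_linear s : linear (gconv s).
Proof.
move=> c f h; rewrite /gconv scaler_sumr -big_split; apply: eq_bigr => p _ /=.
by rewrite left_regular_linear scalerDr !scalerA mulrC.
Qed.

Lemma opb_gconv s : opb (gconv s) (\sum_(p <- s) normc p.1).
Proof.
move=> f; apply: le_trans (nrm_sum _ _) _; rewrite mulr_suml.
by apply: ler_sum => p _; rewrite nrmZ nrm_left_regular.
Qed.

Lemma sum_normc_ge0 s : 0 <= \sum_(p <- s) normc p.1.
Proof. by apply: sumr_ge0 => p _; exact: normc_ge0. Qed.

Lemma opb_le a (M N : R) : opb a M -> M <= N -> opb a N.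
Proof. by move=> aM MN f; apply: le_trans (aM f) _; rewrite ler_wpM2r ?nrm_ge0. Qed.

Lemma opb_eq0 a : (forall e, 0 < e -> opb a e) -> forall f, a f = 0.
Proof.
move=> ae f; apply: nrm_eq0; apply/eqP; rewrite eq_le nrm_ge0 andbT.
apply/ler_addgt0Pl => e e0; rewrite addr0.
have n0 : 0 < nrm f + 1 by have := nrm_ge0 f; lra.
apply: le_trans (ae (e / (nrm f + 1)) (divr_gt0 e0 n0) f) _.
rewrite mulrAC ler_pdivrMr //; rewrite ler_pM2l //; lra.
Qed.

(** [op_norm] is a supremum, meaningful only for a set bounded above; the bound [M] provides
    this. *)
Lemma opb_op_norm a (M : R) : linear a -> opb a M -> opb a (op_norm a).
Proof.
move=> al aM f; have [f0|f0] := eqVneq (nrm f) 0.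
  by rewrite (nrm_eq0 f0) (op0 al) nrm0 mulr0.
have fp : 0 < nrm f by rewrite lt0r f0 nrm_ge0.
have nz : normc (nrm f)%:C = nrm f.
  by rewrite /= expr0n addr0 sqrtr_sqr ger0_norm ?nrm_ge0.
rewrite -[nrm (a f)]mulr1 -(mulVf f0) mulrA ler_pM2r // mulrC.
have -> : (nrm f)^-1 * nrm (a f) = nrm (a ((nrm f)%:C^-1 *: f)).
  by rewrite (opZ al) nrmZ normcV nz.
apply: ub_le_sup.
  exists `|M| => _ [h /= h1 <-]; apply: le_trans (aM h) _.
  apply: (@le_trans _ _ (`|M| * nrm h)); first by rewrite ler_wpM2r ?nrm_ge0 ?ler_norm.
  by rewrite -[leRHS]mulr1 ler_wpM2l.
by exists ((nrm f)%:C^-1 *: f) => //=; rewrite nrmZ normcV nz mulVf.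
Qed.

Lemma op_norm_le a (M : R) : 0 <= M -> opb a M -> op_norm a <= M.
Proof.
move=> M0 aM; apply: ge_sup.
  by exists (nrm (a 0)), 0 => //=; rewrite nrm0 ler01.
move=> _ [h /= h1 <-]; apply: le_trans (aM h) _.
by rewrite -[leRHS]mulr1 ler_wpM2l.
Qed.

Definition op_near a b (e : R) := opb (fun f => a f - b f) e.

Local Notation A := (reduced_Cstar R G).

Lemma sub_linear a b : linear a -> linear b -> linear (fun f => a f - b f).
Proof. by move=> al bl c f h; rewrite al bl scalerBr opprD addrACA. Qed.

(** Trades [op_norm] for pointwise estimates; boundedness comes for free from a nearby
    convolution. *)
Lemma reducedP a :
  A a <-> linear a /\ forall e, 0 < e -> exists s, op_near a (gconv s) e.
Proof.
split=> [[[al [M aM]] cl]|[al ap]].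
  split=> // e e0; have [b /left_regular_spanE[s ->] ltb] := cl e e0.
  exists s; apply: opb_le (ltW ltb).
  apply: (@opb_op_norm _ (M + \sum_(p <- s) normc p.1)).
    exact: (sub_linear al (gconv_linear s)).
  move=> f; apply: le_trans (nrmD _ _) _; rewrite nrmN mulrDl.
  by apply: lerD; [exact: aM|exact: opb_gconv].
split.
  split=> //; have [s sP] := ap 1 ltr01; exists (1 + \sum_(p <- s) normc p.1) => f.
  have -> : a f = (a f - gconv s f) + gconv s f by rewrite subrK.
  apply: le_trans (nrmD _ _) _; rewrite mulrDl.
  by apply: lerD; [exact: sP|exact: opb_gconv].
move=> e e0; have e20 : 0 < e / 2 by lra.
have [s sP] := ap _ e20; exists (gconv s); first by apply/left_regular_spanE; exists s.
by apply: (@le_lt_trans _ _ (e / 2)); [apply: op_norm_le sP; lra|lra].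
Qed.

Lemma reduced_linear a : A a -> linear a.
Proof. by move=> /reducedP[]. Qed.

Lemma reduced_bounded a : A a -> exists2 M : R, 0 <= M & opb a M.
Proof.
move=> [[al [M aM]] _]; exists `|M| => // f.
by apply: le_trans (aM f) _; rewrite ler_wpM2r ?nrm_ge0 ?ler_norm.
Qed.

Lemma op_near_trans a b d (e e' : R) : op_near a b e -> op_near b d e' -> op_near a d (e + e').
Proof.
move=> ab bd f; have -> : a f - d f = (a f - b f) + (b f - d f) by rewrite addrA subrK.
by apply: le_trans (nrmD _ _) _; rewrite mulrDl lerD.
Qed.

Lemma op_near_sym a b (e : R) : op_near a b e -> op_near b a e.
Proof. by move=> ab f; rewrite nrmB; exact: ab. Qed.

Lemma reduced_lim a : linear a ->
  (forall e, 0 < e -> exists2 b, A b & op_near a b e) -> A a.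
Proof.
move=> al ab; apply/reducedP; split=> // e e0; have e20 : 0 < e / 2 by lra.
have [b /reducedP[_ bA] abe] := ab _ e20; have [s sP] := bA _ e20; exists s.
by have := op_near_trans abe sP; have -> : e / 2 + e / 2 = e by lra.
Qed.

Lemma reduced_gconv s : A (gconv s).
Proof.
apply/reducedP; split; first exact: gconv_linear.
by move=> e e0; exists s => f; rewrite subrr nrm0 mulr_ge0 ?nrm_ge0 // ltW.
Qed.

Lemma gconv1 c g f : gconv [:: (c, g)] f = c *: left_regular g f.
Proof. by rewrite /gconv big_seq1. Qed.

Lemma gconv_cat s t f : gconv (s ++ t) f = gconv s f + gconv t f.
Proof. by rewrite /gconv big_cat. Qed.

Lemma gconv_cons p s f : gconv (p :: s) f = p.1 *: left_regular p.2 f + gconv s f.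
Proof. by rewrite /gconv big_cons. Qed.

Lemma gconv_scale c s f : gconv [seq (c * p.1, p.2) | p <- s] f = c *: gconv s f.
Proof.
rewrite /gconv big_map scaler_sumr; apply: eq_bigr => p _ /=.
by rewrite scalerA.
Qed.

Lemma gconv_comp s t f :
  gconv s (gconv t f) = gconv [seq (p.1 * q.1, (p.2 * q.2)%g) | p <- s, q <- t] f.
Proof.
rewrite {1}/gconv /gconv big_allpairs_dep; apply: eq_bigr => p _.
rewrite (op_sum (@left_regular_linear R G p.2)) scaler_sumr; apply: eq_bigr => q _ /=.
by rewrite (opZ (@left_regular_linear R G p.2)) left_regularM scalerA.
Qed.

Lemma reduced_left_regular g : A (@left_regular R G g).
Proof.
suff -> : @left_regular R G g = gconv [:: (1, g)] by exact: reduced_gconv.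
by apply: funext => f; rewrite gconv1 scale1r.
Qed.

Lemma reduced_id : A id.
Proof.
suff -> : id = @left_regular R G 1%g by exact: reduced_left_regular.
by apply: funext => f; rewrite left_regular1.
Qed.

Lemma reduced_comb c a b : A a -> A b -> A (c *: a + b).
Proof.
move=> /reducedP[al aA] /reducedP[bl bA]; apply/reducedP; split.
  move=> d f h; rewrite !fctE /= al bl scalerDr !scalerDr !scalerA mulrC addrACA.
  by rewrite [d * c]mulrC.
move=> e e0; have c0 : 0 < normc c + 1 by have := normc_ge0 c; lra.
have [s sP] := aA (e / 2 / (normc c + 1)) ltac:(by rewrite divr_gt0 //; lra).
have [t tP] := bA (e / 2) ltac:(lra).
exists ([seq (c * p.1, p.2) | p <- s] ++ t) => f; rewrite gconv_cat gconv_scale !fctE /=.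
have -> : c *: a f + b f - (c *: gconv s f + gconv t f) =
    c *: (a f - gconv s f) + (b f - gconv t f).
  by rewrite scalerBr opprD addrACA.
apply: le_trans (nrmD _ _) _; rewrite nrmZ.
have -> : e * nrm f = e / 2 * nrm f + e / 2 * nrm f by lra.
apply: lerD; last exact: tP.
apply: (@le_trans _ _ ((normc c + 1) * nrm (a f - gconv s f))).
  by rewrite ler_wpM2r ?nrm_ge0 //; lra.
by rewrite mulrC -ler_pdivlMr // mulrAC; exact: sP.
Qed.

Lemma reduced0 : A 0.
Proof.
suff -> : (0 : E -> E) = gconv [::] by exact: reduced_gconv.
by apply: funext => f; rewrite /gconv big_nil.
Qed.

Lemma reducedZ c a : A a -> A (c *: a).
Proof. by move=> aA; rewrite -[c *: a]addr0; exact: reduced_comb aA reduced0. Qed.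

Lemma reducedD a b : A a -> A b -> A (a + b).
Proof. by move=> aA bA; rewrite -[a]scale1r; exact: reduced_comb. Qed.

Lemma reducedN a : A a -> A (- a).
Proof. by move=> aA; rewrite -scaleN1r; exact: reducedZ. Qed.

Lemma reducedB a b : A a -> A b -> A (a - b).
Proof. by move=> aA bA; exact: (reducedD aA (reducedN bA)). Qed.

Lemma reduced_sum (I : Type) (r : seq I) (F : I -> E -> E) :
  (forall i, A (F i)) -> A (\sum_(i <- r) F i).
Proof.
move=> FA; elim: r => [|i r IH]; first by rewrite big_nil; exact: reduced0.
by rewrite big_cons; exact: (reducedD (FA i) IH).
Qed.

Lemma opb_comp a b (M N : R) : 0 <= M -> opb a M -> opb b N -> opb (a \o b) (M * N).
Proof.
move=> M0 aM bN f; apply: le_trans (aM _) _.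
by rewrite -mulrA ler_wpM2l.
Qed.

Lemma reduced_comp a b : A a -> A b -> A (a \o b).
Proof.
move=> aA bA; have al := reduced_linear aA; have bl := reduced_linear bA.
apply: reduced_lim => [c f h /=|e e0]; first by rewrite bl al.
have [N N0 bN] := reduced_bounded bA.
have e1 : 0 < e / 2 / (N + 1) by rewrite !divr_gt0 //; lra.
have [_ /(_ _ e1) [s sP]] := (reducedP a).1 aA.
have M0 := sum_normc_ge0 s; set M := \sum_(p <- s) normc p.1 in M0.
have e2 : 0 < e / 2 / (M + 1) by rewrite !divr_gt0 //; lra.
have [_ /(_ _ e2) [t tP]] := (reducedP b).1 bA.
exists (gconv s \o gconv t).
  by rewrite (_ : _ \o _ = gconv [seq (p.1 * q.1, (p.2 * q.2)%g) | p <- s, q <- t]);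
    [exact: reduced_gconv|apply: funext => f /=; rewrite gconv_comp].
move=> f /=; have -> : a (b f) - gconv s (gconv t f) =
    (a (b f) - gconv s (b f)) + gconv s (b f - gconv t f).
  by rewrite (opB (gconv_linear s)) addrA subrK.
apply: le_trans (nrmD _ _) _.
have -> : e * nrm f = e / 2 * nrm f + e / 2 * nrm f by lra.
apply: lerD.
  apply: le_trans (sP _) _; apply: (@le_trans _ _ (e / 2 / (N + 1) * ((N + 1) * nrm f))).
    by rewrite ler_pM2l //; apply: le_trans (bN f) _; rewrite ler_wpM2r ?nrm_ge0 //; lra.
  by rewrite mulrA divfK // gt_eqF //; lra.
apply: le_trans (opb_gconv s _) _; rewrite -/M.
apply: (@le_trans _ _ ((M + 1) * (e / 2 / (M + 1) * nrm f))).
  by apply: ler_pM; [exact: M0|exact: nrm_ge0|lra|exact: tP].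
by rewrite mulrA [(M + 1) * _]mulrC divfK // gt_eqF //; lra.
Qed.
End OperatorAlgebra.

Ltac ell2_ring := apply: ell2P => ?; rewrite !(ell2DE, ell2NE, ell2ZE); ring.

(** * Inverses, adjoints and square roots inside the algebra *)

Section Limits.
Local Open Scope complex_scope.
Local Open Scope ring_scope.
Variables (R : realType) (G : groupType).
Local Notation E := (ell2 R G).
Local Notation C := R[i].
Local Notation nrm := (@ell2_norm R G).
Local Notation A := (reduced_Cstar R G).
Implicit Types (f h k : E) (g : G) (c z : C) (a b : E -> E) (s t : seq (C * G)).

Lemma nrm_pow2_eq0 f (K : R) : 0 <= K -> (forall n, nrm f <= K / 2 ^+ n) -> f = 0.
Proof.
move=> K0 h; apply: nrm_eq0; apply/eqP; rewrite eq_le nrm_ge0 andbT.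
by apply: (ler_add_pow2 K0) => m; rewrite add0r.
Qed.

Lemma op_limit (b_ : nat -> E -> E) (M : R) : 0 <= M -> (forall n, A (b_ n)) ->
  (forall n, op_near (b_ n.+1) (b_ n) (M / 2 ^+ n)) ->
  exists b, A b /\ forall n, op_near b (b_ n) (2 * (M / 2 ^+ n)).
Proof.
move=> M0 bA db.
have lim f : exists h, forall n, nrm (h - b_ n f) <= 2 * (M / 2 ^+ n) * nrm f.
  have [||h hP] := @ell2_complete R G (fun n => b_ n f) (M * nrm f).
  - by rewrite mulr_ge0 ?nrm_ge0.
  - by move=> n; rewrite mulrAC; exact: db.
  by exists h => n; rewrite -mulrA -[_ / _ * nrm f]mulrAC; exact: hP.
have [b bP] := choice lim; exists b; split; last by move=> n f; exact: bP.
have bl : linear b.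
  move=> c f h; apply/eqP; rewrite -subr_eq0; apply/eqP.
  apply: (@nrm_pow2_eq0 _ (2 * M * (nrm (c *: f + h) + normc c * nrm f + nrm h))).
    by rewrite mulr_ge0 ?addr_ge0 ?mulr_ge0 ?nrm_ge0 ?normc_ge0.
  move=> n; have bnl := reduced_linear (bA n).
  have -> : b (c *: f + h) - (c *: b f + b h) =
      (b (c *: f + h) - b_ n (c *: f + h)) - (c *: (b f - b_ n f) + (b h - b_ n h)).
    by rewrite (opD bnl) (opZ bnl); ell2_ring.
  apply: le_trans (nrmD _ _) _; rewrite nrmN.
  have h1 := bP (c *: f + h) n; have h2 := bP f n; have h3 := bP h n.
  have := nrmD (c *: (b f - b_ n f)) (b h - b_ n h); rewrite nrmZ.
  have := ler_wpM2l (normc_ge0 c) h2.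
  set u := nrm _ in h1 *; set v := 2 ^+ n; set w := M / v in h1 h2 h3 *.
  have -> : 2 * M * (nrm (c *: f + h) + normc c * nrm f + nrm h) / v =
    2 * w * nrm (c *: f + h) + normc c * (2 * w * nrm f) + 2 * w * nrm h.
    by rewrite /w; ring.
  by lra.
apply: reduced_lim => // e e0; have [n ne] := pow2_inv_small (mulr_ge0 (ler0n R 2) M0) e0.
exists (b_ n) => // f; apply: le_trans (bP f n) _; rewrite ler_wpM2r ?nrm_ge0 //.
by rewrite mulrA ltW.
Qed.

(** Neumann series: the iteration [b := id + (b - y \o b)] contracts by 1/2 because [id - y] has
    norm at most 1/2. *)
Lemma reduced_right_inverse y : A y -> op_near id y (1 / 2) ->
  exists2 b, A b & y \o b = id.
Proof.
move=> yA yid; have yl := reduced_linear yA.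
have [B [B0 BSn]] : exists B : nat -> E -> E,
    B 0%N = id /\ forall n, B n.+1 = id + (B n - (y \o B n)).
  by exists (fun n => iter n (fun b => id + (b - (y \o b))) id).
have BA n : A (B n).
  elim: n => [|n IH]; first by rewrite B0; exact: reduced_id.
  by rewrite BSn; exact: (reducedD (reduced_id R G) (reducedB IH (reduced_comp yA IH))).
have BS n f : B n.+1 f = f + (B n f - y (B n f)) by rewrite BSn.
have dB n : op_near (B n.+1) (B n) (1 / 2 ^+ n).
  elim: n => [|n IH] f.
    rewrite BS B0 expr0 divr1; have -> : f + (f - y f) - f = f - y f by ell2_ring.
    by apply: le_trans (yid f) _; rewrite ler_wpM2r ?nrm_ge0 //; lra.
  have -> : B n.+2 f - B n.+1 f = (B n.+1 f - B n f) - y (B n.+1 f - B n f).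
    by rewrite [B n.+2 f]BS (opB yl) [in B n.+1 f - B n f]BS; ell2_ring.
  apply: le_trans (yid _) _; have := IH f; rewrite [1 / 2 ^+ n]pow2_invS.
  set v := 1 / 2 ^+ n.+1; rewrite -mulrA; set w := v * nrm f; lra.
have [b [bA bB]] := op_limit ler01 BA dB; exists b => //; apply: funext => f /=.
have [N N0 yN] := reduced_bounded yA.
apply/eqP; rewrite -subr_eq0 -opprB oppr_eq0; apply/eqP.
apply: (@nrm_pow2_eq0 _ (nrm f + N * 2 * nrm f)).
  by rewrite addr_ge0 ?nrm_ge0 // !mulr_ge0 ?nrm_ge0.
move=> n; have -> : f - y (b f) = (B n.+1 f - B n f) + y (B n f - b f).
  by rewrite BS (opB yl); ell2_ring.
apply: le_trans (nrmD _ _) _; rewrite mulrDl; apply: lerD.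
  by have := dB n f; rewrite [_ * nrm f]mulrC mul1r.
apply: le_trans (yN _) _; rewrite -!mulrA ler_wpM2l // nrmB.
by have := bB n f; rewrite mul1r -!mulrA [_^-1 * _]mulrC.
Qed.

Lemma adjoint_sym a b : op_adjoint a b -> op_adjoint b a.
Proof. by move=> ab f h; rewrite dotC -ab -dotC. Qed.

Lemma adjoint_sub a a' b b' : op_adjoint a a' -> op_adjoint b b' ->
  op_adjoint (fun f => a f - b f) (fun f => a' f - b' f).
Proof. by move=> aa bb f h; rewrite dotDl dotNl dotDr dotNr aa bb. Qed.

Lemma adjointD a a' b b' : op_adjoint a a' -> op_adjoint b b' ->
  op_adjoint (a + b) (a' + b').
Proof. by move=> aa bb f h; rewrite !fctE /= dotDl dotDr aa bb. Qed.

Lemma adjointZ c a a' : op_adjoint a a' -> op_adjoint (c *: a) (c^*%C *: a').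
Proof. by move=> aa f h; rewrite !fctE /= dotZl dotZr conjcK aa. Qed.

Lemma adjoint_id : op_adjoint (@id E) id.
Proof. by []. Qed.

Lemma adjoint_comp a a' b b' : op_adjoint a a' -> op_adjoint b b' ->
  op_adjoint (a \o b) (b' \o a').
Proof. by move=> aa bb f h; rewrite /= aa bb. Qed.

Lemma normc_real (u : R) : normc u%:C = `|u|.
Proof. by rewrite /= expr0n addr0 sqrtr_sqr. Qed.

(** Cauchy-Schwarz for [a (a' f)] and [f]. *)
Lemma adjoint_opb a a' (M : R) : 0 <= M -> op_adjoint a a' -> opb a M -> opb a' M.
Proof.
move=> M0 aa aM f; have [v0|v0] := eqVneq (nrm (a' f)) 0.
  by rewrite v0 mulr_ge0 ?nrm_ge0.
have vp : 0 < nrm (a' f) by rewrite lt0r v0 nrm_ge0.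
have := cauchy_schwarz (a (a' f)) f; rewrite aa dotff normc_real ger0_norm ?sq_ge0 //.
rewrite -nrm_sq expr2 => h; rewrite -(ler_pM2l vp); apply: (le_trans h).
by rewrite mulrA ler_wpM2r ?nrm_ge0 // mulrC; exact: aM.
Qed.

Definition star s : seq (C * G) := [seq (p.1^*%C, p.2^-1%g) | p <- s].

Lemma adjoint_gconv s : op_adjoint (gconv s) (gconv (star s)).
Proof.
move=> f h; elim: s => [|p s IH]; first by rewrite /gconv !big_nil dot0l dot0r.
rewrite /star /= !gconv_cons dotDl dotDr IH; congr (_ + _).
by rewrite dotZl dotZr conjcK dot_left_regular.
Qed.

Lemma adjoint_lim a a' (a_ a'_ : nat -> E -> E) (K : R) : 0 <= K ->
  (forall n, op_adjoint (a_ n) (a'_ n)) -> (forall n, op_near a (a_ n) (K / 2 ^+ n)) ->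
  (forall n, op_near a' (a'_ n) (K / 2 ^+ n)) -> op_adjoint a a'.
Proof.
move=> K0 adj ha ha' f h; apply/eqP; rewrite -subr_eq0; apply/eqP/eq0_normc/eqP.
rewrite eq_le normc_ge0 andbT.
apply: (@ler_add_pow2 _ _ _ (2 * K * nrm f * nrm h)); first by rewrite !mulr_ge0 ?nrm_ge0.
move=> n; rewrite add0r.
have -> : ell2_dot (a f) h - ell2_dot f (a' h) =
    ell2_dot (a f - a_ n f) h + - ell2_dot f (a' h - a'_ n h).
  by rewrite dotDl dotNl dotDr dotNr adj; ring.
apply: le_trans (le_normcD _ _) _; rewrite normcN.
have h1 := cauchy_schwarz (a f - a_ n f) h; have h2 := cauchy_schwarz f (a' h - a'_ n h).
have h3 := ler_wpM2r (nrm_ge0 h) (ha n f); have h4 := ler_wpM2l (nrm_ge0 f) (ha' n h).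
set w := 2 ^+ n in h3 h4 *; have -> : 2 * K * nrm f * nrm h / w =
  K / w * nrm f * nrm h + nrm f * (K / w * nrm h) by ring.
by lra.
Qed.

(** The adjoint is the limit of the explicit adjoints of convolutions approximating [a]; these
    converge because passing to adjoints preserves bounds. *)
Lemma reduced_adjoint a : A a -> exists2 a', A a' & op_adjoint a a'.
Proof.
move=> /reducedP[al aA].
have ex n : exists s, op_near a (gconv s) (1 / 2 ^+ n).
  by apply: aA; rewrite divr_gt0 ?exprn_gt0.
have [s sP] := choice ex.
have p0 n : 0 <= 1 / 2 ^+ n :> R := pow2_inv_ge0 n ler01.
have step n : op_near (gconv (s n.+1)) (gconv (s n)) (2 / 2 ^+ n).
  apply: opb_le (op_near_trans (op_near_sym (sP n.+1)) (sP n)) _.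
  have := pow2_invS (1 : R) n; have := p0 n.+1.
  have -> : 2 / 2 ^+ n = 2 * (1 / 2 ^+ n) :> R by rewrite mul1r.
  by lra.
have step' n : op_near (gconv (star (s n.+1))) (gconv (star (s n))) (2 / 2 ^+ n).
  apply: (adjoint_opb (pow2_inv_ge0 n (ler0n R 2)) _ (step n)).
  exact: (adjoint_sub (adjoint_gconv (s n.+1)) (adjoint_gconv (s n))).
have [a' [a'A a'P]] := op_limit (ler0n R 2) (fun n => reduced_gconv (star (s n))) step'.
exists a' => //; apply: (@adjoint_lim _ _ (fun n => gconv (s n)) (fun n => gconv (star (s n))) 4).
- by [].
- by move=> n; exact: adjoint_gconv.
- by move=> n; apply: opb_le (sP n) _; have := p0 n; rewrite mul1r; lra.
- by move=> n; apply: opb_le (a'P n) _; lra.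
Qed.

(* [w = id - b] where [b] is the limit of the iteration [b := (a + b \o b) / 2]. *)
Lemma reduced_sqrt a : A a -> op_adjoint a a -> opb a (1 / 8) ->
  exists w, [/\ A w, op_adjoint w w & id - a = w \o w].
Proof.
move=> aA aa a8.
have [B [B0 BSn]] : exists B : nat -> E -> E,
    B 0%N = 0 /\ forall n, B n.+1 = (2^-1 : R)%:C *: (a + (B n \o B n)).
  by exists (fun n => iter n (fun b => (2^-1 : R)%:C *: (a + (b \o b))) 0).
have BA n : A (B n).
  elim: n => [|n IH]; first by rewrite B0; exact: reduced0.
  by rewrite BSn; exact: (reducedZ _ (reducedD aA (reduced_comp IH IH))).
have BS n f : B n.+1 f = (2^-1 : R)%:C *: (a f + B n (B n f)) by rewrite BSn.
have Bl n := reduced_linear (BA n).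
have nh : normc (2^-1 : R)%:C = 2^-1 :> R by rewrite normc_real ger0_norm.
(* The bound 1/4 is preserved since half of [1/8 + 1/16] is smaller, and it makes the iteration
   contract faster than the factor 1/2 that [op_limit] needs. *)
have B4 n : opb (B n) (1 / 4).
  elim: n => [|n IH] f.
    by rewrite B0 [X in nrm X](_ : _ = 0) // nrm0 mulr_ge0 ?nrm_ge0.
  rewrite BS nrmZ nh; have := nrmD (a f) (B n (B n f)).
  have := a8 f; have := IH f; have := IH (B n f); have := nrm_ge0 f; lra.
have BB n : op_adjoint (B n) (B n).
  elim: n => [|n IH]; first by rewrite B0 => f h; rewrite dot0l dot0r.
  rewrite BSn; have := adjointZ (2^-1 : R)%:C (adjointD aa (adjoint_comp IH IH)).
  by rewrite conjc_real.
have dB n : op_near (B n.+1) (B n) (1 / 2 ^+ n).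
  elim: n => [|n IH] f.
    rewrite B0 [(0 : E -> E) f](_ : _ = 0) // subr0 expr0.
    by have := B4 1%N f; have := nrm_ge0 f; lra.
  have -> : B n.+2 f - B n.+1 f = (2^-1 : R)%:C *:
     (B n.+1 (B n.+1 f - B n f) + (B n.+1 (B n f) - B n (B n f))).
    by rewrite [B n.+2 f]BS (opB (Bl n.+1)) [X in _ - X = _]BS; ell2_ring.
  rewrite nrmZ nh; have := nrmD (B n.+1 (B n.+1 f - B n f)) (B n.+1 (B n f) - B n (B n f)).
  have p0 : 0 <= 1 / 2 ^+ n.+1 :> R := pow2_inv_ge0 n.+1 ler01.
  have h1 := B4 n.+1 (B n.+1 f - B n f); have h2 := IH f; have h3 := IH (B n f).
  have h4 := ler_wpM2l p0 (B4 n f); rewrite [1 / 2 ^+ n]pow2_invS in h2 h3.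
  set v := 1 / 2 ^+ n.+1 in p0 h2 h3 h4 *.
  have e1 : v * (1 / 4 * nrm f) = 1 / 4 * (v * nrm f) by ring.
  have e2 : 2 * v * nrm f = 2 * (v * nrm f) by ring.
  have e3 : 2 * v * nrm (B n f) = 2 * (v * nrm (B n f)) by ring.
  rewrite e1 in h4; rewrite e2 in h2; rewrite e3 in h3.
  have : 0 <= v * nrm f by rewrite mulr_ge0 ?nrm_ge0.
  set w1 := v * nrm f in h2 h4 *; set w2 := v * nrm (B n f) in h3 h4 *; lra.
have [b [bA bB]] := op_limit ler01 BA dB.
have bl := reduced_linear bA; have [N N0 bN] := reduced_bounded bA.
have bE f : b f = (2^-1 : R)%:C *: (a f + b (b f)).
  apply/eqP; rewrite -subr_eq0; apply/eqP.
  apply: (@nrm_pow2_eq0 _ (2 * nrm f + (N * 2 * nrm f + 2 * nrm f))).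
    by rewrite !addr_ge0 // !mulr_ge0 ?nrm_ge0.
  move=> n; have -> : b f - (2^-1 : R)%:C *: (a f + b (b f)) =
      (b f - B n.+1 f) - (2^-1 : R)%:C *: (b (b f - B n f) + (b (B n f) - B n (B n f))).
    by rewrite BS (opB bl); ell2_ring.
  apply: le_trans (nrmD _ _) _; rewrite nrmN nrmZ nh.
  have := nrmD (b (b f - B n f)) (b (B n f) - B n (B n f)).
  have h1 := bB n.+1 f; have h2 := bB n f; have h3 := bB n (B n f).
  have h4 := bN (b f - B n f); have h5 := ler_wpM2l N0 h2; have h6 := B4 n f.
  have p0 : 0 <= 1 / 2 ^+ n.+1 :> R := pow2_inv_ge0 n.+1 ler01.
  have h7 := ler_wpM2l p0 h6; rewrite [1 / 2 ^+ n]pow2_invS in h2 h3 h5.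
  have -> : (2 * nrm f + (N * 2 * nrm f + 2 * nrm f)) / 2 ^+ n =
     (4 * nrm f + (N * 4 * nrm f + 4 * nrm f)) * (1 / 2 ^+ n.+1).
    have := pow2_invS (1 : R) n; rewrite !mul1r => ->; ring.
  set v := 1 / 2 ^+ n.+1 in h1 h2 h3 h5 p0 h7 *.
  have q1 : 0 <= v * nrm f by rewrite mulr_ge0 ?nrm_ge0.
  have q2 : 0 <= N * (v * nrm f) by rewrite mulr_ge0.
  have e1 : N * (2 * (2 * v) * nrm f) = 4 * (N * (v * nrm f)) by ring.
  have e2 : (4 * nrm f + (N * 4 * nrm f + 4 * nrm f)) * v =
    8 * (v * nrm f) + 4 * (N * (v * nrm f)) by ring.
  have e3 : v * (1 / 4 * nrm f) = 1 / 4 * (v * nrm f) by ring.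
  have e4 : 2 * (2 * v) * nrm (B n f) = 4 * (v * nrm (B n f)) by ring.
  have e5 : 2 * v * nrm f = 2 * (v * nrm f) by ring.
  rewrite e1 in h5; rewrite e2; rewrite e3 in h7; rewrite e4 in h3; rewrite e5 in h1.
  set w1 := v * nrm f in h1 h7 q1 h5 q2 *; set w2 := v * nrm (B n f) in h3 h7.
  by set w3 := N * w1 in h5 q2 *; lra.
exists (id - b); split.
- exact: (reducedB (reduced_id R G) bA).
- apply: (adjoint_sub adjoint_id).
  apply: (@adjoint_lim _ _ B B 2) => // n; apply: opb_le (bB n) _; lra.
- apply: funext => f; rewrite !fctE /= (opB bl).
  have half : (2^-1 : R)%:C + (2^-1 : R)%:C = 1 :> C.
    by rewrite -rmorphD (_ : 2^-1 + 2^-1 = 1 :> R) ?rmorph1 //; lra.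
  have e2 : b f + b f = a f + b (b f).
    have := bE f; set X := a f + b (b f) => e.
    by rewrite e -scalerDl half scale1r.
  have -> : a f = b f + b f - b (b f) by rewrite e2 addrK.
  by ell2_ring.
Qed.
End Limits.

(** * Averages over conjugates and Powers' estimate *)

Section Averaging.
Local Open Scope complex_scope.
Local Open Scope ring_scope.
Variables (R : realType) (G : groupType).
Local Notation E := (ell2 R G).
Local Notation C := R[i].
Local Notation nrm := (@ell2_norm R G).
Local Notation A := (reduced_Cstar R G).
Implicit Types (f h : E) (g x y : G) (c z : C) (a b : E -> E) (s t : seq (C * G)).

Definition tr a : C := a (delta R 1%g) 1%g.

Lemma tr_bound a (M : R) : opb a M -> normc (tr a) <= M.
Proof.
move=> aM; apply: le_trans (normc_le_nrm _ _) _.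
by have := aM (delta R 1%g); rewrite nrm_delta mulr1.
Qed.

Lemma tr_left_regular g : tr (@left_regular R G g) = (g == 1%g)%:R.
Proof. by rewrite /tr left_regular_delta mulg1 deltaE eq_sym. Qed.

Definition average (gs : seq G) a : E -> E :=
  ((size gs)%:R^-1 : C) *: \sum_(g <- gs) (@left_regular R G g \o (a \o @left_regular R G g^-1%g)).

Lemma averageE gs a f : average gs a f =
  ((size gs)%:R^-1 : C) *: \sum_(g <- gs) left_regular g (a (left_regular g^-1%g f)).
Proof. by rewrite /average fct_sumE. Qed.

Lemma normc_natV n : normc (n%:R^-1 : C) = n%:R^-1.
Proof.
have -> : (n%:R^-1 : C) = (n%:R^-1 : R)%:C by rewrite fmorphV rmorph_nat.
by rewrite normc_real ger0_norm ?invr_ge0.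
Qed.

Lemma opb_average gs a (M : R) : gs != [::] -> opb a M -> opb (average gs a) M.
Proof.
move=> gs0 aM f; rewrite averageE nrmZ normc_natV.
have n0 : (0 < size gs)%N by case: (gs) gs0.
rewrite mulrC ler_pdivrMr ?ltr0n //; apply: le_trans (nrm_sum _ _) _.
apply: (@le_trans _ _ (\sum_(g <- gs) M * nrm f)).
  by apply: ler_sum => g _; rewrite nrm_left_regular (le_trans (aM _)) // nrm_left_regular.
by rewrite big_const_seq count_predT iter_addr addr0 [leRHS]mulr_natr.
Qed.

Lemma average_near gs a b (e : R) : gs != [::] -> op_near a b e ->
  op_near (average gs a) (average gs b) e.
Proof.
move=> gs0 ab f.
have -> : average gs a f - average gs b f = average gs (fun f => a f - b f) f.
  rewrite !averageE -scalerBr -sumrB; congr (_ *: _); apply: eq_bigr => g _.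
  by rewrite (opB (@left_regular_linear R G g)).
exact: opb_average gs0 ab f.
Qed.

Lemma reduced_average gs a : A a -> A (average gs a).
Proof.
move=> aA; apply: reducedZ; apply: reduced_sum => g.
exact: (reduced_comp (reduced_left_regular R g) (reduced_comp aA (reduced_left_regular R _))).
Qed.

Lemma average_comb gs c a b f :
  average gs (c *: a + b) f = c *: average gs a f + average gs b f.
Proof.
rewrite !averageE scalerA [c * _]mulrC -scalerA -scalerDr; congr (_ *: _).
rewrite scaler_sumr -big_split; apply: eq_bigr => g _ /=.
by rewrite (opD (@left_regular_linear R G g)) (opZ (@left_regular_linear R G g)).
Qed.

Lemma average_id gs f : gs != [::] -> average gs id f = f.
Proof.
move=> gs0; have n0 : (size gs)%:R != 0 :> C by rewrite pnatr_eq0; case: (gs) gs0.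
rewrite averageE (eq_bigr (fun=> f)); last first.
  by move=> g _; rewrite left_regularM mulgV left_regular1.
by rewrite big_const_seq count_predT iter_addr addr0 -[f *+ _](@scaler_nat C) scalerA mulVf ?scale1r.
Qed.

Lemma normc_sum_sq (I : Type) (r : seq I) (u : I -> C) :
  normc (\sum_(i <- r) u i) ^+ 2 <= (size r)%:R * \sum_(i <- r) normc (u i) ^+ 2.
Proof.
elim: r => [|i [|j r] IH]; first by rewrite !big_nil normc0 expr0n mulr0.
  by rewrite !big_seq1 mul1r.
rewrite big_cons [in leRHS]big_cons; set S := \sum_(k <- _) u k in IH *.
set T := \sum_(k <- _) _ in IH *; set n := size _ in IH.
have n0 : (0 : R) < n%:R by rewrite ltr0n.
apply: le_trans (normc_sqD (u i) S n0) _.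
have -> : (size [:: i, j & r])%:R = 1 + n%:R :> R by rewrite -natr1 addrC.
rewrite mulrDr; apply: lerD => //.
have -> : (1 + n%:R) * T = (1 + n%:R^-1) * (n%:R * T) by field; rewrite gt_eqF.
by rewrite ler_wpM2l // addr_ge0 // invr_ge0 ltW.
Qed.

(* Powers' estimate: in [sum_j lambda (k j)] split each summand at the set
   [D j], which [k j] maps its complement into; the [D j] are disjoint. *)
Lemma powers_estimate n (k : nat -> G) (D : nat -> G -> bool) f :
  (forall j x, (j < n)%N -> ~~ D j x -> D j ((k j)^-1 * x)%g) ->
  (forall i j x, (i < n)%N -> (j < n)%N -> D i x -> D j x -> i = j) ->
  nrm (\sum_(j <- iota 0 n) left_regular (k j) f) <= 2 * Num.sqrt n%:R * nrm f.
Proof.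
move=> kD Ddisj; apply: nrm_le => [|B].
  by rewrite !mulr_ge0 ?sqrtr_ge0 ?nrm_ge0.
rewrite !exprMn sqr_sqrtr ?ler0n // nrm_sq.
have -> : (2 : R) ^+ 2 * n%:R * sq f = 2 * (n%:R * sq f) + 2 * (n%:R * sq f) by ring.
pose v j x := f ((k j)^-1 * x)%g.
have SE x : (\sum_(j <- iota 0 n) left_regular (k j) f : E) x = \sum_(j <- iota 0 n) v j x.
  by elim: (iota 0 n) => [|j r IH]; rewrite ?big_nil // !big_cons -IH.
have -> : (\sum_(j <- iota 0 n) left_regular (k j) f : G -> C) =
   (fun x => \sum_(j <- iota 0 n | D j x) v j x) \+
   (fun x => \sum_(j <- iota 0 n | ~~ D j x) v j x).
  by apply: funext => x; rewrite SE /= [LHS](bigID (fun j => D j x)).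
apply: le_trans (fsumD _ _ _ ltr01) _; rewrite invr1.
have -> : (1 + 1 : R) = 2 by ring.
have in_n j : j \in iota 0 n -> (j < n)%N by rewrite mem_iota.
apply: lerD; rewrite ler_pM2l //.
  (* Each point lies in at most one [D j], so the square of the sum has only one term. *)
  apply: (@le_trans _ _ (\sum_(j <- iota 0 n) fsum (v j) B)).
    rewrite /fsum exchange_big /=; apply: ler_sum => x _.
    have [/hasP[j jn Dj]|/hasPn no] := boolP (has (fun j => D j x) (iota 0 n)); last first.
      rewrite big_seq_cond big1 ?normc0 ?expr0n; last by move=> j /andP[/no /negPf ->].
      by apply: sumr_ge0 => j _; rewrite sqr_ge0.
    rewrite big_mkcond (bigD1_seq j) ?iota_uniq //= Dj [X in _ + X]big_seq_cond.
    rewrite [X in _ + X]big1 ?addr0; last first.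
      move=> i /andP[ni ij]; case: ifP => // Di; move/negP: ij; case; apply/eqP.
      exact: (Ddisj i j x (in_n _ ni) (in_n _ jn) Di Dj).
    rewrite (bigD1_seq j) ?iota_uniq //= lerDl.
    by apply: sumr_ge0 => i _; rewrite sqr_ge0.
  apply: (@le_trans _ _ (\sum_(j <- iota 0 n) sq f)).
    apply: ler_sum => j _; rewrite -[v j]/(translate (k j) f) fsum_translate.
    exact: fsum_le.
  by rewrite big_const_seq count_predT size_iota iter_addr addr0 mulr_natl.
(* Off [D j] the point [(k j)^-1 * x] lies in [D j]. After this change of variable the terms are
   parts of [f] on disjoint sets, and Cauchy-Schwarz costs the factor [n]. *)
pose w j x : C := (D j x)%:R * f x.
pose B' := [fset y in flatten [seq [seq ((k j)^-1 * x)%g | x <- enum_fset B] | j <- iota 0 n]]%fset.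
apply: (@le_trans _ _ (n%:R * \sum_(j <- iota 0 n) fsum (w j) B')).
  apply: (@le_trans _ _ (n%:R * \sum_(j <- iota 0 n)
      fsum (w j) [fset ((k j)^-1 * x)%g | x in B]%fset)); last first.
    rewrite ler_wpM2l // big_seq [leRHS]big_seq; apply: ler_sum => j jn.
    apply: fsum_subset; apply/fsubsetP => y /imfsetP[x /= xB ->]; rewrite inE.
    by apply/flatten_mapP; exists j => //; apply/mapP; exists x.
  rewrite /fsum mulr_sumr; under [leRHS]eq_bigr => j _.
    rewrite big_imfset /=; last by move=> x y _ _; exact: mulgI.
    over.
  rewrite -mulr_sumr exchange_big /= mulr_sumr; apply: ler_sum => x _.
  rewrite -big_filter; apply: le_trans (normc_sum_sq _ _) _.
  apply: ler_pM; rewrite ?ler0n //.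
    by apply: sumr_ge0 => j _; rewrite sqr_ge0.
    by rewrite ler_nat size_filter (leq_trans (count_size _ _)) // size_iota.
  rewrite big_filter big_mkcond big_seq [leRHS]big_seq; apply: ler_sum => j jn.
  case: ifP => [nD|_]; last by rewrite sqr_ge0.
  by rewrite /w kD ?mul1r //; exact: in_n.
rewrite ler_wpM2l //; apply: le_trans (fsum_le f B'); rewrite /fsum exchange_big /=.
apply: ler_sum => x _.
have [/hasP[j jn Dj]|/hasPn no] := boolP (has (fun j => D j x) (iota 0 n)); last first.
  rewrite big_seq big1 ?sqr_ge0 // => j /no /negPf nD.
  by rewrite /w nD mul0r normc0 expr0n.
rewrite (bigD1_seq j) ?iota_uniq //= [X in _ + X]big_seq_cond [X in _ + X]big1 ?addr0.
  by rewrite /w Dj mul1r.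
move=> i /andP[ni ij]; have /negPf nD : ~~ D i x.
  apply/negP => Di; move/negP: ij; apply; apply/eqP.
  exact: (Ddisj i j x (in_n _ ni) (in_n _ jn) Di Dj).
by rewrite /w nD mul0r normc0 expr0n.
Qed.

(** Conjugation of [x] by the [g i] carries [D] to its disjoint translates; [powers_estimate]
    divided by [n] gives the bound. *)
Lemma powers_average (F : seq G) n : (0 < n)%N -> powers_property G -> 1%g \notin F ->
  exists2 gs : seq G, gs != [::] &
    forall x, x \in F -> opb (average gs (@left_regular R G x)) (2 / Num.sqrt n%:R).
Proof.
move=> n0 pow F1; have [D [g [h1 h2]]] := pow F n F1.
exists [seq g i | i <- iota 0 n]; first by case: (n) n0.
move=> x xF f; rewrite averageE size_map size_iota big_map nrmZ normc_natV.
have n1 : (0 : R) < n%:R by rewrite ltr0n.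
have sn : 0 < Num.sqrt n%:R :> R by rewrite sqrtr_gt0.
have -> : 2 / Num.sqrt n%:R = n%:R^-1 * (2 * Num.sqrt n%:R) :> R.
  by rewrite -{2}(sqr_sqrtr (ltW n1)); field; rewrite gt_eqF.
rewrite -mulrA ler_pM2l ?invr_gt0 //.
under eq_bigr do rewrite !left_regularM.
pose k j : G := (g j * x * (g j)^-1)%g.
pose D' j y := D ((g j)^-1 * y)%g.
have k1 j y : (j < n)%N -> ~~ D' j y -> D' j ((k j)^-1 * y)%g.
  rewrite /D' /k => jn nD; have := h1 x _ xF nD.
  by rewrite !invgM invgK !mulgA mulVg mul1g.
have k2 i j y : (i < n)%N -> (j < n)%N -> D' i y -> D' j y -> i = j by exact: h2.
exact: (powers_estimate f k1 k2).
Qed.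

(** For a finite convolution near [a], averaging keeps the coefficient at 1 and makes all other
    terms small, as one choice of conjugators serves the whole set [F]. *)
Lemma dixmier a (e : R) : powers_property G -> A a -> 0 < e ->
  exists2 gs : seq G, gs != [::] & op_near (average gs a) (fun f => tr a *: f) e.
Proof.
move=> pow /reducedP[al aA] e0; have e40 : 0 < e / 4 by lra.
have [s sP] := aA _ e40; pose M := \sum_(p <- s) normc p.1.
have M0 : 0 <= M := sum_normc_ge0 s.
pose F := [seq p.2 | p <- s & p.2 != 1%g].
have F1 : 1%g \notin F.
  by apply/mapP => -[p]; rewrite mem_filter => /andP[/eqP p1 _] /esym.
have [n n0 nM] : exists2 n, (0 < n)%N & M * (2 / Num.sqrt n%:R) <= e / 4.
  pose u := 8 * M / e; have u0 : 0 <= u by rewrite divr_ge0 ?mulr_ge0 // ltW.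
  have := archi_boundP (sqr_ge0 (u + 1)); set n := Num.bound _ => nu.
  have u10 : 0 < u + 1 by lra.
  have un : u + 1 <= Num.sqrt n%:R.
    by rewrite -[u + 1]ger0_norm ?(ltW u10) // -sqrtr_sqr ler_wsqrtr // ltW.
  have sn : 0 < Num.sqrt n%:R :> R by lra.
  exists n; first by rewrite -(ltr0n R); apply: lt_trans nu; rewrite exprn_gt0.
  rewrite mulrA ler_pdivrMr //.
  have -> : M * 2 = e / 4 * u by rewrite /u; field; rewrite gt_eqF.
  by rewrite ler_pM2l //; lra.
have [gs gs0 gsP] := powers_average n0 pow F1; exists gs => //.
set eta := 2 / Num.sqrt n%:R in nM gsP.
have eta0 : 0 <= eta by rewrite divr_ge0 // sqrtr_ge0.
have key t : {subset t <= s} -> op_near (average gs (gconv t)) (fun f => tr (gconv t) *: f)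
    ((\sum_(p <- t) normc p.1) * eta).
  elim: t => [|p t IH] ts f.
    rewrite big_nil mul0r mul0r averageE.
    have z h : gconv [::] h = 0 :> E by rewrite /gconv big_nil.
    rewrite (eq_bigr (fun=> 0)); last by move=> g _; rewrite z (op0 (@left_regular_linear R G g)).
    by rewrite big1_eq scaler0 /tr z ell20E scale0r subr0 nrm0.
  have -> : gconv (p :: t) = p.1 *: @left_regular R G p.2 + gconv t.
    by apply: funext => h; rewrite gconv_cons.
  rewrite average_comb -[tr _]/(p.1 * tr (@left_regular R G p.2) + tr (gconv t)).
  have -> : p.1 *: average gs (@left_regular R G p.2) f + average gs (gconv t) f -
      (p.1 * tr (@left_regular R G p.2) + tr (gconv t)) *: f =
    p.1 *: (average gs (@left_regular R G p.2) f - tr (@left_regular R G p.2) *: f) +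
    (average gs (gconv t) f - tr (gconv t) *: f) by ell2_ring.
  apply: le_trans (nrmD _ _) _; rewrite big_cons !mulrDl; apply: lerD; last first.
    by apply: IH => q qt; apply: ts; rewrite inE qt orbT.
  rewrite nrmZ -mulrA ler_wpM2l ?normc_ge0 // tr_left_regular.
  have [p1|p1] := eqVneq p.2 1%g.
    have -> : average gs (@left_regular R G p.2) f = f.
      rewrite -[RHS](average_id f gs0); congr (average gs _ f).
      by apply: funext => h; rewrite p1 left_regular1.
    by rewrite scale1r subrr nrm0 mulr_ge0 ?nrm_ge0.
  rewrite scale0r subr0; apply: gsP; apply/mapP; exists p => //.
  by rewrite mem_filter p1 ts // inE eqxx.
have k1 := average_near gs0 sP.
have k2 := key s (fun=> id).
have k3 : op_near (fun f => tr (gconv s) *: f) (fun f => tr a *: f) (e / 4).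
  move=> f; rewrite -scalerBl nrmZ ler_wpM2r ?nrm_ge0 //.
  have -> : tr (gconv s) - tr a = - tr (fun f => a f - gconv s f).
    by rewrite /tr ell2DE ell2NE; ring.
  by rewrite normcN; apply: tr_bound.
apply: opb_le (op_near_trans (op_near_trans k1 k2) k3) _.
by rewrite -/M; lra.
Qed.
End Averaging.

(** * Simplicity, and uniqueness and automatic continuity of the trace *)

Section Dixmier.
Local Open Scope complex_scope.
Local Open Scope ring_scope.
Variables (R : realType) (G : groupType).
Local Notation E := (ell2 R G).
Local Notation C := R[i].
Local Notation nrm := (@ell2_norm R G).
Local Notation A := (reduced_Cstar R G).
Implicit Types (f h : E) (g x y : G) (c z : C) (a b : E -> E) (s t : seq (C * G)).

Lemma tr_dot a : tr a = ell2_dot (a (delta R 1%g)) (delta R 1%g).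
Proof. by rewrite dot_delta. Qed.

Lemma normc_small z (M : R) : (forall e : R, 0 < e -> normc z <= M * e) -> z = 0.
Proof.
move=> zM; apply/eq0_normc/eqP; rewrite eq_le normc_ge0 andbT leNgt; apply/negP => z0.
have d0 : 0 < 2 * (`|M| + 1) by have := normr_ge0 M; lra.
have := zM _ (divr_gt0 z0 d0); have := ler_norm M; have := normr_ge0 M.
rewrite mulrA ler_pdivlMr //; set N := `|M|; set w := normc z in z0 * => h1 h2 h3.
have : M * w <= N * w by rewrite ler_pM2r.
have : 0 <= N * w by rewrite mulr_ge0 // ltW.
lra.
Qed.

Lemma op_eq0 a (M : R) : linear a -> opb a M -> (forall g, a (delta R g) = 0) -> a = 0.
Proof.
move=> al aM a0; apply: funext => f; apply: nrm_eq0.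
suff [] : (nrm (a f))%:C = 0 :> C by [].
apply: (@normc_small _ M) => e e0; rewrite normc_real ger0_norm ?nrm_ge0 //.
have [B fB] := finite_support_dense f e0.
have -> : a f = a (f - \sum_(x <- B) f x *: delta R x).
  rewrite (opB al) (op_sum al) big1 ?subr0 // => x _.
  by rewrite (opZ al) a0 scaler0.
have M0 : 0 <= M.
  by have := aM (delta R 1%g); rewrite nrm_delta mulr1; apply: le_trans; exact: nrm_ge0.
by apply: le_trans (aM _) _; rewrite ler_wpM2l // ltW.
Qed.

Lemma ideal_average I gs a : two_sided_ideal A I -> I a -> I (average gs a).
Proof.
move=> [_ I0 Ic Im] aI.
have IZ c b : I b -> I (c *: b) by move=> bI; rewrite -[_ *: _]addr0; exact: Ic.
apply: IZ; elim: gs => [|g gs IH]; first by rewrite big_nil.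
rewrite big_cons -[X in X + _]scale1r; apply: Ic IH.
have [_ h] := Im _ _ (reduced_left_regular R g^-1%g) aI.
by have [] := Im _ _ (reduced_left_regular R g) h.
Qed.

Lemma powers_simple : powers_property G -> simple_algebra A.
Proof.
move=> pow I idI; have [IA I0 Ic Im] := idI.
have [[a aI a0]|noa] := pselect (exists2 a, I a & a <> 0); last first.
  left; apply/seteqP; split=> [a aI|a ->//].
  by apply: contrapT => a0; apply: noa; exists a.
right; have [M M0 aM] := reduced_bounded (IA _ aI).
have [g ag] : exists g, a (delta R g) <> 0.
  apply: contrapT => no; apply: a0; apply: (op_eq0 (reduced_linear (IA _ aI)) aM) => g.
  by apply: contrapT => ag; apply: no; exists g.
pose a' := a \o @left_regular R G g.
have a'I : I a' by have [] := Im _ _ (reduced_left_regular R g) aI.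
set d := delta R (1%g : G).
have a'd : a' d = a (delta R g) by rewrite /a' /= left_regular_delta mulg1.
have n0 : 0 < nrm (a' d).
  by rewrite lt0r nrm_ge0 andbT; apply/eqP => /nrm_eq0; rewrite a'd.
have n20 : 0 < nrm (a' d) / 2 by lra.
have [_ /(_ _ n20) [s sP]] := (reducedP a').1 (IA _ a'I).
(* The trace of [y] is the inner product of [a' d] with [gconv s d], which is non-zero because these
   vectors differ by at most half of [nrm (a' d)]. *)
pose y := gconv (star s) \o a'.
have yI : I y by have [] := Im _ _ (reduced_gconv (star s)) a'I.
have y0 : tr y != 0.
  apply/eqP; rewrite tr_dot -/d (adjoint_sym (adjoint_gconv s)) => e.
  have := cauchy_schwarz (a' d) (a' d - gconv s d).
  rewrite dotDr dotNr e oppr0 addr0 dotff normc_real ger0_norm ?sq_ge0 // -nrm_sq expr2.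
  rewrite ler_pM2l //; have := sP d; rewrite nrm_delta; lra.
pose z := (tr y)^-1 *: y.
have zI : I z by rewrite /z -[_ *: _]addr0; exact: Ic.
have z1 : tr z = 1 by rewrite -[tr z]/((tr y)^-1 * tr y) mulVf.
have e0 : (0 : R) < 1 / 2 by lra.
have [gs gs0 gsP] := dixmier pow (IA _ zI) e0.
have bI := ideal_average gs idI zI.
have bid : op_near id (average gs z) (1 / 2).
  by apply: op_near_sym => f; have := gsP f; rewrite z1 scale1r.
have [b bA bE] := reduced_right_inverse (IA _ bI) bid.
have idI' : I id by rewrite -bE; have [_] := Im _ _ bA bI.
apply/seteqP; split=> // x xA.
by have [] := Im _ _ xA idI'.
Qed.

Lemma tr_left_regular_comm g s :
  tr (@left_regular R G g \o gconv s) = tr (gconv s \o @left_regular R G g).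
Proof.
have gl := @left_regular_linear R G g.
elim: s => [|p s IH].
  congr tr; apply: funext => f; rewrite !fctE.
  by rewrite /gconv !big_nil (op0 gl).
have -> : tr (@left_regular R G g \o gconv (p :: s)) =
    p.1 * tr (@left_regular R G (g * p.2)%g) + tr (@left_regular R G g \o gconv s).
  rewrite /tr [(_ \o _) _](_ : _ = left_regular g (gconv (p :: s) (delta R 1%g))) //.
  by rewrite gconv_cons (opD gl) (opZ gl) left_regularM.
have -> : tr (gconv (p :: s) \o @left_regular R G g) =
    p.1 * tr (@left_regular R G (p.2 * g)%g) + tr (gconv s \o @left_regular R G g).
  by rewrite /tr /= gconv_cons left_regularM.
rewrite IH !tr_left_regular; congr (_ * _%:R + _); congr nat_of_bool.
have mul1C (x y : G) : (x * y = 1)%g -> (y * x = 1)%g.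
  by move=> e; rewrite -[y](mulKg x) e mulg1 mulVg.
by apply/eqP/eqP; exact: mul1C.
Qed.

(** [tr_comm] uses this twice, so that only one factor is approximated at a time. *)
Lemma tr_comm_lim a : A a -> (forall s, tr (a \o gconv s) = tr (gconv s \o a)) ->
  forall b, A b -> tr (a \o b) = tr (b \o a).
Proof.
move=> aA as_ b bA; apply/eqP; rewrite -subr_eq0; apply/eqP.
have [M M0 aM] := reduced_bounded aA; have al := reduced_linear aA.
have [_ bs] := (reducedP b).1 bA.
apply: (@normc_small _ (2 * M)) => e e0; have [s sP] := bs _ e0.
have -> : tr (a \o b) - tr (b \o a) =
   tr (a \o (fun f => b f - gconv s f)) - tr ((fun f => b f - gconv s f) \o a).
  have -> : tr (a \o (fun f => b f - gconv s f)) = tr (a \o b) - tr (a \o gconv s).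
    by rewrite /tr /= (opB al).
  have -> : tr ((fun f => b f - gconv s f) \o a) = tr (b \o a) - tr (gconv s \o a).
    by [].
  by rewrite as_; ring.
apply: le_trans (le_normcD _ _) _; rewrite normcN.
have e0' := ltW e0.
have := tr_bound (opb_comp M0 aM sP); have := tr_bound (opb_comp e0' sP aM).
have -> : 2 * M * e = e * M + M * e by ring.
lra.
Qed.

Lemma tr_comm a b : A a -> A b -> tr (a \o b) = tr (b \o a).
Proof.
move=> aA bA; apply: tr_comm_lim => // s; symmetry.
apply: tr_comm_lim aA; first exact: reduced_gconv.
move=> t; elim: s => [|p s IH].
  have z h : gconv [::] h = 0 :> E by rewrite /gconv big_nil.
  by rewrite /tr /= !z (op0 (gconv_linear t)).
have -> : tr (gconv (p :: s) \o gconv t) =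
    p.1 * tr (@left_regular R G p.2 \o gconv t) + tr (gconv s \o gconv t).
  by rewrite /tr /= gconv_cons.
have -> : tr (gconv t \o gconv (p :: s)) =
    p.1 * tr (gconv t \o @left_regular R G p.2) + tr (gconv t \o gconv s).
  by rewrite /tr /= gconv_cons (opD (gconv_linear t)) (opZ (gconv_linear t)).
by rewrite IH tr_left_regular_comm.
Qed.

Lemma tr_ge0 a a' : op_adjoint a a' -> 0 <= tr (a' \o a).
Proof.
by move=> aa; rewrite tr_dot /= (adjoint_sym aa) dotff lecR sq_ge0.
Qed.

Lemma tr_normalized : normalized_trace A (@tr R G).
Proof.
split=> //; first by rewrite /tr deltaE eqxx.
  by move=> a a' _ _; exact: tr_ge0.
exact: tr_comm.
Qed.

Section Trace.
Local Open Scope complex_scope.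
Local Open Scope ring_scope.
Variable sigma : (E -> E) -> C.
Hypothesis trace : normalized_trace A sigma.

Lemma trace_comb c a b : A a -> A b -> sigma (c *: a + b) = c * sigma a + sigma b.
Proof. by case: trace => h _ _ _; exact: h. Qed.

Lemma trace0 : sigma 0 = 0.
Proof.
have := trace_comb 1 (reduced0 R G) (reduced0 R G).
rewrite scale1r addr0 mul1r => e.
by apply: (@addrI _ (sigma 0)); rewrite -e addr0.
Qed.

Lemma traceZ c a : A a -> sigma (c *: a) = c * sigma a.
Proof.
by move=> aA; rewrite -[_ *: _]addr0 (trace_comb c aA (reduced0 R G)) trace0 addr0.
Qed.

Lemma traceD a b : A a -> A b -> sigma (a + b) = sigma a + sigma b.
Proof. by move=> aA bA; rewrite -[X in X + _]scale1r (trace_comb 1 aA bA) mul1r. Qed.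

Lemma trace_average gs a : gs != [::] -> A a -> sigma (average gs a) = sigma a.
Proof.
move=> gs0 aA; pose u g := @left_regular R G g \o (a \o @left_regular R G g^-1%g).
have agA g : A (a \o @left_regular R G g^-1%g).
  exact: (reduced_comp aA (reduced_left_regular R g^-1%g)).
have uA g : A (u g) := reduced_comp (reduced_left_regular R g) (agA g).
have us g : sigma (u g) = sigma a.
  case: trace => _ _ _ h; rewrite /u (h _ _ (reduced_left_regular R g) (agA g)).
  by congr (sigma _); apply: funext => f; rewrite /= left_regularM mulVg left_regular1.
rewrite /average (traceZ _ (reduced_sum gs uA)).
have -> : sigma (\sum_(g <- gs) u g) = \sum_(g <- gs) sigma (u g).
  elim: gs {gs0} => [|g gs IH]; first by rewrite !big_nil trace0.
  by rewrite !big_cons (traceD (uA g) (reduced_sum gs uA)) IH.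
under eq_bigr do rewrite us.
rewrite big_const_seq count_predT iter_addr addr0 -[sigma a *+ _]mulr_natl mulrA mulVf ?mul1r //.
by rewrite pnatr_eq0; case: (gs) gs0.
Qed.

(** [id - a] is the square of a self-adjoint element of the algebra, where positivity applies. *)
Lemma trace_selfadjoint a : A a -> op_adjoint a a -> opb a (1 / 8) -> 0 <= 1 - sigma a.
Proof.
move=> aA aa a8; have [w [wA ww e]] := reduced_sqrt aA aa a8.
have [_ s1 sp _] := trace; have := sp _ _ wA wA ww.
rewrite -e (_ : id - a = -1 *: a + id); last by rewrite scaleN1r addrC.
by rewrite (trace_comb _ aA (reduced_id R G)) s1 mulN1r addrC.
Qed.

(** Divide [a] by [8 * M] and use both signs. Comparability with 0 in the complex numbers also
    forces [sigma a] to be real. *)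
Lemma trace_bound_selfadjoint a (M : R) : 0 < M -> A a -> op_adjoint a a -> opb a M ->
  normc (sigma a) <= 8 * M.
Proof.
move=> M0 aA aa aM; have M80 : 0 < 8 * M by lra.
pose r := (8 * M)^-1; have r0 : 0 < r by rewrite invr_gt0.
have small (k : R) : `|k| = r -> 0 <= 1 - k%:C * sigma a.
  move=> kr; rewrite -(traceZ _ aA); apply: trace_selfadjoint.
  - exact: reducedZ.
  - by have := adjointZ k%:C aa; rewrite conjc_real.
  - move=> f; rewrite [nrm _](nrmZ k%:C (a f)) normc_real kr.
    have -> : 1 / 8 * nrm f = r * (M * nrm f) by rewrite /r; field; rewrite gt_eqF.
    by rewrite ler_pM2l.
have := small r; have := small (- r); rewrite normrN (gtr0_norm r0).
case: (sigma a) => u v /(_ erefl) h1 /(_ erefl) h2.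
move: h1 h2; rewrite !lecE /= => /andP[/eqP h1 h2] /andP[_ h3].
have v0 : v = 0.
  have : r * v = 0 by move: h1; lra.
  by move/eqP; rewrite mulf_eq0 gt_eqF //= => /eqP.
rewrite v0 expr0n addr0 sqrtr_sqr -(ler_pM2l r0) mulVf ?gt_eqF //.
have -> : r * `|u| = `|r * u| by rewrite normrM (gtr0_norm r0).
by rewrite ler_norml; apply/andP; split; rewrite v0 in h2 h3; lra.
Qed.

(** Continuity of the trace: the self-adjoint parts [p] and [q] of [a] contribute [8 * M] each. *)
Lemma trace_bound a (M : R) : 0 < M -> A a -> opb a M -> normc (sigma a) <= 16 * M.
Proof.
move=> M0 aA aM; have [b bA ab] := reduced_adjoint aA.
have bM := adjoint_opb (ltW M0) ab aM; have ba := adjoint_sym ab.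
pose p := (2^-1 : R)%:C *: (a + b); pose q := ((2^-1 : R)%:C * 'i) *: (b - a).
have nh : normc (2^-1 : R)%:C = 2^-1 :> R by rewrite normc_real ger0_norm.
have ni : normc ('i : C) = 1 by rewrite /= expr0n expr1n add0r sqrtr1.
have pA : A p := reducedZ _ (reducedD aA bA).
have qA : A q := reducedZ _ (reducedB bA aA).
have pp : op_adjoint p p.
  have := adjointZ (2^-1 : R)%:C (adjointD ab ba).
  by rewrite conjc_real [b + a]addrC.
have qq : op_adjoint q q.
  have := adjointZ ((2^-1 : R)%:C * 'i) (adjoint_sub ba ab).
  have -> : ((2^-1 : R)%:C * 'i)^*%C = - ((2^-1 : R)%:C * 'i).
    by apply/eqP; rewrite eq_complex /=; apply/andP; split; apply/eqP; ring.
  rewrite scaleNr -scalerN.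
  have -> : - ((fun f => a f - b f) : E -> E) = b - a.
    by apply: funext => f; rewrite !fctE; ell2_ring.
  by [].
have pM : opb p M.
  move=> f; rewrite [nrm _](nrmZ _ (a f + b f)) nh.
  have := nrmD (a f) (b f); have := aM f; have := bM f; lra.
have qM : opb q M.
  move=> f; rewrite [nrm _](nrmZ _ (b f - a f)) normcM nh ni mulr1.
  have := nrmD (b f) (- a f); rewrite nrmN; have := aM f; have := bM f; lra.
have aE : a = 'i *: q + p.
  apply: funext => f; rewrite !fctE scalerA -[_ * (_ * 'i)]mulrCA -expr2 sqr_i.
  have half : (2^-1 : R)%:C + (2^-1 : R)%:C = 1 :> C.
    by rewrite -rmorphD (_ : 2^-1 + 2^-1 = 1 :> R) ?rmorph1 //; lra.
  transitivity (((2^-1 : R)%:C + (2^-1 : R)%:C) *: a f); first by rewrite half scale1r.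
  by ell2_ring.
rewrite aE (trace_comb _ qA pA); apply: le_trans (le_normcD _ _) _; rewrite normcM ni mul1r.
have := trace_bound_selfadjoint M0 pA pp pM; have := trace_bound_selfadjoint M0 qA qq qM.
lra.
Qed.

(** [sigma] is constant on averages of [a] and continuous, so its value is that at their limit
    [tr a *: id]. *)
Lemma powers_trace_eq a : powers_property G -> A a -> sigma a = tr a.
Proof.
move=> pow aA; apply/eqP; rewrite -subr_eq0; apply/eqP.
apply: (@normc_small _ 16) => e e0; have [gs gs0 gsP] := dixmier pow aA e0.
rewrite -(trace_average gs0 aA).
have avA := reduced_average gs aA; have [_ s1 _ _] := trace.
have -> : sigma (average gs a) - tr a = sigma (- tr a *: id + average gs a).
  by rewrite (trace_comb _ (reduced_id R G) avA) s1 mulr1 addrC.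
apply: (trace_bound e0 (reduced_comb _ (reduced_id R G) avA)).
move=> f; have -> : (- tr a *: (@id E) + average gs a) f = average gs a f - tr a *: f.
  by rewrite !fctE scaleNr addrC.
exact: gsP.
Qed.
End Trace.

Lemma powers_unique_trace : powers_property G -> has_unique_trace A.
Proof.
move=> pow; exists (@tr R G); first exact: tr_normalized.
by move=> tau tauP a aA; exact: powers_trace_eq.
Qed.

End Dixmier.

(** * Central projections of finite normal subgroups *)

Section FiniteNormal.
Local Open Scope complex_scope.
Local Open Scope ring_scope.
Variables (R : realType) (G : groupType).
Local Notation E := (ell2 R G).
Local Notation C := R[i].
Local Notation nrm := (@ell2_norm R G).
Local Notation A := (reduced_Cstar R G).
Implicit Types (f h : E) (g x y : G) (c z : C) (a b : E -> E).
Variable s : seq G.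
Hypothesis s_uniq : uniq s.
Hypothesis s1 : 1%g \in s.
Hypothesis sM : forall x y, x \in s -> y \in s -> (x * y)%g \in s.
Hypothesis sV : forall x, x \in s -> x^-1%g \in s.
Hypothesis sJ : forall x g, x \in s -> (x ^ g)%g \in s.

Definition subgroup_proj : E -> E := gconv [seq ((size s)%:R^-1, x) | x <- s].
Local Notation p := subgroup_proj.

Lemma subgroup_projE f : p f = ((size s)%:R^-1 : C) *: \sum_(x <- s) left_regular x f.
Proof. by rewrite /p /gconv big_map /= scaler_sumr. Qed.

Lemma size_s_neq0 : (size s)%:R != 0 :> C.
Proof. by rewrite pnatr_eq0; case: (s) s1. Qed.

Lemma reduced_subgroup_proj : A p.
Proof. exact: reduced_gconv. Qed.

Let pl := reduced_linear reduced_subgroup_proj.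

(** An injective self-map of a finite set is a permutation; this serves translations, inversion and
    conjugations alike. *)
Lemma sum_perm (u : G -> G) f : injective u -> (forall x, x \in s -> u x \in s) ->
  \sum_(x <- s) left_regular (u x) f = \sum_(x <- s) left_regular x f.
Proof.
move=> ui us; rewrite -(big_map u xpredT (fun x => left_regular x f)).
apply: perm_big; have mu : uniq (map u s) by rewrite map_inj_uniq.
apply: uniq_perm => //.
have sub : {subset map u s <= s} by move=> _ /mapP[x xs ->]; exact: us.
by have [] := uniq_min_size mu sub; rewrite ?size_map.
Qed.

Lemma left_regular_subgroup_proj x f : x \in s -> left_regular x (p f) = p f.
Proof.
move=> xs; rewrite !subgroup_projE (opZ (@left_regular_linear R G x)).
rewrite (op_sum (@left_regular_linear R G x)); congr (_ *: _).
under eq_bigr do rewrite left_regularM.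
by apply: (sum_perm f (@mulgI G x)) => y ys; exact: sM.
Qed.

Lemma subgroup_proj_idem f : p (p f) = p f.
Proof.
rewrite [LHS]subgroup_projE big_seq.
rewrite (eq_bigr (fun=> p f)) => [|x xs]; last exact: left_regular_subgroup_proj.
rewrite -big_seq big_const_seq count_predT iter_addr addr0 -[p f *+ _](@scaler_nat C).
by rewrite scalerA mulVf ?size_s_neq0 // scale1r.
Qed.

Lemma subgroup_proj_left_regular g f : p (left_regular g f) = left_regular g (p f).
Proof.
rewrite !subgroup_projE (opZ (@left_regular_linear R G g)).
rewrite (op_sum (@left_regular_linear R G g)); congr (_ *: _).
under [RHS]eq_bigr do rewrite left_regularM.
rewrite -(sum_perm _ (@conjg_inj G g^-1%g)) => [|x xs]; last exact: sJ.
apply: eq_bigr => x _.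
by rewrite !left_regularM conjgE invgK -!mulgA mulVg mulg1.
Qed.

Lemma subgroup_proj_gconv t f : p (gconv t f) = gconv t (p f).
Proof.
elim: t => [|q t IH]; first by rewrite /gconv !big_nil (op0 pl).
by rewrite !gconv_cons (opD pl) (opZ pl) subgroup_proj_left_regular IH.
Qed.

(** Normality gives commutation with convolutions, and approximation extends it to the algebra. *)
Lemma subgroup_proj_central a : A a -> p \o a = a \o p.
Proof.
move=> aA; apply: funext => f; apply/eqP; rewrite -subr_eq0; apply/eqP.
have [M M0 pM] := reduced_bounded reduced_subgroup_proj.
have [_ at_] := (reducedP a).1 aA.
apply: (opb_eq0 (a := fun h => p (a h) - a (p h))) => e e0.
have M1 : 0 < 2 * M + 1 by lra.
have [t tP] := at_ _ (divr_gt0 e0 M1); move=> h.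
have -> : p (a h) - a (p h) = p (a h - gconv t h) - (a (p h) - gconv t (p h)).
  by rewrite (opB pl) subgroup_proj_gconv; ell2_ring.
apply: le_trans (nrmD _ _) _; rewrite nrmN.
set e' := e / _ in tP; have e'0 : 0 <= e' by rewrite ltW // divr_gt0.
have h1 := tP (p h); have h2 := ler_wpM2l e'0 (pM h).
have h3 := pM (a h - gconv t h); have h4 := ler_wpM2l M0 (tP h).
have -> : e * nrm h = e' * (M * nrm h) + M * (e' * nrm h) + e' * nrm h.
  by rewrite /e'; field; rewrite gt_eqF.
have := nrm_ge0 h; have : 0 <= e' * nrm h by rewrite mulr_ge0 ?nrm_ge0.
lra.
Qed.

Lemma adjoint_subgroup_proj : op_adjoint p p.
Proof.
move=> f h; rewrite (adjoint_gconv _ f h); congr ell2_dot.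
rewrite subgroup_projE /star -map_comp /gconv big_map /= -scaler_sumr; congr (_ *: _).
  by rewrite conjc_inv conjc_nat.
by rewrite (sum_perm h (@invg_inj G)).
Qed.

Lemma tr_subgroup_proj : tr p = (size s)%:R^-1.
Proof.
have -> : tr p = (size s)%:R^-1 * \sum_(x <- s) tr (@left_regular R G x).
  rewrite /tr subgroup_projE; congr (_ * _).
  by elim: (s) => [|x r IH]; rewrite ?big_nil // !big_cons -IH.
under eq_bigr do rewrite tr_left_regular.
rewrite (bigD1_seq 1%g) //= eqxx big1 ?addr0 ?mulr1 // => x /negPf ->.
by [].
Qed.

(** Simplicity and uniqueness of the trace are both exploited by deriving [tr p = 1]. *)
Lemma size_of_tr : tr p = 1 -> s = [:: 1%g].
Proof.
rewrite tr_subgroup_proj => /eqP; rewrite invr_eq1 (eqr_nat _ _ 1%N).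
by case: (s) s1 => [|x [|]] //; rewrite inE => /eqP ->.
Qed.

Lemma simple_subgroup_trivial : simple_algebra A -> s = [:: 1%g].
Proof.
move=> simp; apply: size_of_tr.
have pp : p \o p = p by apply: funext => f; exact: subgroup_proj_idem.
have pA := reduced_subgroup_proj.
pose I := [set a | A a /\ p \o a = a].
have idI : two_sided_ideal A I.
  split=> [a []//||c a b [aA pa] [bA pb]|a b aA [bA pb]].
  - by split; [exact: reduced0|apply: funext => f; exact: (op0 pl)].
  - split; first exact: (reduced_comb c aA bA).
    apply: funext => f; rewrite /= !fctE (opD pl) (opZ pl).
    by rewrite -[p (a f)]/((p \o a) f) -[p (b f)]/((p \o b) f) pa pb.
  - split; split; [exact: (reduced_comp aA bA)| |exact: (reduced_comp bA aA)|].
    + by rewrite compA (subgroup_proj_central aA) -compA pb.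
    + by rewrite compA pb.
have pI : I p by [].
case: (simp I idI) => IE.
  have p0 : p = 0 by move: pI; rewrite IE.
  have := size_s_neq0; rewrite -invr_eq0 -tr_subgroup_proj p0 /tr.
  by rewrite [X in X != 0](_ : _ = 0) ?eqxx.
have [_ pid] : I id by rewrite IE; exact: reduced_id.
have -> : p = id by exact: pid.
by rewrite /tr deltaE eqxx.
Qed.

Lemma unique_trace_subgroup_trivial : has_unique_trace A -> s = [:: 1%g].
Proof.
case=> sigma _ sigmaP; apply: size_of_tr.
have pp : p \o p = p by apply: funext => f; exact: subgroup_proj_idem.
have pA := reduced_subgroup_proj; have pC := subgroup_proj_central.
pose tau a : C := (size s)%:R * tr (p \o a).
have tauP : normalized_trace A tau.
  split=> [c a b aA bA||a a' aA a'A aa|a b aA bA].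
  - rewrite /tau.
    have -> : tr (p \o (c *: a + b)) = c * tr (p \o a) + tr (p \o b).
      by rewrite /tr /= (opD pl) (opZ pl).
    by ring.
  - by rewrite /tau -[p \o id]/p tr_subgroup_proj mulfV // size_s_neq0.
  - rewrite mulr_ge0 //.
    (* Centrality and idempotence turn the argument into the adjoint of [p \o a] times [p \o a]. *)
    have -> : p \o (a' \o a) = (a' \o p) \o (p \o a).
      apply: funext => f; have := congr1 (fun b => b (a f)) (pC _ a'A).
      by rewrite /= subgroup_proj_idem.
    exact: (tr_ge0 (adjoint_comp adjoint_subgroup_proj aa)).
  - rewrite /tau; congr (_ * _).
    by rewrite compA (tr_comm (reduced_comp pA aA) bA) compA -(pC _ bA).
have := sigmaP _ tauP _ pA; rewrite -(sigmaP _ (tr_normalized R G) _ pA) => <-.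
by rewrite /tau pp tr_subgroup_proj mulfV // size_s_neq0.
Qed.
End FiniteNormal.

Lemma finite_normal_seq (G : groupType) (N : set G) : normal_subgroup N -> finite_set N ->
  exists s : seq G, N = [set` s] /\
   [/\ uniq s, 1%g \in s,
    forall x y, x \in s -> y \in s -> (x * y)%g \in s,
    forall x, x \in s -> x^-1%g \in s &
    forall x g, x \in s -> (x ^ g)%g \in s].
Proof.
move=> [Nsub NJ] /finite_seqP[r Nr]; exists (undup r).
have NE x : N x <-> x \in undup r by rewrite mem_undup Nr.
have N1 : N 1%g by apply: set_mem; case: Nsub.
have ND x y : N x -> N y -> N (x * y^-1)%g.
  by move=> Nx Ny; apply: set_mem; case: Nsub => _; apply; exact: mem_set.
have NV x : N x -> N x^-1%g by move=> Nx; rewrite -[x^-1%g]mul1g; exact: ND.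
split; first by apply/seteqP; split=> x /=; rewrite NE.
split=> [||x y /NE xN /NE yN|x /NE xN|x g /NE xN]; rewrite ?undup_uniq //; apply/NE => //.
- by rewrite -[y]invgK; apply: ND => //; exact: NV.
- exact: NV.
- exact: NJ.
Qed.

Lemma simple_no_finite_normal (R : realType) (G : groupType) :
  simple_algebra (reduced_Cstar R G) -> no_nontrivial_finite_normal_subgroup G.
Proof.
move=> simp N nN fN; have [s [-> [su s1 sM sV sJ]]] := finite_normal_seq nN fN.
rewrite (simple_subgroup_trivial su s1 sM sJ simp).
by apply/seteqP; split=> x /=; rewrite inE => /eqP.
Qed.

Lemma unique_trace_no_finite_normal (R : realType) (G : groupType) :
  has_unique_trace (reduced_Cstar R G) -> no_nontrivial_finite_normal_subgroup G.
Proof.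
move=> uni N nN fN; have [s [-> [su s1 sM sV sJ]]] := finite_normal_seq nN fN.
rewrite (unique_trace_subgroup_trivial su s1 sM sV sJ uni).
by apply/seteqP; split=> x /=; rewrite inE => /eqP.
Qed.

Theorem corollary2 (R : realType) (G : groupType)
  (G_countable : countable [set: G])
  (G_nonelementary : ~ elementary G)
  (G_relhyp : exists (Lambda : Type) (H : Lambda -> subgroupType G),
    (forall l, (H l : set G) <> [set: G]) /\ relatively_hyperbolic R H) :
  [<-> simple_algebra (reduced_Cstar R G);
       has_unique_trace (reduced_Cstar R G);
       icc G;
       no_nontrivial_finite_normal_subgroup G].
Proof.
(* Condition (iv) yields both icc and Powers' property; the arrows leaving (i) and (ii) pass through
   it. *)
have powers := relhyp_powers G_nonelementary G_relhyp.
split=> [/simple_no_finite_normal/powers[_ pow]|]; first exact: powers_unique_trace.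
split=> [/unique_trace_no_finite_normal/powers[]//|].
split=> [|/powers[_ pow]]; first exact: icc_no_finite_normal.
exact: powers_simple.
Qed.
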